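(* Let $(Y,\Delta)$ be a smooth compact orbifold. If $(Y,\Delta)$ is hyperbolic, then the orbifold automorphism group $\mathrm{Aut}(Y,\Delta)$ is finite.
   Context: All varieties are complex, irreducible, reduced and normal. An orbifold (pair) $(X,\Delta)$ is a variety $X$ with a Weil $\mathbb{Q}$-divisor $\Delta=\sum_i (1-\frac{1}{m_i})\Delta_i$, where the $\Delta_i$ are distinct irreducible divisors and $m_i\in\mathbb{N}\cup\{\infty\}$, $m_i\ge 1$. The orbifold multiplicity $m_X(E)$ of an irreducible divisor $E\subset X$ is $m_i$ if $E=\Delta_i$, and $1$ if $E$ is not a component of $\Delta$. $\lceil\Delta\rceil$ denotes the support of $\Delta$ and $\lfloor\Delta\rfloor$ the union of the components with infinite multiplicity. $(X,\Delta)$ is compact if $X$ is compact and $\lfloor\Delta\rfloor=\emptyset$; it is smooth if $X$ is smooth and $\lceil\Delta\rceil$ is a simple normal crossing divisor. A holomorphic map $f:X\to Y$ is an orbifold morphism $(X,\Delta_X)\to(Y,\Delta_Y)$ if (1) $f(X)\not\subset\lceil\Delta_Y\rceil$, and (2) for all irreducible divisors $D\subset Y$, $E\subset X$ with $f^*(D)=t_{E,D}E+R$, $t_{E,D}\ge 1$, $R$ effective not containing $E$, one has $t_{E,D}\,m_X(E)\ge m_Y(D)$. An orbifold morphism from the unit disk $\mathbb{D}$ to $(X,\Delta)$ is a holomorphic map $h:\mathbb{D}\to X$ with $h(\mathbb{D})\not\subset\lceil\Delta\rceil$ and $\mathrm{mult}_x(h^*\Delta_i)\ge m_i$ for all $i$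 and all $x$ with $h(x)\in\Delta_i$ (if $m_i=\infty$ one requires $h(\mathbb{D})\cap\Delta_i=\emptyset$). The orbifold Kobayashi pseudo-distance $d_{(X,\Delta)}$ is the largest pseudo-distance on $X\setminus\lfloor\Delta\rfloor$ with $h^*d_{(X,\Delta)}\le d_P$ for every orbifold morphism $h:\mathbb{D}\to(X,\Delta)$, $d_P$ being the Poincaré distance. $(X,\Delta)$ is hyperbolic if $d_{(X,\Delta)}$ is a distance on $X\setminus\lfloor\Delta\rfloor$. $\mathrm{Aut}(Y,\Delta)$ is the set of biholomorphic maps $f:Y\to Y$ which are orbifold morphisms $(Y,\Delta)\to(Y,\Delta)$. *)

(* Defs.v *)
From HB Require Import structures.
From mathcomp Require Import all_boot all_order all_algebra.
From mathcomp Require Import all_classical all_reals all_analysis.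
From mathcomp Require Import complex.

Set Implicit Arguments.
Unset Strict Implicit.
Unset Printing Implicit Defensive.

Import Order.TTheory GRing.Theory Num.Theory.
Import numFieldNormedType.Exports.

Local Open Scope classical_set_scope.
Local Open Scope ring_scope.

(* Typed as a numClosedFieldType so that it and 'rV[Cplx R]_n carry the
   canonical normed-module structure over the complex numbers: [differentiable]
   below is then complex differentiability, and "differentiable at every point
   of an open set" is holomorphy. *)
Definition Cplx (R : realType) : numClosedFieldType := R[i].

Section Manifolds.
Variables (R : realType).
Local Notation C := (Cplx R).

(* [chart_map] and [chart_inv] are total functions; only their values on
   [chart_dom] and on its image are meaningful. *)
Record chart (M : topologicalType) (n : nat) := Chart {
  chart_dom : set M;
  chart_map :> M -> 'rV[C]_n;
  chart_inv : 'rV[C]_n -> M;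
  chart_dom_open : open chart_dom;
  chart_img_open : open (chart_map @` chart_dom);
  chart_mapK : forall x, chart_dom x -> chart_inv (chart_map x) = x;
  chart_map_cont : forall x, chart_dom x -> {for x, continuous chart_map};
  chart_inv_cont :
    forall x, chart_dom x -> {for chart_map x, continuous chart_inv} }.

Definition transition_holomorphic (M : topologicalType) (n : nat)
    (c c' : chart M n) : Prop :=
  forall x, chart_dom c x -> chart_dom c' x ->
    differentiable (c' \o chart_inv c) (c x).

Record complexManifold (n : nat) := ComplexManifold {
  carrier :> topologicalType;
  atlas : set (chart carrier n);
  atlas_cover : forall x, exists2 c, atlas c & chart_dom c x;
  atlas_compatible :
    forall c c', atlas c -> atlas c' -> transition_holomorphic c c';
  carrier_hausdorff : hausdorff_space carrier;
  carrier_second_countable : @second_countable carrier }.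

(* Membership in the maximal atlas. *)
Definition holomorphic_chart (n : nat) (X : complexManifold n)
    (c : chart X n) : Prop :=
  forall c', atlas c' ->
    transition_holomorphic c c' /\ transition_holomorphic c' c.

Definition holomorphic_map (n m : nat)
    (X : complexManifold n) (Y : complexManifold m) (f : X -> Y) : Prop :=
  forall x, {for x, continuous f} /\
    forall c c', atlas c -> atlas c' -> chart_dom c x -> chart_dom c' (f x) ->
      differentiable (c' \o f \o chart_inv c) (c x).

Definition biholomorphic (n m : nat)
    (X : complexManifold n) (Y : complexManifold m) (f : X -> Y) : Prop :=
  holomorphic_map f /\
  exists g : Y -> X, [/\ holomorphic_map g, cancel f g & cancel g f].

Section Functions.
Variables (n : nat) (X : complexManifold n).

Definition holomorphic_near (g : X -> C) (p : X) : Prop :=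
  \forall q \near p, forall c, atlas c -> chart_dom c q ->
    differentiable (g \o chart_inv c) (c q).

Definition analytic_subset (A : set X) : Prop :=
  closed A /\
  forall p, A p -> exists (k : nat) (F : 'I_k -> X -> C),
    (forall i, holomorphic_near (F i) p) /\
    \forall q \near p, A q <-> forall i, F i q = 0.

Definition irreducible_analytic (A : set X) : Prop :=
  [/\ analytic_subset A, A !=set0 &
    forall B1 B2, analytic_subset B1 -> analytic_subset B2 ->
      A = B1 `|` B2 -> A = B1 \/ A = B2].

(* Pure codimension one: locally the zero set of a single holomorphic function
   which vanishes identically on no nonempty open set. *)
Definition analytic_hypersurface (D : set X) : Prop :=
  [/\ closed D, D° = set0 &
    forall p, D p -> exists g : X -> C,
      holomorphic_near g p /\ \forall q \near p, D q <-> g q = 0].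

Definition irreducible_divisor (D : set X) : Prop :=
  analytic_hypersurface D /\ irreducible_analytic D.

(* The germ of g at p generates the ideal of germs at p vanishing on D, i.e.
   g is a reduced equation of D near p (a unit if p is not in D). *)
Definition local_equation (D : set X) (p : X) (g : X -> C) : Prop :=
  [/\ holomorphic_near g p,
      \forall q \near p, D q -> g q = 0 &
      forall h : X -> C, holomorphic_near h p ->
        (\forall q \near p, D q -> h q = 0) ->
        exists2 u : X -> C, holomorphic_near u p &
          \forall q \near p, h q = g q * u q].

Definition smooth_hypersurface (D : set X) : Prop :=
  closed D /\
  forall p, D p -> exists (c : chart X n) (j : 'I_n),
    [/\ holomorphic_chart c, chart_dom c p, c p = 0 &
      forall q, chart_dom c q -> (D q <-> c q ord0 j = 0)].

Definition normal_crossing (S : set X) : Prop :=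
  closed S /\
  forall p, S p -> exists (c : chart X n) (J : {set 'I_n}),
    [/\ holomorphic_chart c, chart_dom c p, c p = 0 &
      forall q, chart_dom c q ->
        (S q <-> exists2 j, j \in J & c q ord0 j = 0)].

End Functions.

(* f^*(D) = t E + R with R effective and not containing E, expressed by local
   equations: near the points of E, f^*(D) is the divisor of g \o f, tE that of
   e ^+ t, and R that of r. *)
Definition pullback_multiplicity (n m : nat)
    (X : complexManifold n) (Y : complexManifold m) (f : X -> Y)
    (D : set Y) (E : set X) (t : nat) : Prop :=
  forall p, E p -> exists (g : Y -> C) (e r : X -> C),
    [/\ local_equation D (f p) g, local_equation E p e, holomorphic_near r p,
        \forall q \near p, g (f q) = e q ^+ t * r q &
        ~ \forall q \near p, E q -> r q = 0].

End Manifolds.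

(* Multiplicities in {1, 2, ...} U {oo}; None stands for oo. *)
Definition multiplicity := option nat.

Definition mult_le (m1 m2 : multiplicity) : Prop :=
  match m1, m2 with
  | _, None => True
  | None, Some _ => False
  | Some a, Some b => (a <= b)%N
  end.

(* Only used with t >= 1, so that t * oo = oo. *)
Definition mult_scale (t : nat) (m : multiplicity) : multiplicity :=
  omap (muln t) m.

Section Orbifolds.
Variables (R : realType).
Local Notation C := (Cplx R).

(* The divisor \sum_i (1 - 1/m_i) Delta_i is recorded by its components Delta_i
   and their multiplicities m_i. *)
Record orbifold (n : nat) (X : complexManifold R n) := Orbifold {
  orb_size : nat;
  orb_comp : 'I_orb_size -> set X;
  orb_mult : 'I_orb_size -> multiplicity;
  orb_comp_irreducible : forall i, irreducible_divisor (orb_comp i);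
  orb_comp_distinct : injective orb_comp;
  orb_mult_ge1 : forall i, mult_le (Some 1%N) (orb_mult i) }.

Section Pairs.
Variables (n : nat) (X : complexManifold R n) (Delta : orbifold X).

Definition orb_multiplicity (E : set X) : multiplicity :=
  if [pick i : 'I_(orb_size Delta) | `[< orb_comp i = E >]] is Some i
  then orb_mult i else Some 1%N.

(* Components of multiplicity 1 have coefficient 0 in the divisor, hence are
   not in its support. *)
Definition orb_support : set X :=
  [set x | exists i : 'I_(orb_size Delta),
    orb_mult i <> Some 1%N /\ orb_comp i x].

Definition orb_floor : set X :=
  [set x | exists i : 'I_(orb_size Delta), orb_mult i = None /\ orb_comp i x].

Definition compact_orbifold : Prop :=
  compact [set: X] /\ orb_floor = set0.

(* X itself is smooth, being a manifold. *)
Definition smooth_orbifold : Prop :=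
  normal_crossing orb_support /\
  forall i : 'I_(orb_size Delta), orb_mult i <> Some 1%N ->
    smooth_hypersurface (orb_comp i).

Definition unit_disk : set C := [set z | `|z| < 1].

(* A map from the disk is a total function on C of which only the restriction
   to the disk matters. *)
Definition holomorphic_disk (h : C -> X) : Prop :=
  forall z, unit_disk z -> {for z, continuous h} /\
    forall c, atlas c -> chart_dom c (h z) -> differentiable (c \o h) z.

(* mult_z(h^* D) >= k: (w - z)^k divides the pullback of an equation of D. *)
Definition disk_multiplicity_ge (h : C -> X) (D : set X) (z : C) (k : nat) :
    Prop :=
  exists g : X -> C, local_equation D (h z) g /\
    exists psi : C -> C, (\forall w \near z, differentiable psi w) /\
      \forall w \near z, g (h w) = (w - z) ^+ k * psi w.

Definition orbifold_disk (h : C -> X) : Prop :=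
  [/\ holomorphic_disk h,
      ~ (h @` unit_disk `<=` orb_support) &
      forall (i : 'I_(orb_size Delta)) (z : C),
        unit_disk z -> orb_comp i (h z) ->
        if orb_mult i is Some k then disk_multiplicity_ge h (orb_comp i) z k
        else False].

(* Poincare distance, normalised to curvature -1. *)
Definition poincare_dist (z w : C) : R :=
  let rho := complex.Re (`|z - w| / `|1 - w^* * z|) in
  ln ((1 + rho) / (1 - rho)).

Definition pseudo_distance_on (A : set X) (d : X -> X -> R) : Prop :=
  [/\ forall x y, A x -> A y -> 0 <= d x y,
      forall x, A x -> d x x = 0,
      forall x y, A x -> A y -> d x y = d y x &
      forall x y z, A x -> A y -> A z -> d x z <= d x y + d y z].

Definition distance_on (A : set X) (d : X -> X -> R) : Prop :=
  pseudo_distance_on A d /\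
  forall x y, A x -> A y -> d x y = 0 -> x = y.

Definition disk_decreasing (d : X -> X -> R) : Prop :=
  forall h, orbifold_disk h -> forall z w, unit_disk z -> unit_disk w ->
    d (h z) (h w) <= poincare_dist z w.

(* d is the largest disk-decreasing pseudo-distance off the floor. *)
Definition kobayashi_pseudo_distance (d : X -> X -> R) : Prop :=
  [/\ pseudo_distance_on (~` orb_floor) d,
      disk_decreasing d &
      forall d', pseudo_distance_on (~` orb_floor) d' -> disk_decreasing d' ->
        forall x y, ~ orb_floor x -> ~ orb_floor y -> d' x y <= d x y].

Definition hyperbolic_orbifold : Prop :=
  exists2 d, kobayashi_pseudo_distance d & distance_on (~` orb_floor) d.

End Pairs.

Definition orbifold_morphism (n m : nat)
    (X : complexManifold R n) (Y : complexManifold R m)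
    (DX : orbifold X) (DY : orbifold Y) (f : X -> Y) : Prop :=
  [/\ holomorphic_map f,
      ~ (range f `<=` orb_support DY) &
      forall (D : set Y) (E : set X) (t : nat),
        irreducible_divisor D -> irreducible_divisor E -> (1 <= t)%N ->
        pullback_multiplicity f D E t ->
        mult_le (orb_multiplicity DY D)
                (mult_scale t (orb_multiplicity DX E))].

Definition orbifold_aut (n : nat) (X : complexManifold R n)
    (Delta : orbifold X) : set (X -> X) :=
  [set f | biholomorphic f /\ orbifold_morphism Delta Delta f].

End Orbifolds.

(* Main.v *)
Require Import Defs.
From HB Require Import structures.
From mathcomp Require Import all_boot all_order all_algebra.
From mathcomp Require Import all_classical all_reals all_analysis.
From mathcomp Require Import complex.
From mathcomp Require Import ring lra.

Set Implicit Arguments.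
Unset Strict Implicit.
Unset Printing Implicit Defensive.

Import Order.TTheory GRing.Theory Num.Theory.
Import numFieldNormedType.Exports.

Local Open Scope classical_set_scope.
Local Open Scope ring_scope.

(** Let [d] be the Kobayashi distance of the compact hyperbolic orbifold.
An automorphism permutes the components of multiplicity different from one and
keeps their multiplicities ([aut_symmetry]); it therefore composes orbifold
disks into orbifold disks and is an isometry of [d] ([symmetry_iso]).  The
distance is continuous for the topology of [Y] ([d_near]): where the support is
a union of coordinate hyperplanes, two close points are joined by a small disk
whose coordinates are high powers of polynomials, hence meet the hyperplanes
with high multiplicity.  So if the group were infinite, compactness would give
automorphisms [f k <> id] converging uniformly to the identity
([isometries_near_id]).

Such a sequence produces a one-parameter flow.  Let [eps k] be the supremum
of the displacements of [f k] in finitely many charts ([displacement_scale]).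
For real [t >= 0], [flow t] is the limit along an ultrafilter of the iterates of
[f k] of order [t / eps k].  In a chart the iterates are given by Newton's series, the
[m]-th iterate of [F] being the sum over [j] of the binomial coefficient of [m]
over [j] times the [j]-th iterated difference of the identity along [F].  In it
[m = z / eps k] may be complex.  Schwarz's lemma bounds the [j]-th difference by
[eps k * (16 * j * eps k / r) ^ (j - 1)] ([fwd_diff_bound]), so the series is
bounded for [|z| <= c] with [c] independent of [k] ([newton_sum_bound]).  Its
limit is holomorphic in [z], and it extends the flow to complex times
([complex_flow]).

Running the complex flow [N] times in a row gives a holomorphic disk through [y]
([orbit]) that reaches [flow t y] already at a point at distance [O(1 / N)] from
the centre.  It stays off the support when [y] does ([complex_flow_support]), so
it is an orbifold disk, and [d y (flow t y) <= O(1 / N)] for all [N]: the flow is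
trivial ([flow_id]).  On the other hand the first-order term of Newton's series
shows that it moves some points by at least a constant times [t], as [eps k] is
the size of the displacement of [f k] ([flow_contradiction]).

Two points need care.  An orbifold disk is asked for local equations of all the
components that it meets, including those of multiplicity one; they exist at
every point because every point lies on an orbifold disk: otherwise its distance
to the other points could be increased, against the maximality of [d]
([disk_through]).  And the facts used about functions of one complex variable,
such as Taylor estimates, Schwarz's lemma, removable singularities, isolated
zeros and limits of holomorphic functions, are all derived from one expansion
with remainder ([taylor]).  It comes from Cauchy's formula, with Riemann sums
over the sides of squares in place of path integrals: the theorem of Goursat
needs only their additivity under bisection and their vanishing on affine
functions, both of which hold exactly for these sums. *)

(** * Real-valued norms and differentiability *)

Section RealNorm.
Variable R : realType.
Local Notation C := (Cplx R).

Definition cR (x : R) : C := (x +i* 0)%C.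

(** The norm of a normed module over the complex numbers is itself a complex
    number; [nrm] is the same number in [R], which is totally ordered. *)
Definition nrm (V : normedModType C) (v : V) : R := complex.Re (`|v| : R[i]).

Lemma cRD x y : cR (x + y) = cR x + cR y.
Proof. by apply/eqP; rewrite eq_complex /= addr0 !eqxx. Qed.
Lemma cRN x : cR (- x) = - cR x.
Proof. by apply/eqP; rewrite eq_complex /= oppr0 !eqxx. Qed.
Lemma cRB x y : cR (x - y) = cR x - cR y.
Proof. by rewrite cRD cRN. Qed.
Lemma cRM x y : cR (x * y) = cR x * cR y.
Proof. by apply/eqP; rewrite eq_complex /= !mulr0 mul0r subr0 addr0 !eqxx. Qed.
Lemma cR0 : cR 0 = 0. Proof. by []. Qed.
Lemma cR1 : cR 1 = 1. Proof. by []. Qed.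
Lemma cRn n : cR n%:R = n%:R.
Proof. by elim: n => // n IH; rewrite -!natr1 cRD IH. Qed.
Lemma cRV x : cR x^-1 = (cR x)^-1.
Proof.
have [->|x0] := eqVneq x 0; first by rewrite cR0 !invr0.
have cx0 : cR x != 0 by rewrite eq_complex /= negb_and x0.
by apply: (mulfI cx0); rewrite -cRM mulfV // mulfV.
Qed.
Lemma cRX x k : cR (x ^+ k) = cR x ^+ k.
Proof. by elim: k => // k IH; rewrite !exprS cRM IH. Qed.
Lemma le_cR x y : (cR x <= cR y) = (x <= y).
Proof. exact: (@lecR R). Qed.
Lemma lt_cR x y : (cR x < cR y) = (x < y).
Proof. exact: (@ltcR R). Qed.
Lemma cR_inj : injective cR. Proof. by move=> x y []. Qed.

Lemma nrmE (V : normedModType C) (v : V) : `|v| = cR (nrm v).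
Proof.
have : `|v| \is Num.real by rewrite normr_real.
by move=> /(@RRe_real R) <-.
Qed.

Lemma gt0_cR (e : C) : 0 < e -> exists2 r : R, 0 < r & e = cR r.
Proof.
move=> e0; have : e \is Num.real by rewrite realE ltW.
move=> /(@RRe_real R) E; exists (complex.Re e); last by rewrite -{1}E.
by rewrite -lt_cR cR0; move: e0; rewrite -{1}E.
Qed.

Section NormedMod.
Variable V : normedModType C.
Implicit Types u v w : V.

Lemma nrm_ge0 v : 0 <= nrm v.
Proof. by rewrite -le_cR -nrmE normr_ge0. Qed.
Lemma nrm0 : nrm (0 : V) = 0.
Proof. by apply: cR_inj; rewrite -nrmE normr0. Qed.
Lemma nrm_eq0 v : (nrm v == 0) = (v == 0).
Proof. by rewrite -(inj_eq cR_inj) -nrmE normr_eq0. Qed.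
Lemma nrm_gt0 v : (0 < nrm v) = (v != 0).
Proof. by rewrite lt_neqAle nrm_ge0 eq_sym nrm_eq0 andbT. Qed.
Lemma nrmD u v : nrm (u + v) <= nrm u + nrm v.
Proof. by rewrite -le_cR cRD -!nrmE ler_normD. Qed.
Lemma nrmN v : nrm (- v) = nrm v.
Proof. by rewrite /nrm normrN. Qed.
Lemma nrmBC u v : nrm (u - v) = nrm (v - u).
Proof. by rewrite -nrmN opprB. Qed.
Lemma nrmB u v : nrm (u - v) <= nrm u + nrm v.
Proof. by rewrite -(nrmN v) nrmD. Qed.
Lemma nrm_tri w u v : nrm (u - v) <= nrm (u - w) + nrm (w - v).
Proof. by apply: le_trans (nrmD _ _); rewrite addrA subrK. Qed.
Lemma nrm_leD u v : nrm u <= nrm v + nrm (u - v).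
Proof. by rewrite -{1}(subrK v u) addrC; apply: nrmD. Qed.
Lemma nrmZ (a : C) v : nrm (a *: v) = nrm a * nrm v.
Proof. by apply: cR_inj; rewrite cRM -!nrmE normrZ. Qed.
Lemma nrm_sum (I : Type) (s : seq I) (P : pred I) (F : I -> V) :
  nrm (\sum_(i <- s | P i) F i) <= \sum_(i <- s | P i) nrm (F i).
Proof.
elim/big_ind2: _ => [|x a y b xa yb|//]; first by rewrite nrm0.
by apply: le_trans (nrmD _ _) (lerD xa yb).
Qed.

Lemma nbhs_nrm v (A : set V) :
  nbhs v A <-> exists2 e : R, 0 < e & forall w, nrm (w - v) < e -> A w.
Proof.
split.
  move=> /nbhs_normP [e /= e0 eA].
  have [r r0 E] := gt0_cR e0; exists r => // w wr; apply: eA => /=.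
  by rewrite E -opprB normrN nrmE lt_cR.
move=> [e e0 eA]; apply/nbhs_normP; exists (cR e) => /=; first by rewrite -cR0 lt_cR.
by move=> w /=; rewrite -opprB normrN nrmE lt_cR => /eA.
Qed.

Lemma near_nrm v (e : R) : 0 < e -> \forall w \near v, nrm (w - v) < e.
Proof. by move=> e0; apply/nbhs_nrm; exists e. Qed.

Lemma cvg_nrm (T : Type) (F : set_system T) (f : T -> V) v : Filter F ->
  (f @ F --> v) <-> (forall e : R, 0 < e -> \forall t \near F, nrm (f t - v) < e).
Proof.
move=> FF; split.
  by move=> fv e e0; apply: (fv _ (near_nrm v e0)).
move=> H A /nbhs_nrm [e e0 eA].
by apply: filterS (H e e0) => t; apply: eA.
Qed.

End NormedMod.

Lemma continuous_nrm (V W : normedModType C) (f : V -> W) v :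
  {for v, continuous f} <-> (forall e : R, 0 < e ->
     exists2 d : R, 0 < d & forall w, nrm (w - v) < d -> nrm (f w - f v) < e).
Proof.
split.
  by move=> /(cvg_nrm f (f v) (nbhs_filter v)) H e /H /nbhs_nrm.
move=> H; apply/(cvg_nrm f (f v) (nbhs_filter v)) => e /H ?; exact/nbhs_nrm.
Qed.

Lemma nrmM (a b : C) : nrm (a * b) = nrm a * nrm b.
Proof. by apply: cR_inj; rewrite cRM -!nrmE normrM. Qed.
Lemma nrmV (a : C) : nrm a^-1 = (nrm a)^-1.
Proof. by apply: cR_inj; rewrite cRV -!nrmE normfV. Qed.
Lemma nrmX (a : C) k : nrm (a ^+ k) = nrm a ^+ k.
Proof. by apply: cR_inj; rewrite cRX -!nrmE normrX. Qed.
Lemma nrm1 : nrm (1 : C) = 1.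
Proof. by apply: cR_inj; rewrite -nrmE normr1. Qed.
Lemma nrm_cR x : nrm (cR x) = `|x|.
Proof.
apply: cR_inj; rewrite -nrmE.
have [x0|x0] := leP 0 x; first by rewrite (ger0_norm x0); apply: ger0_norm; rewrite -le_cR in x0.
by rewrite (ltr0_norm x0) cRN; apply: ler0_norm; move: (ltW x0); rewrite -le_cR.
Qed.
Lemma nrm_nat k : nrm (k%:R : C) = k%:R.
Proof. by rewrite -cRn nrm_cR normr_nat. Qed.
Lemma nrm_Re (a : C) : `|complex.Re a| <= nrm a.
Proof. by rewrite -le_cR -nrmE; apply: (@normc_ge_Re R). Qed.
Lemma nrm_Im (a : C) : `|complex.Im a| <= nrm a.
Proof.
have -> : nrm a = nrm (a * 'i%C : C).
  rewrite nrmM; suff -> : nrm ('i%C : C) = 1 by rewrite mulr1.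
  by apply: cR_inj; rewrite -nrmE (@normc_def R) /= expr0n /= add0r expr1n sqrtr1.
by apply: le_trans (nrm_Re _); rewrite (@ReiNIm R) normrN.
Qed.
Lemma nrm_ReIm (a : C) : nrm a <= `|complex.Re a| + `|complex.Im a|.
Proof.
have E : a = cR (complex.Re a) + ('i%C : C) * cR (complex.Im a).
  exact: (@complexE R a).
rewrite {1}E; apply: le_trans (nrmD _ _) _.
rewrite nrmM !nrm_cR.
suff -> : nrm ('i%C : C) = 1 by rewrite mul1r.
by apply: cR_inj; rewrite -nrmE (@normc_def R) /= expr0n /= add0r expr1n sqrtr1.
Qed.

Lemma nrm_coord n (v : 'rV[C]_n) i : nrm (v ord0 i) <= nrm v.
Proof.
rewrite -le_cR -!nrmE [leRHS]/Num.norm /= mx_normE.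
have -> : `|v ord0 i| = (`|v (ord0 : 'I_1, i).1 (ord0 : 'I_1, i).2|%:nng)%:num by [].
by rewrite num_le; apply: (@le_bigmax _ _ _ _ (fun x : 'I_1 * 'I_n => `|v x.1 x.2|%:nng)).
Qed.

Lemma nrm_rV_le n (v : 'rV[C]_n) (M : R) : 0 <= M ->
  (forall i, nrm (v ord0 i) <= M) -> nrm v <= M.
Proof.
move=> M0 H; have [|v0] := eqVneq `|v| 0.
  by move=> /eqP; rewrite normr_eq0 => /eqP ->; rewrite nrm0.
have [[i j] E] := mx_norm_neq0 v0.
have {}E : `|v| = `|v i j| := E.
by rewrite -le_cR -nrmE E nrmE le_cR (ord1 i).
Qed.

Lemma nrm_rV_lt n (v : 'rV[C]_n) (M : R) : 0 < M ->
  (forall i, nrm (v ord0 i) < M) -> nrm v < M.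
Proof.
move=> M0 H; have [|v0] := eqVneq `|v| 0.
  by move=> /eqP; rewrite normr_eq0 => /eqP ->; rewrite nrm0.
have [[i j] E] := mx_norm_neq0 v0.
have {}E : `|v| = `|v i j| := E.
by rewrite -lt_cR -nrmE E nrmE lt_cR (ord1 i).
Qed.

Lemma differentiable1P (f : C -> C) (z : C) :
  differentiable f z <-> exists a : C, forall e : R, 0 < e ->
    exists2 d : R, 0 < d & forall w, nrm (w - z) < d ->
      nrm (f w - f z - a * (w - z)) <= e * nrm (w - z).
Proof.
split.
  move=> /derivable1_diffP; rewrite /derivable => /cvg_ex [a Ha].
  exists a => e e0.
  have FF : Filter (0:C)^' by apply: dnbhs_filter.
  have /= K0 := (@cvg_nrm _ _ _ _ a FF).1 Ha e e0.
  have [d d0 H] := (nbhs_nrm _ _).1 K0; exists d => // w wd.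
  have [->|wz] := eqVneq w z; first by rewrite !subrr mulr0 subr0 nrm0 mulr0.
  have wz0 : w - z != 0 by rewrite subr_eq0.
  have := H (w - z); rewrite subr0 => /(_ wd wz0) /ltW.
  rewrite /= [_ *: 1]mulr1 subrK => K.
  have -> : f w - f z - a * (w - z) = ((w - z)^-1 *: (f w - f z) - a) * (w - z).
    by rewrite mulrBl [_ *: _]mulrC mulfVK.
  by rewrite nrmM ler_pM2r // nrm_gt0.
move=> [a H]; apply/derivable1_diffP; rewrite /derivable; apply/cvg_ex; exists a.
have FF : Filter (0:C)^' by apply: dnbhs_filter.
apply/(@cvg_nrm _ _ _ _ a FF) => e e0.
have [d d0 K] := H _ (divr_gt0 e0 (ltr0n _ 2)).
apply/(nbhs_nrm (0 : C)); exists d => // h; rewrite subr0 => hd h0.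
have := K (h + z); rewrite addrK => /(_ hd) L.
rewrite /= [_ *: 1]mulr1.
have -> : h^-1 *: (f (h + z) - f z) - a = (f (h + z) - f z - a * h) * h^-1.
  by rewrite mulrBl mulfK // [_ *: _]mulrC.
rewrite nrmM nrmV; apply: (@le_lt_trans _ _ (e / 2)).
  by rewrite ler_pdivrMr // nrm_gt0.
by rewrite ltr_pdivrMr // mulr_natr mulr2n ltrDl.
Qed.

Lemma differentiable_rV (V : normedModType C) n (f : V -> 'rV[C]_n) x :
  (forall i, differentiable (fun y => f y ord0 i) x) -> differentiable f x.
Proof.
move=> H; have -> : f = (fun y => \sum_(i < n) (fun y => f y ord0 i *: delta_mx ord0 i : 'rV[C]_n) y).
  by apply/funext => y; rewrite {1}[f y]row_sum_delta.
have -> : (fun y => \sum_(i < n) (fun y => f y ord0 i *: delta_mx ord0 i : 'rV[C]_n) y) =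
  \sum_(i < n) (fun y => f y ord0 i *: delta_mx ord0 i : 'rV[C]_n).
  by apply/funext => y; rewrite fct_sumE.
by apply: differentiable_sum => i; apply: differentiableZl.
Qed.

Lemma differentiable_comp_coord (V : normedModType C) n (f : V -> 'rV[C]_n) x i :
  differentiable f x -> differentiable (fun y => f y ord0 i) x.
Proof.
move=> H; apply: (@differentiable_comp _ _ _ _ f (fun v : 'rV[C]_n => v ord0 i)) => //.
exact: differentiable_coord.
Qed.

Lemma diff_id (V : normedModType C) (z : V) : differentiable (@id V) z.
Proof. exact: (@linear_differentiable _ _ _ idfun _ (fun=> cvg_id)). Qed.

Lemma differentiable_line n (b v : 'rV[C]_n) (z : C) :
  differentiable (fun s : C => b + s *: v) z.
Proof.
exact: (@differentiableD _ _ _ (cst b) (fun s : C => s *: v)).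
Qed.

(** [g - f] vanishes near [x], so it is differentiable with differential [0]. *)
Lemma differentiable_near (V W : normedModType C) (f g : V -> W) x :
  (\forall y \near x, f y = g y) -> differentiable f x -> differentiable g x.
Proof.
move=> E df.
pose k := g - f.
have Ek : \forall y \near x, k y = 0.
  by apply: filterS E => y fg; rewrite /k -[LHS]/(g y - f y) fg subrr.
have kx0 : k x = 0 := nbhs_singleton Ek.
pose L := 'd (cst (0 : W)) x.
have L0 h : L h = 0 by rewrite /L diff_cst.
have c0 : continuous L by apply: diff_continuous; apply: differentiable_cst.
have lk : k \o shift x = cst (k x) + L +o_ (0 : V) id.
  apply/eqaddoP => e e0; rewrite kx0.
  move: Ek => /nbhs_nrm [d d0 Hd]; apply/nbhs_nrm; exists d => // h; rewrite subr0 => hd.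
  have -> : (k \o shift x - (cst 0 + L)) h = 0.
    rewrite -[LHS]/(k (h + x) - (0 + L h)) Hd ?addrK //.
    by rewrite L0 addr0 subr0.
  by rewrite normr0 mulr_ge0 // ltW.
have dk : differentiable k x.
  by apply/diff_locallyP; rewrite (diff_unique c0 lk).
have -> : g = f + k by rewrite /k addrC subrK.
exact: differentiableD.
Qed.
End RealNorm.

(** * Riemann sums along boundaries of squares and Goursat's theorem *)

Section Goursat.
Variable R : realType.
Local Notation C := (Cplx R).

Definition cxy (x y : R) : C := (x +i* y)%C.

Lemma cxyE x y : cxy x y = cR x + cxy 0 1 * cR y.
Proof. exact: (@complexE R (x +i* y)%C). Qed.

Lemma nrm_cxy01 : nrm (cxy 0 1) = 1.
Proof. by apply: cR_inj; rewrite -nrmE (@normc_def R) /= expr0n /= add0r expr1n sqrtr1. Qed.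

Lemma nrm_cxy x y : nrm (cxy x y) <= `|x| + `|y|.
Proof. by rewrite cxyE; apply: le_trans (nrmD _ _) _; rewrite nrmM nrm_cxy01 mul1r !nrm_cR. Qed.

Lemma cxyD x y x' y' : cxy (x + x') (y + y') = cxy x y + cxy x' y'.
Proof. by []. Qed.

Lemma cxyZ r x y : cxy (r * x) (r * y) = cR r * cxy x y.
Proof. by apply/eqP; rewrite eq_complex /= !mul0r subr0 addr0 !eqxx. Qed.

Lemma cRhalf : cR 2^-1 = 2^-1 :> C.
Proof. by rewrite cRV (cRn R 2). Qed.

Lemma cxy_shift (p s : C) (x y h a b : R) :
  p + s * cxy x y + s * cR h * cxy a b = p + s * cxy (x + h * a) (y + h * b).
Proof.
rewrite (cxyE x) (cxyE a) (cxyE (_ + _)) !cRD !cRM.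
set X := cR x; set Y := cR y; set A := cR a; set B := cR b; set H := cR h.
by set i := cxy 0 1; ring.
Qed.

Definition edge_sum (N : nat) (f : C -> C) (p v : C) : C :=
  \sum_(k < N) f (p + v * (k%:R / N%:R)) * (v / N%:R).

(** Riemann sum, with [N] points on each side, for the integral of [f w dw]
    counterclockwise along the square with lower left corner [p] and side [s].
    The side may be any complex number, which turns the square. *)
Definition bdry_sum (N : nat) (f : C -> C) (p s : C) : C :=
  let i := cxy 0 1 in
  edge_sum N f p s + edge_sum N f (p + s) (i * s) - edge_sum N f (p + i * s) s - edge_sum N f p (i * s).

Lemma natC_neq0 N : (0 < N)%N -> (N%:R : C) != 0.
Proof. by rewrite pnatr_eq0 lt0n. Qed.

Lemma edge_split N f p v : (0 < N)%N ->
  edge_sum (N + N) f p v = edge_sum N f p (v / 2) + edge_sum N f (p + v / 2) (v / 2).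
Proof.
move=> N0; have NC := natC_neq0 N0; rewrite /edge_sum big_split_ord /=.
have NC2 : N%:R + N%:R != 0 :> C by rewrite -natrD natC_neq0 // addn_gt0 N0.
have t0 : 2 != 0 :> C by rewrite pnatr_eq0.
congr (_ + _); apply: eq_bigr => k _; rewrite !natrD; move: NC NC2;
  set n : C := N%:R; set kk : C := k%:R => NC NC2.
  congr (f _ * _); first by congr (_ + _); field; rewrite NC NC2.
  by field; rewrite NC NC2.
congr (f _ * _); last by field; rewrite NC NC2.
by rewrite -addrA; congr (_ + _); field; rewrite NC NC2.
Qed.

(** The sums over the four inner edges cancel in pairs, exactly and for every
    [N], as path integrals do. *)
Lemma bdry_split N f p s : (0 < N)%N ->
  bdry_sum (N + N) f p s = bdry_sum N f p (s / 2) + bdry_sum N f (p + s / 2) (s / 2)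
    + bdry_sum N f (p + cxy 0 1 * (s / 2)) (s / 2)
    + bdry_sum N f (p + s / 2 + cxy 0 1 * (s / 2)) (s / 2).
Proof.
move=> N0; rewrite /bdry_sum !edge_split //; set i := cxy 0 1.
have -> : i * s / 2 = i * (s / 2) by rewrite mulrA.
have E1 : p + s = p + s / 2 + s / 2 by field.
have E2 : p + i * s = p + i * (s / 2) + i * (s / 2) by field.
rewrite E1 E2.
have -> : p + i * (s/2) + s/2 = p + s/2 + i * (s/2) by ring.
have -> : p + i * (s/2) + i * (s/2) + s/2 = p + s/2 + i * (s/2) + i * (s/2) by ring.
have -> : p + s/2 + i * (s/2) + s/2 = p + s/2 + s/2 + i * (s/2) by ring.
by ring.
Qed.

Lemma edge_le N f p v (M : R) : (0 < N)%N ->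
  (forall t : R, 0 <= t <= 1 -> nrm (f (p + v * cR t)) <= M) ->
  nrm (edge_sum N f p v) <= M * nrm v.
Proof.
move=> N0 H; apply: le_trans (nrm_sum _ _ _) _.
apply: (@le_trans _ _ (\sum_(k < N) M * (nrm v / N%:R))).
  apply: ler_sum => k _; rewrite !nrmM nrmV nrm_nat ler_wpM2r //.
    by rewrite divr_ge0 // nrm_ge0.
  rewrite -!cRn -cRV -cRM; apply: H.
  rewrite divr_ge0 //= ler_pdivrMr ?ltr0n // mul1r ler_nat.
  by apply: ltnW.
rewrite sumr_const card_ord -[_ *+ N]mulr_natr -mulrA mulfVK //.
by rewrite pnatr_eq0 -lt0n.
Qed.

Lemma edge_cst N c p v : (0 < N)%N -> edge_sum N (fun=> c) p v = c * v.
Proof.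
move=> N0; rewrite /edge_sum sumr_const card_ord -[_ *+ N]mulr_natr -mulrA mulfVK //.
exact: natC_neq0.
Qed.

Lemma edge_shift N a p q v : (0 < N)%N ->
  edge_sum N (fun z => a * z) (p + q) v - edge_sum N (fun z => a * z) p v = a * q * v.
Proof.
move=> N0; rewrite /edge_sum -sumrB.
transitivity (\sum_(k < N) (a * q) * (v / N%:R)); last exact: (edge_cst (a * q) p v N0).
by apply: eq_bigr => k _; ring.
Qed.

Lemma edgeD N f g p v : edge_sum N (fun z => f z + g z) p v = edge_sum N f p v + edge_sum N g p v.
Proof. by rewrite /edge_sum -big_split /=; apply: eq_bigr => k _; rewrite mulrDl. Qed.

Lemma edgeZ N a f p v : edge_sum N (fun z => a * f z) p v = a * edge_sum N f p v.
Proof. by rewrite /edge_sum mulr_sumr; apply: eq_bigr => k _ /=; rewrite -!mulrA. Qed.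

Lemma bdryD N f g p s : bdry_sum N (fun z => f z + g z) p s = bdry_sum N f p s + bdry_sum N g p s.
Proof. by rewrite /bdry_sum !edgeD; ring. Qed.

Lemma bdryZ N a f p s : bdry_sum N (fun z => a * f z) p s = a * bdry_sum N f p s.
Proof. by rewrite /bdry_sum !edgeZ; ring. Qed.

Lemma bdryB N f g p s : bdry_sum N (fun z => f z - g z) p s = bdry_sum N f p s - bdry_sum N g p s.
Proof.
have -> : (fun z => f z - g z) = (fun z => f z + (-1) * g z).
  by apply/funext => z; rewrite mulN1r.
by rewrite bdryD bdryZ mulN1r.
Qed.

(** The sums over two opposite sides differ by the slope times the
    displacement times the side; the two differences cancel. *)
Lemma bdry_affine N a c p s : (0 < N)%N -> bdry_sum N (fun z => c + a * z) p s = 0.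
Proof.
move=> N0; rewrite bdryD /bdry_sum !edge_cst //.
set i := cxy 0 1.
have H1 := edge_shift a p (i * s) s N0; have H2 := edge_shift a p s (i * s) N0.
rewrite (_ : _ + _ = (edge_sum N (fun z => a * z) (p + s) (i * s) - edge_sum N (fun z => a * z) p (i * s))
  - (edge_sum N (fun z => a * z) (p + i * s) s - edge_sum N (fun z => a * z) p s)); last by ring.
by rewrite H1 H2; ring.
Qed.

Definition on_bdry (p s w : C) := exists x y : R,
  [/\ 0 <= x <= 1, 0 <= y <= 1, x = 0 \/ x = 1 \/ y = 0 \/ y = 1 & w = p + s * cxy x y].

Definition square (p s w : C) := exists x y : R,
  [/\ 0 <= x <= 1, 0 <= y <= 1 & w = p + s * cxy x y].

Lemma on_bdry_square p s w : on_bdry p s w -> square p s w.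
Proof. by move=> [x [y [? ? _ ?]]]; exists x, y. Qed.

Lemma bdry_le N f p s (M : R) : (0 < N)%N ->
  (forall w, on_bdry p s w -> nrm (f w) <= M) ->
  nrm (bdry_sum N f p s) <= 4 * M * nrm s.
Proof.
move=> N0 H; set i := cxy 0 1.
have i1 := nrm_cxy01.
have e1 : nrm (edge_sum N f p s) <= M * nrm s.
  apply: edge_le => // t t01; apply: H; exists t, 0.
  by split=> //; [rewrite lexx ler01|tauto].
have e2 : nrm (edge_sum N f (p + i * s) s) <= M * nrm s.
  apply: edge_le => // t t01; apply: H; exists t, 1.
  split=> //; [by rewrite lexx ler01|by right; right; right|by rewrite cxyE cR1 -/i; ring].
have e3 : nrm (edge_sum N f p (i * s)) <= M * nrm s.
  have -> : M * nrm s = M * nrm (i * s) by rewrite nrmM i1 mul1r.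
  apply: edge_le => // t t01; apply: H; exists 0, t.
  split=> //; [by rewrite lexx ler01|tauto|rewrite cxyE cR0 -/i; ring].
have e4 : nrm (edge_sum N f (p + s) (i * s)) <= M * nrm s.
  have -> : M * nrm s = M * nrm (i * s) by rewrite nrmM i1 mul1r.
  apply: edge_le => // t t01; apply: H; exists 1, t.
  split=> //; [by rewrite lexx ler01|by right; left|by rewrite cxyE cR1 -/i; ring].
rewrite /bdry_sum -/i.
have := nrmB (edge_sum N f p s + edge_sum N f (p + s) (i * s) - edge_sum N f (p + i * s) s) (edge_sum N f p (i * s)).
have := nrmB (edge_sum N f p s + edge_sum N f (p + s) (i * s)) (edge_sum N f (p + i * s) s).
have := nrmD (edge_sum N f p s) (edge_sum N f (p + s) (i * s)).
by lra.
Qed.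

Lemma bdry_ext N f g p s : (0 < N)%N ->
  (forall w, on_bdry p s w -> f w = g w) -> bdry_sum N f p s = bdry_sum N g p s.
Proof.
move=> N0 H; apply/eqP; rewrite -subr_eq0 -bdryB -nrm_eq0 eq_le nrm_ge0 andbT.
apply: le_trans (@bdry_le _ _ _ _ 0 N0 _) _; last by rewrite mulr0 mul0r.
by move=> w /H ->; rewrite subrr nrm0.
Qed.

End Goursat.

Section Goursat2.
Variable R : realType.
Local Notation C := (Cplx R).
Local Notation cxy := (@cxy R).

(** Restricting to [2 ^ n] points per side makes a bisection of the square
    correspond to one step of [n]. *)
Definition small_bdry (f : C -> C) (p s : C) (e : R) :=
  exists n0, forall n, (n0 <= n)%N -> nrm (bdry_sum (2 ^ n) f p s) <= e.

Lemma small_le f p s (e e' : R) : e <= e' -> small_bdry f p s e -> small_bdry f p s e'.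
Proof. by move=> le [n0 H]; exists n0 => n /H /le_trans; apply. Qed.

Lemma small_split f p s (E : bool -> bool -> R) :
  (forall a b : bool, small_bdry f (p + s / 2 * cxy a%:R b%:R) (s / 2) (E a b)) ->
  small_bdry f p s (E false false + E true false + E false true + E true true).
Proof.
move=> H.
have [n1 H1] := H false false; have [n2 H2] := H true false.
have [n3 H3] := H false true; have [n4 H4] := H true true.
exists (n1 + n2 + n3 + n4).+1 => -[//|n]; rewrite ltnS => le.
rewrite expnS mul2n -addnn bdry_split ?expn_gt0 //.
have {}H1 := H1 n (leq_trans (leq_trans (leq_addr _ _) (leq_trans (leq_addr _ _) (leq_addr _ _))) le).
have {}H2 := H2 n (leq_trans (leq_trans (leq_addl _ _) (leq_trans (leq_addr _ _) (leq_addr _ _))) le).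
have {}H3 := H3 n (leq_trans (leq_trans (leq_addl _ _) (leq_addr _ _)) le).
have {}H4 := H4 n (leq_trans (leq_addl _ _) le).
have E1 : p = p + s / 2 * cxy 0 0.
  by rewrite cxyE cR0 mulr0 addr0 mulr0 addr0.
have E2 : p + s / 2 = p + s / 2 * cxy 1 0 by rewrite cxyE cR0 cR1 mulr0 addr0 mulr1.
have E3 : p + cxy 0 1 * (s / 2) = p + s / 2 * cxy 0 1 by rewrite mulrC.
have E4 : p + s / 2 + cxy 0 1 * (s / 2) = p + s / 2 * cxy 1 1.
  by rewrite (cxyE 1 1) cR1; ring.
rewrite E4 E3 E2 [X in bdry_sum _ f X _ + _ + _ + _]E1.
apply: le_trans (nrmD _ _) _; apply: lerD H4; apply: le_trans (nrmD _ _) _; apply: lerD H3.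
by apply: le_trans (nrmD _ _) _; apply: lerD.
Qed.

(** If the sums over a square do not become small, neither do those over one
    of its quarters.  At the common point of the nested squares so obtained [f] is
    affine up to an error that is small compared with their size, and affine
    functions contribute nothing. *)
Lemma goursat f p s (e : R) : 0 < e ->
  (forall w, square p s w -> differentiable f w) -> small_bdry f p s e.
Proof.
move=> e0 df; apply: contrapT => nb.
have [s0|s0] := eqVneq s 0.
  apply: nb; exists 0 => n _; rewrite s0 /bdry_sum /edge_sum !big1 => *; rewrite ?mulr0 ?mul0r ?mulr0 //.
  by rewrite !subr0 addr0 nrm0 ltW.
pose h k : R := (2 ^+ k)^-1.
have h0 k : 0 < h k by rewrite invr_gt0 exprn_gt0.
have hS k : h k.+1 = h k / 2 by rewrite /h exprSr invfM.
pose Bad k (q : R * R) := ~ small_bdry f (p + s * cxy q.1 q.2) (s * cR (h k)) (e / 4 ^+ k).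
pose nx k (q q' : R * R) := Bad k.+1 q' /\ (q'.1 = q.1 \/ q'.1 = q.1 + h k.+1) /\
   (q'.2 = q.2 \/ q'.2 = q.2 + h k.+1).
have step (kq : nat * (R * R)) : exists q', Bad kq.1 kq.2 -> nx kq.1 kq.2 q'.
  case: kq => k q /=.
  have [B|] := pselect (Bad k q); last by exists q.
  apply: contrapT => Hn; apply: B.
  have G (a b : R) : (a = 0 \/ a = h k.+1) -> (b = 0 \/ b = h k.+1) ->
    small_bdry f (p + s * cxy (q.1 + a) (q.2 + b)) (s * cR (h k.+1)) (e / 4 ^+ k.+1).
    move=> Ha Hb; apply: contrapT => Bs; apply: Hn.
    exists (q.1 + a, q.2 + b) => _; split => //=; split.
      by case: Ha => ->; [left; rewrite addr0|right].
    by case: Hb => ->; [left; rewrite addr0|right].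
  have Es : s * cR (h k) / 2 = s * cR (h k.+1).
    by rewrite hS cRM cRV -(cRn R 2) mulrA.
  have Ee : e / 4 ^+ k / 4 = e / 4 ^+ k.+1 by rewrite exprSr invfM mulrA.
  have -> : e / 4 ^+ k = e / 4 ^+ k.+1 + e / 4 ^+ k.+1 + e / 4 ^+ k.+1 + e / 4 ^+ k.+1.
    by rewrite -Ee; field; rewrite expf_neq0.
  apply: (small_split (E := fun _ _ => e / 4 ^+ k.+1)) => a b; rewrite Es.
  have := G (h k.+1 * a%:R) (h k.+1 * b%:R).
  have -> : p + s * cxy q.1 q.2 + s * cR (h k.+1) * cxy a%:R b%:R =
     p + s * cxy (q.1 + h k.+1 * a%:R) (q.2 + h k.+1 * b%:R).
    exact: cxy_shift.
  by apply; [case: a|case: b]; rewrite ?mulr0 ?mulr1; [right|left|right|left].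
have [F HF] := choice step.
pose Q := fix Q k := if k is k'.+1 then F (k', Q k') else (0, 0) : R * R.
have QB k : Bad k (Q k).
  elim: k => [|k IH] /=; last by have [] := HF (k, Q k) IH.
  rewrite /Bad /= expr0 divr1 /h expr0 invr1 cR1 mulr1.
  by rewrite (_ : cxy 0 0 = 0) // mulr0 addr0.
have Qs k : nx k (Q k) (Q k.+1) by exact: (HF (k, Q k) (QB k)).
(* nested intervals give the coordinates of the common point *)
have lim (u : nat -> R) : u 0 = 0 -> (forall k, u k.+1 = u k \/ u k.+1 = u k + h k.+1) ->
   exists x, forall k, u k <= x <= u k + h k.
  move=> u0 us.
  have mono k m : u k <= u (k + m)%N /\ u (k + m)%N + h (k + m)%N <= u k + h k.
    elim: m => [|m [IH1 IH2]]; first by rewrite addn0.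
    rewrite addnS; have hh := hS (k + m)%N; have hp := h0 (k + m)%N.
    by case: (us (k + m)%N) => E; rewrite E; split; lra.
  have ub j k : u j <= u k + h k.
    have [jk|/ltnW jk] := leqP j k.
      have [B1 B2] := mono j (k - j)%N; have := h0 (j + (k - j))%N; rewrite !(subnKC jk) in B1 B2 *; lra.
    have [B1 B2] := mono k (j - k)%N; have := h0 (k + (j - k))%N; rewrite !(subnKC jk) in B1 B2 *; lra.
  have hs : has_sup (range u).
    by split; [exists (u 0); exists 0|exists (u 0 + h 0) => _ [j _ <-]; apply: ub].
  exists (sup (range u)) => k; apply/andP; split.
    by apply: ub_le_sup; [case: hs|exists k].
  by apply: ge_sup; [case: hs|move=> _ [j _ <-]; apply: ub].
have [x Hx] := lim (fun k => (Q k).1) erefl (fun k => (Qs k).2.1).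
have [y Hy] := lim (fun k => (Q k).2) erefl (fun k => (Qs k).2.2).
have h00 : h 0 = 1 by rewrite /h expr0 invr1.
have x01 : 0 <= x <= 1 by have := Hx 0; rewrite /= h00 add0r.
have y01 : 0 <= y <= 1 by have := Hy 0; rewrite /= h00 add0r.
pose z := p + s * cxy x y.
have /df/differentiable1P [a Ha] : square p s z by exists x, y.
have ns0 : 0 < nrm s by rewrite nrm_gt0.
pose eta := e / (8 * nrm s ^+ 2).
have eta0 : 0 < eta by rewrite divr_gt0 // mulr_gt0 // exprn_gt0.
have [d d0 Hd] := Ha eta eta0.
have [k hk] : exists k, 2 * nrm s * h k < d.
  have [k _ Hk] : exists2 k, True & (2 * nrm s / d) < k%:R.
    by exists (Num.bound (2 * nrm s / d)) => //; rewrite archi_boundP // divr_ge0 ?ltW // mulr_gt0.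
  exists k; rewrite /h ltr_pdivrMr ?exprn_gt0 //.
  rewrite ltr_pdivrMr // in Hk; apply: (lt_le_trans Hk).
  rewrite mulrC ler_pM2l // -natrX ler_nat; exact: ltnW (ltn_expl _ _).
apply: (QB k); exists 0 => n _.
set pk := p + s * _; set sk := s * _.
have N0 : (0 < 2 ^ n)%N by rewrite expn_gt0.
(* [L] is the affine approximation of [f] at [z] *)
pose L w := f z - a * z + a * w.
have -> : bdry_sum (2 ^ n) f pk sk = bdry_sum (2 ^ n) (fun w => f w - L w) pk sk.
  by rewrite bdryB bdry_affine // subr0.
have skE : nrm sk = nrm s * h k by rewrite nrmM nrm_cR ger0_norm // ltW.
have -> : e / 4 ^+ k = 4 * (eta * (2 * nrm s * h k)) * nrm sk.
  rewrite skE /eta /h (_ : 4 ^+ k = 2 ^+ k * 2 ^+ k :> R); last by rewrite -exprMn; congr (_ ^+ _); ring.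
  have : 2 ^+ k != 0 :> R by rewrite expf_neq0.
  by move: ns0; rewrite lt0r => /andP[? _] ?; field; apply/andP.
apply: bdry_le => // w /on_bdry_square [u [v [u01 v01 ->]]].
have wz : nrm (pk + sk * cxy u v - z) <= 2 * nrm s * h k.
  have -> : pk + sk * cxy u v - z =
     s * cxy ((Q k).1 + h k * u - x) ((Q k).2 + h k * v - y).
    rewrite /pk /sk /z cxy_shift opprD addrACA subrr add0r -mulrBr.
    by congr (_ * _); apply/eqP; rewrite eq_complex /= !eqxx.
  rewrite nrmM [2 * _]mulrC -mulrA ler_wpM2l ?nrm_ge0 //.
  apply: le_trans (nrm_cxy _ _) _.
  have B (q t xx : R) : 0 <= t <= 1 -> q <= xx <= q + h k -> `|q + h k * t - xx| <= h k.
    move=> /andP[t0 t1] /andP[q1 q2]; rewrite ler_norml; have hp := h0 k.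
    have : h k * t <= h k by rewrite ger_pMr.
    have : 0 <= h k * t by rewrite mulr_ge0 // ltW.
    by move=> *; apply/andP; split; lra.
  have := B _ _ _ u01 (Hx k); have := B _ _ _ v01 (Hy k); lra.
have := Hd _ (le_lt_trans wz hk); set ww := pk + _.
have -> : f ww - f z - a * (ww - z) = f ww - L ww by rewrite /L; ring.
move=> /le_trans; apply; rewrite ler_wpM2l // ltW //.
Qed.

End Goursat2.

Section Exceptional.
Variable R : realType.
Local Notation C := (Cplx R).
Local Notation cxy := (@cxy R).

Lemma cxy_inj (p s : C) x y x' y' : s != 0 ->
  p + s * cxy x y = p + s * cxy x' y' -> x = x' /\ y = y'.
Proof. by move=> s0 /addrI /(mulfI s0) [-> ->]. Qed.

Lemma square_child (p s w : C) (a b : bool) :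
  square (p + s / 2 * cxy a%:R b%:R) (s / 2) w -> square p s w.
Proof.
move=> [x [y [/andP[x0 x1] /andP[y0 y1] ->]]].
exists (2^-1 * (a%:R + x)), (2^-1 * (b%:R + y)); split.
- by case: a; rewrite ?mulr1n ?mulr0n; lra.
- by case: b; rewrite ?mulr1n ?mulr0n; lra.
- rewrite cxyZ cxyD cRhalf; move: (cxy a%:R b%:R) (cxy x y) => A B.
  by rewrite mulrA mulrDr addrA.
Qed.

Variables (f : C -> C) (z0 : C) (M : R).
Let good p s := forall w, square p s w -> nrm (f w) <= M /\ (w <> z0 -> differentiable f w).

Lemma good_child p s (a b : bool) : good p s -> good (p + s / 2 * cxy a%:R b%:R) (s / 2).
Proof. by move=> H w /square_child /H. Qed.

(** A bounded function that is differentiable off a corner: [goursat] takes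
    care of three quarters of the square, and after [k] bisections the perimeter of
    the remaining one is negligible. *)
Lemma small_corner k p s (a b : bool) (e : R) : 0 < e -> s != 0 ->
  z0 = p + s * cxy a%:R b%:R -> good p s -> small_bdry f p s (4 * M * nrm s / 2 ^+ k + e).
Proof.
elim: k p s e => [|k IH] p s e e0 s0 zE H.
  exists 0 => n _; rewrite expr0 divr1.
  apply: (@le_trans _ _ (4 * M * nrm s)); last by rewrite lerDl ltW.
  by apply: bdry_le; rewrite ?expn_gt0 // => w /on_bdry_square /H [].
have s20 : s / 2 != 0 by rewrite mulf_neq0 // invr_eq0 pnatr_eq0.
pose E a' b' := if (a' == a) && (b' == b) then 4 * M * nrm (s / 2) / 2 ^+ k + e / 4 else e / 4.
have n2 : nrm (s / 2) = nrm s / 2 by rewrite nrmM nrmV nrm_nat.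
apply: (@small_le _ f p s (E false false + E true false + E false true + E true true)).
  have -> : 4 * M * nrm s / 2 ^+ k.+1 = 4 * M * nrm (s / 2) / 2 ^+ k.
    by rewrite n2 exprS; field; rewrite expf_neq0.
  by rewrite /E; set X := 4 * M * _ / _; case: (a); case: (b) => /=; lra.
apply: small_split => a' b'; rewrite /E; case: ifP => [/andP[/eqP -> /eqP ->]|ab].
  apply: IH; rewrite ?divr_gt0 //; last exact: good_child.
  by rewrite zE; field.
apply: goursat; first by rewrite divr_gt0.
move=> w wQ; apply: (H w (square_child wQ)).2 => wz.
move: wQ => [x [y [x01 y01]]]; rewrite wz zE.
have -> : p + s * cxy a%:R b%:R = p + s / 2 * cxy a'%:R b'%:R + s / 2 * cxy (2 * a%:R - a'%:R) (2 * b%:R - b'%:R).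
  rewrite cxyD.
  have -> : cxy (- a'%:R) (- b'%:R) = - cxy a'%:R b'%:R by [].
  have -> : cxy (2 * a%:R) (2 * b%:R) = 2 * cxy a%:R b%:R by rewrite cxyZ (cRn R 2).
  move: (cxy a%:R b%:R) (cxy a'%:R b'%:R) => A B.
  by field.
move=> /(cxy_inj s20) [xE yE]; move: ab x01 y01; rewrite -xE -yE.
by case: (a); case: (a'); case: (b); case: (b') => //=; lra.
Qed.

(** A dyadic exceptional point becomes a corner of a subsquare, or lies outside
    of it, after [m] bisections.  Dyadic points are dense, and continuity reaches
    the others. *)
Lemma small_grid m p s (a b : int) (e : R) : 0 < e -> s != 0 ->
  z0 = p + s * cxy (a%:~R / 2 ^+ m) (b%:~R / 2 ^+ m) -> good p s -> small_bdry f p s e.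
Proof.
elim: m p s a b e => [|m IH] p s a b e e0 s0 zE H.
  move: zE; rewrite !divr1 => zE.
  have [[a' aE]|na] := pselect (exists a' : bool, a = a'%:R); last first.
    apply: goursat => // w wQ; apply: (H w wQ).2 => wz.
    move: wQ => [x [y [/andP[x0 x1] y01]]]; rewrite wz zE => /(cxy_inj s0) [xE _].
    apply: na; move: x0 x1; rewrite -xE ler0z lerz1.
    by case: a {zE xE} => [[|[|n]]|] //; [exists false|exists true].
  have [[b' bE]|nb] := pselect (exists b' : bool, b = b'%:R); last first.
    apply: goursat => // w wQ; apply: (H w wQ).2 => wz.
    move: wQ => [x [y [_ /andP[x0 x1]]]]; rewrite wz zE => /(cxy_inj s0) [_ xE].
    apply: nb; move: x0 x1; rewrite -xE ler0z lerz1.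
    by case: b {zE xE} => [[|[|n]]|] //; [exists false|exists true].
  have zE' : z0 = p + s * cxy a'%:R b'%:R.
    by rewrite zE aE bE; case: (a'); case: (b').
  have M0 : 0 <= M.
    apply: le_trans (nrm_ge0 _) (H p _).1; exists 0, 0.
    by rewrite lexx ler01; split => //; rewrite cxyE cR0 mulr0 addr0 mulr0 addr0.
  have [k hk] : exists k, 4 * M * nrm s / (e / 2) < 2 ^+ k.
    exists (Num.bound (4 * M * nrm s / (e / 2))).
    apply: (@lt_le_trans _ _ (Num.bound (4 * M * nrm s / (e / 2)))%:R).
      apply: archi_boundP; apply: divr_ge0; last by apply: ltW; rewrite divr_gt0.
      by rewrite !mulr_ge0 ?nrm_ge0.
    by rewrite -natrX ler_nat ltnW // ltn_expl.
  apply: small_le (@small_corner k p s a' b' (e / 2) _ s0 zE' H); last by rewrite divr_gt0.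
  have : 4 * M * nrm s / 2 ^+ k <= e / 2.
    rewrite ltr_pdivrMr ?divr_gt0 // in hk.
    by rewrite ler_pdivrMr ?exprn_gt0 // [e / 2 * _]mulrC ltW.
  by lra.
have s20 : s / 2 != 0 by rewrite mulf_neq0 // invr_eq0 pnatr_eq0.
have -> : e = e / 4 + e / 4 + e / 4 + e / 4 by lra.
apply: (small_split (E := fun _ _ => e / 4)) => a' b'.
apply: (IH _ _ (a - a'%:R * 2 ^+ m) (b - b'%:R * 2 ^+ m)) => //; first by rewrite divr_gt0.
  rewrite zE; set t : R := 2 ^+ m.
  have t0 : t != 0 by rewrite expf_neq0.
  have E (c : int) (c' : bool) : c%:~R / 2 ^+ m.+1 = 2^-1 * (c'%:R + (c - c'%:R * 2 ^+ m)%:~R / t) :> R.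
    rewrite intrB intrM rmorphXn /= exprS -/t.
    have -> : (c'%:R : int)%:~R = c'%:R :> R by case: c'.
    by field.
  rewrite (E a a') (E b b') cxyZ cxyD cRhalf; move: (cxy _ _) (cxy _ _) => A B.
  by field.
exact: good_child.
Qed.

End Exceptional.

(** * Limits along ultrafilters *)

Section Ultra.
Variable R : realType.
Local Notation C := (Cplx R).
Variables (T : Type) (U : set_system T).
Hypothesis UU : UltraFilter U.

Lemma ultra_fmap (X : Type) (u : T -> X) : UltraFilter (u @ U).
Proof.
split; first exact: fmap_proper_filter.
move=> G PG sub; apply/seteqP; split => [A GA|]; last exact: sub.
have [//|nA] := in_ultra_setVsetC (u @^-1` A) UU.
have : G (~` A) by apply: sub.
move=> /(filterI GA); rewrite setICr => /filter_ex [] //.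
Qed.

Lemma ultra_compact (X : topologicalType) (A : set X) (u : T -> X) :
  compact A -> U (u @^-1` A) -> exists2 l, A l & u @ U --> l.
Proof.
rewrite compact_ultra => /(_ _ (ultra_fmap u)) K /K [l [Al ul]].
by exists l.
Qed.

(** Bolzano-Weierstrass, for the limit along an ultrafilter, which serves all
    bounded sequences at once. *)
Lemma ultra_bounded (u : T -> C) (B : R) : (\forall t \near U, nrm (u t) <= B) ->
  exists2 l : C, nrm l <= B & forall e : R, 0 < e -> \forall t \near U, nrm (u t - l) < e.
Proof.
move=> ub.
have H (g : C -> R) : (forall z, `|g z| <= nrm z) -> exists l : R, g \o u @ U --> l.
  move=> gn.
  have [||l _ ?] := @ultra_compact R `[- B, B]%classic (g \o u); last by exists l.
    exact: segment_compact.
  apply: filterS ub => t tB /=; rewrite in_itv /= -ler_norml.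
  exact: le_trans (gn _) tB.
have [x Hx] := H _ (@nrm_Re R); have [y Hy] := H _ (@nrm_Im R).
have cv : forall e : R, 0 < e -> \forall t \near U, nrm (u t - cxy x y) < e.
  move=> e e0; have e20 : 0 < e / 2 by rewrite divr_gt0.
  move/cvgrPdist_lt : Hx => /(_ _ e20) Hx; move/cvgrPdist_lt : Hy => /(_ _ e20) Hy.
  apply: filterS2 Hx Hy => t /= tx ty.
  apply: le_lt_trans (nrm_ReIm _) _.
  have -> : complex.Re (u t - cxy x y) = complex.Re (u t) - x by case: (u t).
  have -> : complex.Im (u t - cxy x y) = complex.Im (u t) - y by case: (u t).
  by rewrite distrC [X in _ + X]distrC; lra.
exists (cxy x y) => //.
apply/ler_addgt0Pr => e e0.
have [t [t1 t2]] := filter_ex (filterI ub (cv e e0)).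
have := nrm_leD (cxy x y) (u t); rewrite nrmBC; lra.
Qed.

End Ultra.

(** * Cauchy's formula and Taylor estimates *)

Section Taylor.
Variable R : realType.
Local Notation C := (Cplx R).
Local Notation cxy := (@cxy R).

(** The square with vertices [1 + i], [1 - i], [-1 + i], [-1 - i] is given by
    [std_corner] and [std_side]. *)
Definition std_corner : C := cxy (-1) (-1).
Definition std_side : C := 2.
Local Notation p0 := std_corner.
Local Notation s0 := std_side.

Lemma std_squareE x y : p0 + s0 * cxy x y = cxy (2 * x - 1) (2 * y - 1).
Proof. by rewrite cxyD cxyZ (cRn R 2) addrC. Qed.

Lemma contour_ge1 w : on_bdry p0 s0 w -> 1 <= nrm w.
Proof.
move=> [x [y [x01 y01 xy ->]]].
have -> : p0 + s0 * cxy x y = cxy (2 * x - 1) (2 * y - 1).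
  by rewrite std_squareE.
case: xy => [xE|[xE|[xE|xE]]].
- by apply: le_trans (nrm_Re _); rewrite /= xE mulr0 add0r normrN normr1.
- apply: le_trans (nrm_Re _); rewrite /= xE mulr1 (_ : 2 - 1 = 1) ?normr1 //; ring.
- by apply: le_trans (nrm_Im _); rewrite /= xE mulr0 add0r normrN normr1.
- apply: le_trans (nrm_Im _); rewrite /= xE mulr1 (_ : 2 - 1 = 1) ?normr1 //; ring.
Qed.

Lemma std_square_lt2 w : square p0 s0 w -> nrm w < 2.
Proof.
move=> [x [y [/andP[x0 x1] /andP[y0 y1] ->]]].
have -> : p0 + s0 * cxy x y = cxy (2 * x - 1) (2 * y - 1).
  by rewrite std_squareE.
set a := 2 * x - 1; set b := 2 * y - 1.
have a1 : a ^+ 2 <= 1 by rewrite /a; nra.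
have b1 : b ^+ 2 <= 1 by rewrite /b; nra.
rewrite -lt_cR -nrmE (@normc_def R) /= ltcR -(@ltr_pXn2r _ 2) ?nnegrE ?sqrtr_ge0 //.
rewrite sqr_sqrtr; last by rewrite addr_ge0 ?sqr_ge0.
lra.
Qed.

Lemma std_square_center z : nrm z <= 1 -> square p0 s0 z.
Proof.
move=> z1; exists ((complex.Re z + 1) / 2), ((complex.Im z + 1) / 2).
have := le_trans (nrm_Re z) z1; have := le_trans (nrm_Im z) z1.
rewrite !ler_norml => /andP[A1 A2] /andP[A3 A4]; split; [by apply/andP; split; lra..|].
clear A1 A2 A3 A4.
rewrite std_squareE; move: {z1} z => [a b] /=.
by apply/eqP; rewrite eq_complex /=; apply/andP; split; apply/eqP; lra.
Qed.

(** [(w - z) ^ -2] has the primitive [- (w - z) ^ -1]: each term of the sum is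
    an increment of the primitive up to [O(1 / N ^ 2)]. *)
Lemma edge_invsq N (z p v : C) : (0 < N)%N -> nrm v <= 2 -> nrm z <= 2^-1 ->
  (forall t : R, 0 <= t <= 1 -> 1 <= nrm (p + v * cR t)) ->
  nrm (edge_sum N (fun w => (w - z)^-1 ^+ 2) p v + ((p + v - z)^-1 - (p - z)^-1)) <= 32 / N%:R.
Proof.
move=> N0 v2 z2 H.
have far (t : R) : 0 <= t <= 1 -> 2^-1 <= nrm (p + v * cR t - z).
  by move=> /H; have := nrm_leD (p + v * cR t) z; lra.
pose g (k : nat) := (p + v * (k%:R / N%:R) - z)^-1.
have NC : (N%:R : C) != 0 by rewrite natC_neq0.
have -> : (p + v - z)^-1 - (p - z)^-1 = \sum_(k < N) (g k.+1 - g k).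
  have := telescope_sumr g (leq0n N); rewrite big_mkord => ->.
  by rewrite /g mul0r mulr0 addr0 divff // mulr1.
rewrite /edge_sum -big_split /=.
apply: le_trans (nrm_sum _ _ _) _.
apply: (@le_trans _ _ (\sum_(k < N) 32 / (N%:R * N%:R))); last first.
  rewrite sumr_const card_ord -[_ *+ N]mulr_natr invfM -!mulrA mulVf ?mulr1 //.
  by rewrite pnatr_eq0 -lt0n.
apply: ler_sum => k _; rewrite /g.
set a := p + v * (k%:R / N%:R) - z; set h := v / N%:R.
have -> : p + v * (k.+1%:R / N%:R) - z = a + h.
  by rewrite /a /h -natr1; field.
have NR : 0 < N%:R :> R by rewrite ltr0n.
have fa (j : nat) : (j <= N)%N -> 2^-1 <= nrm (p + v * (j%:R / N%:R) - z).
  move=> jN; rewrite -!(cRn R) -cRV -cRM; apply: far.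
  by rewrite divr_ge0 //= ler_pdivrMr // mul1r ler_nat.
have a2 : 2^-1 <= nrm a by apply: fa; apply: ltnW.
have ah2 : 2^-1 <= nrm (a + h).
  have -> : a + h = p + v * (k.+1%:R / N%:R) - z by rewrite /a /h -natr1; field.
  exact: fa.
have a0 : a != 0 by rewrite -nrm_gt0; lra.
have ah0 : a + h != 0 by rewrite -nrm_gt0; lra.
have -> : a^-1 ^+ 2 * h + ((a + h)^-1 - a^-1) = h ^+ 2 * (a^-1 ^+ 2 * (a + h)^-1).
  by field; rewrite a0 ah0.
rewrite (nrmM (h ^+ 2)) (nrmM (a^-1 ^+ 2)) !nrmX !nrmV.
have i1 : (nrm a)^-1 <= 2 by rewrite -[2]invrK lef_pV2 ?posrE //; lra.
have i2 : (nrm (a + h))^-1 <= 2 by rewrite -[2]invrK lef_pV2 ?posrE //; lra.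
have i10 : 0 <= (nrm a)^-1 by rewrite invr_ge0 nrm_ge0.
have i20 : 0 <= (nrm (a + h))^-1 by rewrite invr_ge0 nrm_ge0.
have hE : nrm h = nrm v / N%:R by rewrite nrmM nrmV nrm_nat.
have h2 : nrm h ^+ 2 <= 4 / (N%:R * N%:R).
  rewrite hE expr2 mulrACA -invfM; apply: ler_wpM2r.
    by rewrite invr_ge0 mulr_ge0 // ltW.
  have := nrm_ge0 v; move: v2; set V := nrm v => v2 v0.
  have -> : 4 = 2 * 2 :> R by ring.
  exact: ler_pM.
have -> : 32 / (N%:R * N%:R) = 4 / (N%:R * N%:R) * 8 :> R by rewrite mulrAC; congr (_ / _); ring.
apply: ler_pM => //; rewrite ?sqr_ge0 //.
  by rewrite mulr_ge0 // exprn_ge0.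
nra.
Qed.

Lemma bdry_invsq N (z : C) : (0 < N)%N -> nrm z <= 2^-1 ->
  nrm (bdry_sum N (fun w => (w - z)^-1 ^+ 2) p0 s0) <= 128 / N%:R.
Proof.
move=> N0 z2; rewrite /bdry_sum; set i := cxy 0 1; set g := fun w => _.
have i1 := @nrm_cxy01 R.
have s2 : nrm s0 <= 2 by rewrite nrm_nat.
have is2 : nrm (i * s0) <= 2 by rewrite nrmM i1 mul1r nrm_nat.
have onb (x y : R) : 0 <= x <= 1 -> 0 <= y <= 1 -> x = 0 \/ x = 1 \/ y = 0 \/ y = 1 ->
  1 <= nrm (p0 + s0 * cxy x y) by move=> ? ? ?; apply: contour_ge1; exists x, y.
have u0 : ((0 : R) <= (0 : R)) && ((0 : R) <= (1 : R)) by rewrite lexx ler01.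
have u1 : ((0 : R) <= (1 : R)) && ((1 : R) <= (1 : R)) by rewrite lexx ler01.
have e1 := @edge_invsq N z p0 s0 N0 s2 z2 (fun t t01 => onb t 0 t01 u0 (or_intror (or_intror (or_introl erefl)))).
have e2 : nrm (edge_sum N g (p0 + i * s0) s0 + ((p0 + i * s0 + s0 - z)^-1 - (p0 + i * s0 - z)^-1)) <= 32 / N%:R.
  apply: edge_invsq => // t t01.
  have := onb t 1 t01 u1 (or_intror (or_intror (or_intror erefl))).
  by rewrite cxyE cR1 -/i; congr (_ <= nrm _); ring.
have e3 : nrm (edge_sum N g p0 (i * s0) + ((p0 + i * s0 - z)^-1 - (p0 - z)^-1)) <= 32 / N%:R.
  apply: edge_invsq => // t t01.
  have := onb 0 t u0 t01 (or_introl erefl).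
  by rewrite cxyE cR0 -/i; congr (_ <= nrm _); ring.
have e4 : nrm (edge_sum N g (p0 + s0) (i * s0) + ((p0 + s0 + i * s0 - z)^-1 - (p0 + s0 - z)^-1)) <= 32 / N%:R.
  apply: edge_invsq => // t t01.
  have := onb 1 t u1 t01 (or_intror (or_introl erefl)).
  by rewrite cxyE cR1 -/i; congr (_ <= nrm _); ring.
rewrite (addrAC p0 (i * s0) s0) in e2.
move: e1 e2 e3 e4; set A1 := (p0 + s0 - z)^-1; set A2 := (p0 - z)^-1.
set A3 := (p0 + s0 + i * s0 - z)^-1; set A4 := (p0 + i * s0 - z)^-1.
set E1 := edge_sum _ _ p0 s0; set E2 := edge_sum _ _ _ s0; set E3 := edge_sum _ _ p0 _; set E4 := edge_sum _ _ _ _.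
move=> e1 e2 e3 e4.
have -> : E1 + E4 - E2 - E3 = (E1 + (A1 - A2)) + (E4 + (A3 - A1)) - (E2 + (A3 - A4)) - (E3 + (A4 - A2)) by ring.
have -> : 128 / N%:R = 32 / N%:R + 32 / N%:R + 32 / N%:R + 32 / N%:R :> R by lra.
apply: le_trans (nrmB _ _) (lerD _ e3).
apply: le_trans (nrmB _ _) (lerD _ e2).
by apply: le_trans (nrmD _ _) (lerD _ e4).
Qed.

End Taylor.

Section Kernel.
Variable R : realType.
Local Notation C := (Cplx R).
Local Notation cxy := (@cxy R).
Local Notation p0 := (std_corner R).
Local Notation s0 := (std_side R).

(** Approximates [2 pi i].  The estimates below say as much as is used: it is
    bounded away from [0] and almost independent of [z]. *)
Definition cauchy_kernel (N : nat) (z : C) := bdry_sum N (fun w => (w - z)^-1) p0 s0.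

Lemma nrm_s0 : nrm s0 = 2. Proof. exact: nrm_nat. Qed.

Lemma far_contour w z : on_bdry p0 s0 w -> nrm z <= 2^-1 ->
  [/\ w != 0, w - z != 0, nrm w^-1 <= 1 & nrm (w - z)^-1 <= 2].
Proof.
move=> /contour_ge1 w1 z2.
have wz : 2^-1 <= nrm (w - z) by have := nrm_leD w z; lra.
split; rewrite -?nrm_gt0 ?nrmV; [lra|lra| |].
  by rewrite invf_le1 //; lra.
by rewrite -[2]invrK lef_pV2 ?posrE //; lra.
Qed.

Lemma cauchy_kernel_step N z z' : (0 < N)%N -> nrm z <= 2^-1 -> nrm z' <= 2^-1 ->
  nrm (cauchy_kernel N z - cauchy_kernel N z') <= 64 * nrm (z - z') ^+ 2 + 128 / N%:R * nrm (z - z').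
Proof.
move=> N0 z2 z'2.
set B := bdry_sum N (fun w => (w - z')^-1 ^+ 2) p0 s0.
have -> : cauchy_kernel N z - cauchy_kernel N z' = (cauchy_kernel N z - cauchy_kernel N z' - (z - z') * B) + (z - z') * B.
  by rewrite subrK.
apply: le_trans (nrmD _ _) _; apply: lerD; last first.
  by rewrite nrmM mulrC ler_wpM2r ?nrm_ge0 // bdry_invsq.
rewrite /cauchy_kernel /B -bdryZ -!bdryB.
have -> : 64 * nrm (z - z') ^+ 2 = 4 * (8 * nrm (z - z') ^+ 2) * nrm s0.
  by rewrite nrm_s0; ring.
apply: bdry_le => // w wb.
have [w0 wz wi wzi] := far_contour wb z2; have [_ wz' _ wzi'] := far_contour wb z'2.
have -> : (w - z)^-1 - (w - z')^-1 - (z - z') * (w - z')^-1 ^+ 2 =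
   (z - z') ^+ 2 * ((w - z')^-1 ^+ 2 * (w - z)^-1).
  by move: wz wz' => wz wz'; field; rewrite wz wz'.
rewrite (nrmM (_ ^+ 2)) (nrmM (_ ^+ 2)) !nrmX mulrC ler_wpM2r ?exprn_ge0 ?nrm_ge0 //.
have := nrm_ge0 (w - z')^-1; have := nrm_ge0 (w - z)^-1.
move: wzi wzi'; set a := nrm _; set b := nrm _ => ? ? ? ?.
have : b ^+ 2 <= 4 by rewrite expr2; nra.
have := sqr_ge0 b; nra.
Qed.

(** The derivative in [z] is the sum for [(w - z) ^ -2], which is nearly [0];
    [z] is joined to [0] by [L] equal steps. *)
Lemma cauchy_kernel_const N z : (0 < N)%N -> nrm z <= 2^-1 ->
  nrm (cauchy_kernel N z - cauchy_kernel N 0) <= 128 / N%:R.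
Proof.
move=> N0 z2; apply/ler_addgt0Pr => e e0.
have NR : 0 < N%:R :> R by rewrite ltr0n.
pose L := (Num.bound (64 / e)).+1.
have L0 : 0 < L%:R :> R by rewrite ltr0n.
have LC : (L%:R : C) != 0 by rewrite natC_neq0.
have Le : 64 / L%:R <= e.
  rewrite ler_pdivrMr // mulrC -ler_pdivrMr // /L.
  have : 64 / e < (Num.bound (64 / e))%:R by apply: archi_boundP; rewrite divr_ge0 // ltW.
  by move=> /ltW /le_trans; apply; rewrite ler_nat.
pose zz (k : nat) : C := z * (k%:R / L%:R).
have zzL : zz L = z by rewrite /zz divff // mulr1.
have zz0 : zz 0 = 0 by rewrite /zz mul0r mulr0.
have zzle k : (k <= L)%N -> nrm (zz k) <= 2^-1.
  move=> kL; rewrite /zz nrmM nrmM nrmV !nrm_nat.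
  have : k%:R / L%:R <= 1 :> R by rewrite ler_pdivrMr // mul1r ler_nat.
  have : 0 <= k%:R / L%:R :> R by rewrite divr_ge0.
  have := nrm_ge0 z; nra.
rewrite -{1}zzL -{1}zz0.
have := telescope_sumr (fun k => cauchy_kernel N (zz k)) (leq0n L); rewrite big_mkord => <-.
apply: le_trans (nrm_sum _ _ _) _.
apply: (@le_trans _ _ (\sum_(k < L) (64 / (L%:R * L%:R) + 128 / N%:R / L%:R))).
  apply: ler_sum => k _.
  apply: le_trans (cauchy_kernel_step N0 (zzle _ (ltn_ord k)) (zzle _ (ltnW (ltn_ord k)))) _.
  have -> : zz k.+1 - zz k = z / L%:R by rewrite /zz -natr1; field.
  rewrite nrmM nrmV nrm_nat.
  have z1 : nrm z <= 1 by lra.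
  have Li : 0 < L%:R^-1 :> R by rewrite invr_gt0.
  have zL : nrm z / L%:R <= L%:R^-1 by rewrite ger_pMl.
  have zL0 : 0 <= nrm z / L%:R by rewrite divr_ge0 ?nrm_ge0 // ltW.
  apply: lerD.
    rewrite invfM ler_pM2l // expr2; exact: ler_pM.
  by rewrite ler_wpM2l // divr_ge0 // ltW.
rewrite sumr_const card_ord -[_ *+ L]mulr_natr mulrDl mulfVK ?gt_eqF // invfM mulrA mulfVK ?gt_eqF //.
by rewrite addrC lerD2l.
Qed.

Lemma ImD (a b : C) : complex.Im (a + b) = complex.Im a + complex.Im b.
Proof. by case: a b => [? ?] [? ?]. Qed.

Lemma ImMr (a : C) (r : R) : complex.Im (a * cR r) = complex.Im a * r.
Proof. by case: a => a b /=; rewrite mulr0 add0r. Qed.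

Lemma Im_edge_inv N (y : R) : (0 < N)%N -> y = 1 \/ y = -1 ->
  1 <= - y * complex.Im (edge_sum N (fun w => (w - 0)^-1) (cxy (-1) y) s0).
Proof.
move=> N0 y1; rewrite /edge_sum (big_morph _ ImD (erefl : complex.Im (0 : C) = 0)) mulr_sumr.
have NR : 0 < N%:R :> R by rewrite ltr0n.
apply: (@le_trans _ _ (\sum_(k < N) N%:R^-1)).
  by rewrite sumr_const card_ord -[_ *+ N]mulr_natr mulVf // gt_eqF.
apply: ler_sum => k _; rewrite subr0.
pose t : R := k%:R / N%:R.
have t0 : 0 <= t by rewrite divr_ge0.
have t1 : t <= 1 by rewrite ler_pdivrMr // mul1r ler_nat ltnW.
have -> : cxy (-1) y + s0 * (k%:R / N%:R) = cxy (2 * t - 1) y.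
  have -> : s0 * (k%:R / N%:R) = cxy (2 * t) 0.
    rewrite -[0](mulr0 2) cxyZ (cRn R 2) /t -(cRn R k) -(cRn R N) -cRV -cRM //.
  by rewrite -cxyD addr0; congr Complex; rewrite addrC.
have -> : s0 / N%:R = cR (2 / N%:R) by rewrite cRM cRV !cRn.
rewrite ImMr /=; set x := 2 * t - 1.
have x1 : x ^+ 2 <= 1 by rewrite /x expr2; nra.
have x0 := sqr_ge0 x.
have yy : y ^+ 2 = 1 by case: y1 => ->; ring.
rewrite yy.
have -> : - y * (- (y / (x ^+ 2 + 1)) * (2 / N%:R)) = y ^+ 2 * (2 / (x ^+ 2 + 1)) / N%:R.
  by field; rewrite gt_eqF //= gt_eqF //; lra.
rewrite yy mul1r ler_pMl ?invr_gt0 // ler_pdivlMr; lra.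
Qed.

(** Multiplication by [i] permutes the sides and preserves the sums, which
    reduces the kernel to twice the difference of two sides; the imaginary parts of
    both have the sign that makes them add up. *)
Lemma cauchy_kernel0_ge N : (0 < N)%N -> 4 <= nrm (cauchy_kernel N 0).
Proof.
move=> N0; apply: le_trans (nrm_Im _); apply: le_trans (ler_norm _).
set i := cxy 0 1; set g : C -> C := fun w => (w - 0)^-1.
have i0 : i != 0 by rewrite -nrm_gt0 nrm_cxy01.
have ii : i * i = -1 := @sqr_i R.
have rot p v : edge_sum N g (i * p) (i * v) = edge_sum N g p v.
  apply: eq_bigr => k _; rewrite /g !subr0.
  have -> : i * p + i * v * (k%:R / N%:R) = i * (p + v * (k%:R / N%:R)) by ring.
  by rewrite invfM -(mulrA i v) mulrACA mulVf // mul1r.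
have p0E : p0 = -1 - i by rewrite /std_corner cxyE -/i cRN cR1 mulrN1.
have E1 : p0 + s0 = i * p0.
  have -> : i * p0 = - i - i * i by rewrite p0E; ring.
  by rewrite p0E ii /std_side; ring.
have E2 : p0 = i * (p0 + i * s0) by rewrite mulrDr -E1 mulrA ii mulN1r addrK.
have E3 : p0 + i * s0 = cxy (-1) 1.
  by rewrite p0E cxyE -/i cRN cR1 /std_side; ring.
have E4 : edge_sum N g p0 (i * s0) = edge_sum N g (p0 + i * s0) s0 by rewrite {1}E2 rot.
rewrite /cauchy_kernel /bdry_sum -/i -/g E1 rot E4 E3.
have H1 := Im_edge_inv N0 (or_introl erefl).
have H2 := Im_edge_inv N0 (or_intror erefl).
rewrite -/g in H1 H2.
have -> (a b : C) : a + a - b - b = (a - b) * cR 2 by rewrite (cRn R 2); ring.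
rewrite ImMr ImD.
have -> (b : C) : complex.Im (- b) = - complex.Im b by case: b.
by rewrite /std_corner in H2 *; lra.
Qed.

End Kernel.

Section Taylor2.
Variable R : realType.
Local Notation C := (Cplx R).
Local Notation cxy := (@cxy R).
Local Notation p0 := (std_corner R).
Local Notation s0 := (std_side R).

Lemma differentiable_quotient (f : C -> C) (z w c : C) : w != z -> differentiable f w ->
  differentiable (fun w => (f w - c) * (w - z)^-1) w.
Proof.
move=> wz df.
apply: (@differentiableM _ _ (fun w => f w - c) (fun w => (w - z)^-1)).
  by apply: (@differentiableB _ _ _ f (cst c)).
apply: (@differentiableV _ _ (fun w => w - z)); last by rewrite subr_eq0.
exact: (@differentiableB _ _ _ id (cst z)).
Qed.

Variables (f : C -> C) (M : R).
Hypothesis df : forall w, square p0 s0 w -> differentiable f w.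
Hypothesis fM : forall w, square p0 s0 w -> nrm (f w) <= M.

Let M0 : 0 <= M.
Proof. by apply: le_trans (nrm_ge0 (f 0)) (fM _); apply: std_square_center; rewrite nrm0. Qed.

Let s00 : s0 != 0. Proof. by rewrite pnatr_eq0. Qed.

Definition dyadic_point (z : C) := exists m (a b : int), z = p0 + s0 * cxy (a%:~R / 2 ^+ m) (b%:~R / 2 ^+ m).

(** The difference quotient of [f] at [z] is bounded, and differentiable except
    at [z], so its sums become small. *)
Lemma cauchy_grid z (e : R) : dyadic_point z -> nrm z <= 2^-1 -> 0 < e ->
  exists n0, forall n, (n0 <= n)%N ->
    nrm (f z * cauchy_kernel (2 ^ n) z - bdry_sum (2 ^ n) (fun w => f w * (w - z)^-1) p0 s0) <= e.
Proof.
move=> [m [a [b zE]]] z2 e0.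
have zQ : square p0 s0 z by apply: std_square_center; lra.
have [A HA] := (differentiable1P f z).1 (df zQ).
have [d d0 Hd] := HA 1 ltr01.
pose q w := (f w - f z) * (w - z)^-1.
pose K := (nrm A + 1) + 2 * M / d.
have Md : 0 <= 2 * M / d by apply: divr_ge0; [rewrite mulr_ge0 // M0|exact: ltW].
have := @small_grid R q z K m p0 s0 a b e e0 s00 zE.
case.
  move=> w wQ; split; last by move=> /eqP wz; apply: differentiable_quotient => //; apply: df.
  have [->|wz] := eqVneq w z.
    by rewrite /q subrr mul0r nrm0 /K; have := nrm_ge0 A; lra.
  have wz0 : 0 < nrm (w - z) by rewrite nrm_gt0 subr_eq0.
  rewrite /q nrmM nrmV ler_pdivrMr //.
  have [near|far] := ltP (nrm (w - z)) d.
    have := Hd w near; rewrite mul1r.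
    have := nrm_leD (f w - f z) (A * (w - z)); rewrite nrmM => h1 h2.
    have h3 : 0 <= 2 * M / d * nrm (w - z) by rewrite mulr_ge0 // ltW.
    by rewrite /K !mulrDl mul1r; lra.
  have h1 : nrm (f w - f z) <= 2 * M.
    by apply: le_trans (nrmB _ _) _; have := fM wQ; have := fM zQ; lra.
  have h2 : 2 * M <= 2 * M / d * nrm (w - z).
    by rewrite -mulrA ler_peMr ?mulr_ge0 ?M0 // mulrC ler_pdivlMr // mul1r.
  have h3 : 0 <= (nrm A + 1) * nrm (w - z).
    by rewrite mulr_ge0 ?addr_ge0 ?nrm_ge0.
  by rewrite /K mulrDl; lra.
move=> n0 H; exists n0 => n /H {}H.
have N0 : (0 < 2 ^ n)%N by rewrite expn_gt0.
rewrite /cauchy_kernel -bdryZ nrmBC -bdryB.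
apply: le_trans H; rewrite (@bdry_ext _ _ _ q) //.
by move=> w wb; rewrite /q mulrBl.
Qed.

Definition cauchy_coef N j := bdry_sum N (fun w => f w * w^-1 ^+ j.+1) p0 s0.

Lemma cauchy_coef_le N j : (0 < N)%N -> nrm (cauchy_coef N j) <= 8 * M.
Proof.
move=> N0; have -> : 8 * M = 4 * M * nrm s0 by rewrite nrm_s0; ring.
apply: bdry_le => // w wb; rewrite nrmM nrmX nrmV.
have w1 := contour_ge1 wb.
rewrite -[leRHS]mulr1; apply: ler_pM; rewrite ?nrm_ge0 ?exprn_ge0 ?invr_ge0 ?nrm_ge0 //.
  by apply: fM; apply: on_bdry_square.
by rewrite exprn_ile1 ?invr_ge0 ?nrm_ge0 // invf_le1 // (lt_le_trans ltr01).
Qed.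

(** The geometric expansion of [(w - z) ^ -1] in powers of [z / w], with its
    exact remainder. *)
Lemma cauchy_coef_expand N m z : (0 < N)%N -> nrm z <= 2^-1 ->
  bdry_sum N (fun w => f w * (w - z)^-1) p0 s0 - \sum_(j < m) z ^+ j * cauchy_coef N j
  = bdry_sum N (fun w => f w * (z ^+ m * (w^-1 ^+ m * (w - z)^-1))) p0 s0.
Proof.
move=> N0 z2; elim: m => [|m IH].
  by rewrite big_ord0 subr0; apply: bdry_ext => // w wb; rewrite !expr0 !mul1r.
rewrite big_ord_recr /= opprD addrA IH /cauchy_coef -bdryZ -bdryB.
apply: bdry_ext => // w wb; have [w0 wz _ _] := far_contour wb z2.
rewrite !exprS; move: (z ^+ m) (w^-1 ^+ m) (f w) => A B D.
by field; rewrite w0 wz.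
Qed.

Lemma cauchy_coef_remainder N m z (r : R) : (0 < N)%N -> nrm z <= r -> r <= 2^-1 ->
  nrm (bdry_sum N (fun w => f w * (w - z)^-1) p0 s0 - \sum_(j < m) z ^+ j * cauchy_coef N j)
  <= 16 * M * r ^+ m.
Proof.
move=> N0 zr r2; have z2 := le_trans zr r2; rewrite cauchy_coef_expand //.
have -> : 16 * M * r ^+ m = 4 * (M * (r ^+ m * (1 * 2))) * nrm s0 by rewrite nrm_s0; ring.
apply: bdry_le => // w wb; have [w0 wz wi wzi] := far_contour wb z2.
rewrite (nrmM (f w)) (nrmM (z ^+ m)) (nrmM (w^-1 ^+ m)) nrmX (nrmX w^-1).
have ze := nrm_ge0 z; have we := nrm_ge0 w^-1; have wze := nrm_ge0 (w - z)^-1.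
apply: ler_pM; rewrite ?nrm_ge0 ?mulr_ge0 ?exprn_ge0 //.
  by apply: fM; apply: on_bdry_square.
apply: ler_pM; rewrite ?nrm_ge0 ?mulr_ge0 ?exprn_ge0 //.
  by rewrite lerXn2r // nnegrE // (le_trans ze).
by apply: ler_pM; rewrite ?exprn_ge0 // exprn_ile1.
Qed.

(** Cauchy's formula divided by the kernel, in the limit along an ultrafilter
    on the number of points.  The coefficients are the same for all orders [m]. *)
Lemma taylor_grid : exists c : nat -> C, forall m z (r : R), dyadic_point z ->
  nrm z <= r -> r <= 2^-1 -> nrm (f z - \sum_(j < m) z ^+ j * c j) <= 4 * M * r ^+ m.
Proof.
have [U [UU Uoo]] := @ultraFilterLemma nat \oo _.
have UF : Filter U by apply: filter_filter.
have Uge n0 : \forall n \near U, (n0 <= n)%N by apply: Uoo; exists n0.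
have pw n : (0 < 2 ^ n)%N by rewrite expn_gt0.
have k8 n : nrm (cauchy_kernel (2 ^ n) (0 : C)) <= 8.
  apply: (@le_trans _ _ (4 * 1 * nrm s0)); last by rewrite nrm_s0; lra.
  apply: bdry_le => // w wb.
  have z2 : nrm (0 : C) <= 2^-1 by rewrite nrm0.
  by have [_ _ wi _] := far_contour wb z2; rewrite subr0.
have [k _ Hk] := @ultra_bounded R nat U UU (fun n => cauchy_kernel (2 ^ n) (0 : C)) 8 (filterE UF (fun n => k8 n)).
have /choice [a Ha] j : exists l : C, forall e : R, 0 < e -> \forall n \near U, nrm (cauchy_coef (2 ^ n) j - l) < e.
  have [l _ Hl] := @ultra_bounded R nat U UU (fun n => cauchy_coef (2 ^ n) j) (8 * M) (filterE UF (fun n => cauchy_coef_le j (pw n))).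
  by exists l.
have k4 : 4 <= nrm k.
  apply/ler_addgt0Pr => e e0.
  have [n Hn] := filter_ex (Hk e e0).
  by have := nrm_leD (cauchy_kernel (2 ^ n) (0 : C)) k; have := @cauchy_kernel0_ge R _ (pw n); lra.
exists (fun j => a j / k) => m z r zg zr r2.
have z2 := le_trans zr r2.
have k0 : k != 0 by rewrite -nrm_gt0; lra.
have r0 : 0 <= r := le_trans (nrm_ge0 z) zr.
suff H : nrm (f z * k - \sum_(j < m) z ^+ j * a j) <= 16 * M * r ^+ m.
  have -> : f z - \sum_(j < m) z ^+ j * (a j / k) = (f z * k - \sum_(j < m) z ^+ j * a j) / k.
    rewrite mulrBl mulfK //; congr (_ - _); rewrite mulr_suml.
    by apply: eq_bigr => j _; rewrite mulrA.
  rewrite nrmM nrmV ler_pdivrMr ?(lt_le_trans _ k4) //.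
  apply: (le_trans H); have h : 0 <= 4 * M * r ^+ m by rewrite !mulr_ge0 ?M0 ?exprn_ge0.
  by have := ler_wpM2l h k4; lra.
apply/ler_addgt0Pr => e e0.
have e5 : 0 < e / 5 by rewrite divr_gt0.
have zM : nrm (f z) <= M by apply: fM; apply: std_square_center; lra.
have [n0 Hn0] := cauchy_grid zg z2 e5.
have sums : \forall n \near U, nrm (\sum_(j < m) z ^+ j * cauchy_coef (2 ^ n) j - \sum_(j < m) z ^+ j * a j) <= e / 5.
  pose e' := e / 5 / m.+1%:R.
  have e'0 : 0 < e' by rewrite divr_gt0.
  have : \forall n \near U, forall j : 'I_m, nrm (cauchy_coef (2 ^ n) j - a j) < e'.
    by apply: filter_forall => j; apply: Ha.
  apply: filterS => n H; rewrite -sumrB; apply: le_trans (nrm_sum _ _ _) _.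
  apply: (@le_trans _ _ (\sum_(j < m) e')).
    apply: ler_sum => j _; rewrite -mulrBr nrmM nrmX.
    apply: le_trans (ltW (H j)); rewrite ler_piMl ?nrm_ge0 // exprn_ile1 ?nrm_ge0 //; lra.
  rewrite sumr_const card_ord -[_ *+ m]mulr_natr /e' -mulrA ger_pMr //.
  by rewrite mulrC ler_pdivrMr // mul1r ler_nat.
pose n1 := Num.bound (M * 128 / (e / 5)).
have M1 : 0 <= M * 128 by rewrite mulr_ge0 // M0.
have eM : 0 < e / 5 / (M + 1) by rewrite divr_gt0 // ltr_pwDr // M0.
have [n [[[h1 h2] h3] h4]] :=
  filter_ex (filterI (filterI (filterI (Uge n0) (Uge n1)) sums) (Hk _ eM)).
have h5 := @cauchy_kernel_const R (2 ^ n) z (pw n) z2.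
have h6 := cauchy_coef_remainder m (pw n) zr r2.
have {Hn0} h7 := Hn0 n h1.
move: h3 h4 h5 h6 h7; set B := bdry_sum _ _ _ _; set S := \sum_(j < m) z ^+ j * cauchy_coef _ _.
set S' := \sum_(j < m) z ^+ j * a j; set W := cauchy_kernel _ z; set W0 := cauchy_kernel _ 0 => h3 h4 h5 h6 h7.
have -> : f z * k - S' = - (f z * (W0 - k)) - (f z * (W - W0)) + (f z * W - B) + (B - S) + (S - S') by ring.
have b1 : nrm (f z * (W0 - k)) <= e / 5.
  rewrite nrmM; apply: (@le_trans _ _ ((M + 1) * (e / 5 / (M + 1)))).
    by apply: ler_pM; rewrite ?nrm_ge0 ?ltW //; lra.
  by rewrite mulrC mulfVK // gt_eqF // ltr_pwDr // M0.
have b2 : nrm (f z * (W - W0)) <= e / 5.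
  rewrite nrmM; apply: (@le_trans _ _ (M * (128 / (2 ^ n)%:R))).
    by apply: ler_pM; rewrite ?nrm_ge0.
  rewrite mulrA ler_pdivrMr ?ltr0n // [e / 5 * _]mulrC -ler_pdivrMr //.
  have : M * 128 / (e / 5) < n1%:R by apply: archi_boundP; rewrite divr_ge0 // ltW.
  move=> /ltW /le_trans; apply; rewrite ler_nat; apply: leq_trans h2 _.
  exact: ltnW (ltn_expl _ _).
apply: le_trans (nrmD _ _) _.
have t1 := nrmD (- (f z * (W0 - k)) - (f z * (W - W0)) + (f z * W - B)) (B - S).
have t2 := nrmD (- (f z * (W0 - k)) - (f z * (W - W0))) (f z * W - B).
have t3 := nrmB (- (f z * (W0 - k))) (f z * (W - W0)).
rewrite nrmN in t3.
by lra.
Qed.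

Lemma grid_dense z (d : R) : 0 < d -> exists2 w, dyadic_point w & nrm (w - z) < d.
Proof.
move=> d0; case: z => x y.
pose m := Num.bound (4 / d).
have hm : 4 / d < 2 ^+ m.
  apply: (@lt_le_trans _ _ m%:R); first by apply: archi_boundP; rewrite divr_ge0 // ltW.
  by rewrite -natrX ler_nat ltnW // ltn_expl.
have t0 : 0 < 2 ^+ m :> R by rewrite exprn_gt0.
pose fl (u : R) : int := Num.floor ((u + 1) / 2 * 2 ^+ m).
have Hf (u : R) : `|2 * ((fl u)%:~R / 2 ^+ m) - 1 - u| < d / 2.
  have := floor_le_tmp ((u + 1) / 2 * 2 ^+ m); have := floorD1_gt ((u + 1) / 2 * 2 ^+ m).
  rewrite -/(fl u) intrD; set F : R := (fl u)%:~R => h1 h2.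
  have h3 : F / 2 ^+ m <= (u + 1) / 2 by rewrite ler_pdivrMr.
  have h4 : (u + 1) / 2 - (2 ^+ m)^-1 < F / 2 ^+ m.
    rewrite ltr_pdivlMr // mulrBl mulVf ?gt_eqF //; lra.
  have h5 : (2 ^+ m)^-1 < d / 4.
    by rewrite -[d / 4]invrK ltf_pV2 ?posrE ?invr_gt0 ?divr_gt0 // invf_div.
  by rewrite ltr_norml; apply/andP; split; lra.
exists (p0 + s0 * cxy ((fl x)%:~R / 2 ^+ m) ((fl y)%:~R / 2 ^+ m)).
  by exists m, (fl x), (fl y).
rewrite std_squareE; apply: le_lt_trans (nrm_ReIm _) _.
have := Hf x; have := Hf y; rewrite /=; lra.
Qed.

(** Both sides are continuous in [z], so the estimate extends from dyadic points
    to all points. *)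
Lemma taylor_std_square : exists c : nat -> C, forall m z, nrm z < 4^-1 ->
  nrm (f z - \sum_(j < m) z ^+ j * c j) <= 4 * M * (2 * nrm z) ^+ m.
Proof.
have [c Hc] := taylor_grid; exists c => m z z4.
have key (r : R) : nrm z < r -> r <= 2^-1 ->
    nrm (f z - \sum_(j < m) z ^+ j * c j) <= 4 * M * r ^+ m.
  move=> zr r2; apply/ler_addgt0Pr => e e0.
  pose g w := f w - \sum_(j < m) w ^+ j * c j.
  have dg : differentiable g z.
    apply: (@differentiableB _ _ _ f (fun w : C => \sum_(j < m) w ^+ j * c j)).
      by apply: df; apply: std_square_center; lra.
    have -> : (fun w => \sum_(j < m) w ^+ j * c j) = \sum_(j < m) (fun w => w ^+ j * c j).
      by apply/funext => w; rewrite fct_sumE.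
    apply: differentiable_sum => j.
    apply: (@differentiableM _ _ (fun w : C => w ^+ j) (cst (c j))) => //.
    case: (nat_of_ord j) => [|j']; first exact: (differentiable_cst (1 : C)).
    have -> : (fun w : C => w ^+ j'.+1) = (@id C) ^+ j'.+1 by rewrite exprfctE.
    exact: differentiableX.
  have /continuous_nrm /(_ e e0) [d d0 Hd] := differentiable_continuous dg.
  have d'0 : 0 < Num.min d (r - nrm z) by rewrite lt_min d0 subr_gt0.
  have [w wg wz] := grid_dense z d'0.
  move: wz; rewrite lt_min => /andP[w1 w2].
  have wr : nrm w <= r by have := nrm_leD w z; lra.
  have h1 : nrm (g w) <= 4 * M * r ^+ m := Hc m w r wg wr r2.
  have h2 : nrm (g w - g z) < e := Hd w w1.
  change (nrm (g z) <= 4 * M * r ^+ m + e).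
  move: (g w) (g z) (4 * M * r ^+ m) h1 h2 => A B K h1 h2.
  by have := nrm_leD B A; rewrite [nrm (B - _)]nrmBC; lra.
have [z0|z0] := eqVneq z 0; last first.
  by apply: key; rewrite -nrm_gt0 in z0; lra.
have zn : nrm z = 0 by rewrite z0 nrm0.
rewrite zn mulr0; case: m key => [|m] key.
  by rewrite expr0 big_ord0 subr0 mulr1; apply: le_trans (fM _) _; [apply: std_square_center; rewrite zn|have := M0; lra].
rewrite expr0n /= mulr0; apply/ler_addgt0Pr => e e0; rewrite add0r.
pose r := Num.min (2^-1) (e / (4 * M + 1)).
have M41 : 0 < 4 * M + 1 by have := M0; lra.
have r0 : 0 < r by rewrite lt_min invr_gt0 ltr0n /= divr_gt0.
apply: le_trans (key r _ _) _; [by rewrite zn|by rewrite ge_min lexx|].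
have r2 : r <= 2^-1 by rewrite ge_min lexx.
have rm : r ^+ m.+1 <= r by rewrite exprS ger_pMr // exprn_ile1 ?ltW //; lra.
have re : r * (4 * M + 1) <= e by rewrite -ler_pdivlMr // ge_min lexx orbT.
have : 4 * M * r ^+ m.+1 <= 4 * M * r by rewrite ler_wpM2l // mulr_ge0 // M0.
by have := ltW r0; lra.
Qed.

End Taylor2.

(** * Functions of one complex variable *)

Section OneVar.
Variable R : realType.
Local Notation C := (Cplx R).

Lemma differentiable_affine (a k z : C) : differentiable (fun w : C => a + k * w) z.
Proof.
apply/differentiable1P; exists k => e e0; exists 1 => // w _.
have -> : a + k * w - (a + k * z) - k * (w - z) = 0 by ring.
by rewrite nrm0 mulr_ge0 ?nrm_ge0 // ltW.
Qed.

Lemma differentiable_powB (z w : C) k : differentiable (fun w => (w - z) ^+ k) w.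
Proof.
case: k => [|k]; first exact: (differentiable_cst (1 : C)).
have -> : (fun w : C => (w - z) ^+ k.+1) = ((@id C) - cst z) ^+ k.+1 by rewrite exprfctE.
apply: differentiableX; apply: differentiableB; last exact: differentiable_cst.
exact: (diff_id w).
Qed.

Definition holo_le (f : C -> C) (a : C) (r M : R) :=
  forall w, nrm (w - a) < r -> differentiable f w /\ nrm (f w) <= M.

Lemma holo_le_ge0 f a r M : 0 < r -> holo_le f a r M -> 0 <= M.
Proof. by move=> r0 H; apply: le_trans (nrm_ge0 (f a)) (H a _).2; rewrite subrr nrm0. Qed.

(** The square of half-side [r / 2] around [a] lies in the disk of radius [r];
    the factor [2 / r] maps it to the standard square. *)
Lemma taylor f a (r M : R) : 0 < r -> holo_le f a r M ->
  exists c : nat -> C, forall m z, nrm (z - a) < r / 8 ->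
    nrm (f z - \sum_(j < m) ((z - a) * cR (2 / r)) ^+ j * c j) <= 4 * M * (4 * nrm (z - a) / r) ^+ m.
Proof.
move=> r0 H; pose g (w : C) := f (a + cR (r / 2) * w).
have r2 : nrm (cR (r / 2) : C) = r / 2 by rewrite nrm_cR ger0_norm // divr_ge0 // ltW.
have gH w : square (std_corner R) (std_side R) w -> differentiable f (a + cR (r / 2) * w) /\ nrm (g w) <= M.
  move=> /std_square_lt2 w2; apply: H; rewrite addrAC subrr add0r nrmM r2.
  by rewrite mulrAC ltr_pdivrMr // ltr_pM2l.
have dg w : square (std_corner R) (std_side R) w -> differentiable g w.
  by move=> /gH [d _]; apply: differentiable_comp (differentiable_affine _ _ _) d.
have [c Hc] := taylor_std_square dg (fun w wQ => (gH w wQ).2).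
exists c => m z za; pose w := (z - a) * cR (2 / r).
have rr : cR (r / 2) * cR (2 / r) = 1 :> C.
  by rewrite -cRM -cR1; congr cR; field; rewrite gt_eqF.
have gw : g w = f z by rewrite /g /w mulrCA rr mulr1 addrC subrK.
have wn : nrm w = nrm (z - a) * (2 / r).
  by rewrite nrmM nrm_cR ger0_norm // divr_ge0 // ltW.
have := Hc m w; rewrite gw wn.
have -> : 2 * (nrm (z - a) * (2 / r)) = 4 * nrm (z - a) / r by field; rewrite gt_eqF.
apply; rewrite mulrA ltr_pdivrMr //.
by have := nrm_ge0 (z - a); lra.
Qed.

Lemma taylor0 (f : C -> C) (a : C) (r M : R) (c : nat -> C) : 0 < r ->
  (forall m z, nrm (z - a) < r / 8 ->
    nrm (f z - \sum_(j < m) ((z - a) * cR (2 / r)) ^+ j * c j) <= 4 * M * (4 * nrm (z - a) / r) ^+ m)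
  -> c 0%N = f a.
Proof.
move=> r0 /(_ 1%N a); rewrite subrr nrm0 mulr0 !mul0r expr1 mulr0 divr_gt0 // => /(_ isT).
rewrite big_ord_recl big_ord0 expr0 mul1r addr0 => H.
by apply/eqP; rewrite eq_sym -subr_eq0 -nrm_eq0 eq_le H nrm_ge0.
Qed.

(** Near [a] this is the Taylor estimate of order one, further away the trivial
    bound [2 * M].  The constant is not sharp. *)
Lemma schwarz f a (r M : R) z : 0 < r -> holo_le f a r M -> nrm (z - a) < r ->
  nrm (f z - f a) <= 16 * M / r * nrm (z - a).
Proof.
move=> r0 H zr; have M0 := holo_le_ge0 r0 H.
have [zs|zl] := ltP (nrm (z - a)) (r / 8).
  have [c Hc] := taylor r0 H; have c0 := taylor0 r0 Hc.
  have := Hc 1%N z zs; rewrite big_ord_recl big_ord0 expr0 mul1r addr0 c0 expr1.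
  by move=> /le_trans; apply; rewrite le_eqVlt; apply/orP; left; apply/eqP; field; rewrite gt_eqF.
have aa : nrm (a - a) < r by rewrite subrr nrm0.
have h1 : nrm (f z - f a) <= 2 * M.
  by apply: le_trans (nrmB _ _) _; have := (H z zr).2; have := (H a aa).2; lra.
have h2 : 2 <= 16 * nrm (z - a) / r by rewrite ler_pdivlMr //; lra.
have -> : 16 * M / r * nrm (z - a) = M * (16 * nrm (z - a) / r) by ring.
by apply: le_trans h1 _; rewrite mulrC ler_wpM2l.
Qed.

Lemma near_bounded (f : C -> C) (a : C) : (\forall w \near a, differentiable f w) ->
  exists r M : R, 0 < r /\ holo_le f a r M.
Proof.
move=> /nbhs_nrm [r r0 H].
have aa : nrm (a - a) < r by rewrite subrr nrm0.
have /continuous_nrm /(_ 1 ltr01) [d d0 Hd] := differentiable_continuous (H a aa).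
exists (Num.min r d), (nrm (f a) + 1); split; first by rewrite lt_min r0.
move=> w; rewrite lt_min => /andP[/H wr /Hd wd]; split=> //.
by have := nrm_leD (f w) (f a); lra.
Qed.

(** The Taylor estimate of order three gives the derivative of the quotient
    at [a]. *)
Lemma removable (f : C -> C) (a : C) : (\forall w \near a, differentiable f w) -> f a = 0 ->
  exists2 psi : C -> C, \forall w \near a, differentiable psi w &
    forall w, f w = (w - a) * psi w.
Proof.
move=> /near_bounded [r [M [r0 H]]] fa.
have M0 := holo_le_ge0 r0 H.
have [c Hc] := taylor r0 H; have c0 := taylor0 r0 Hc; rewrite fa in c0.
set k := cR (2 / r) in Hc.
exists (fun w => if w == a then c 1%N * k else f w * (w - a)^-1); last first.
  move=> w; case: eqP => [->|/eqP wa]; first by rewrite subrr mul0r.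
  by rewrite mulrCA mulfV ?mulr1 // subr_eq0.
apply/nbhs_nrm; exists (r / 8); first by rewrite divr_gt0.
have r8r : r / 8 <= r by lra.
move=> w wr; have [->|wa] := eqVneq w a; last first.
  apply: (@differentiable_near R _ _ (fun w => (f w - 0) * (w - a)^-1)).
    apply/nbhs_nrm; exists (nrm (w - a)); first by rewrite nrm_gt0 subr_eq0.
    move=> v vw; case: eqP => [va|_]; last by rewrite subr0.
    by move: vw; rewrite va nrmBC ltxx.
  by apply: differentiable_quotient => //; apply: (H w (lt_le_trans wr r8r)).1.
apply/differentiable1P; exists (k ^+ 2 * c 2) => e e0.
pose K := 4 * M * (4 / r) ^+ 3.
have K0 : 0 <= K by apply: mulr_ge0; [rewrite mulr_ge0|apply: exprn_ge0; rewrite divr_ge0 // ltW].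
exists (Num.min (r / 8) (e / (K + 1))).
  by rewrite lt_min !divr_gt0 // ltr_pwDr.
move=> v; rewrite lt_min => /andP[v8 vK]; rewrite eqxx.
have [->|va] := eqVneq v a; first by rewrite !subrr mulr0 subr0 nrm0 mulr0.
have va0 : v - a != 0 by rewrite subr_eq0.
have := Hc 3%N v v8.
rewrite !big_ord_recl big_ord0 /= c0 mulr0 add0r addr0 expr1.
have -> : f v - ((v - a) * k * c 1%N + ((v - a) * k) ^+ 2 * c 2) =
   (f v / (v - a) - c 1%N * k - k ^+ 2 * c 2 * (v - a)) * (v - a).
  by field.
rewrite nrmM -ler_pdivlMr ?nrm_gt0 // => /le_trans; apply.
rewrite ler_pdivrMr ?nrm_gt0 //.
have -> : 4 * M * (4 * nrm (v - a) / r) ^+ 3 = (K * nrm (v - a)) * nrm (v - a) * nrm (v - a).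
  by rewrite /K; field; rewrite gt_eqF.
apply: ler_wpM2r; first exact: nrm_ge0.
apply: ler_wpM2r; first exact: nrm_ge0.
rewrite ltr_pdivlMr ?ltr_pwDr // in vK.
by have := nrm_ge0 (v - a); nra.
Qed.

(** The first nonzero Taylor coefficient would dominate the remainder near [a].
    When they all vanish, the estimates of all orders force [f = 0] near [a]. *)
Lemma zeros_near (f : C -> C) (a : C) : (\forall w \near a, differentiable f w) ->
  (forall d : R, 0 < d -> exists w, [/\ w != a, nrm (w - a) < d & f w = 0]) ->
  \forall w \near a, f w = 0.
Proof.
move=> /near_bounded [r [M [r0 H]]] acc.
have M0 := holo_le_ge0 r0 H.
have [c Hc] := taylor r0 H.
set k := cR (2 / r) in Hc.
have k0 : k != 0.
  by rewrite -nrm_gt0 nrm_cR normr_gt0 gt_eqF // divr_gt0.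
have cz m : c m = 0.
  elim/ltn_ind: m => m IH; apply/eqP; apply: contraT => cm0.
  pose K := 4 * M * (4 / r) ^+ m.+1.
  have K0 : 0 <= K by apply: mulr_ge0; [rewrite mulr_ge0|apply: exprn_ge0; rewrite divr_ge0 // ltW].
  have B0 : 0 < nrm (k ^+ m * c m) by rewrite nrm_gt0 mulf_neq0 // expf_neq0.
  have d0 : 0 < Num.min (r / 8) (nrm (k ^+ m * c m) / (K + 1)).
    by rewrite lt_min !divr_gt0 // ltr_pwDr.
  have [w [wa wd fw]] := acc _ d0.
  have wa0 : 0 < nrm (w - a) by rewrite nrm_gt0 subr_eq0.
  move: wd; rewrite lt_min => /andP[w8 wK].
  have := Hc m.+1 w w8; rewrite big_ord_recr /= big1; last first.
    by move=> j _; rewrite IH ?mulr0.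
  have E : nrm (((w - a) * k) ^+ m * c m) = nrm (w - a) ^+ m * nrm (k ^+ m * c m).
    by rewrite exprMn -mulrA nrmM nrmX.
  rewrite fw !add0r nrmN E.
  have -> : 4 * M * (4 * nrm (w - a) / r) ^+ m.+1 = nrm (w - a) ^+ m * (K * nrm (w - a)).
    rewrite /K [4 * nrm _ / r]mulrAC [(4 / r * _) ^+ _]exprMn [nrm (w - a) ^+ m.+1]exprS.
    by move: ((4 / r) ^+ m.+1) => q; ring.
  rewrite ler_pM2l ?exprn_gt0 // => le.
  rewrite ltr_pdivlMr ?ltr_pwDr // in wK.
  by exfalso; nra.
apply/nbhs_nrm; exists (r / 8); first by rewrite divr_gt0.
move=> w w8; apply/eqP; rewrite -nrm_eq0 eq_le nrm_ge0 andbT.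
have q1 : 4 * nrm (w - a) / r <= 2^-1 by rewrite ler_pdivrMr //; lra.
have q0 : 0 <= 4 * nrm (w - a) / r by rewrite divr_ge0 ?mulr_ge0 ?nrm_ge0 // ltW.
apply/ler_addgt0Pr => e e0; rewrite add0r.
pose m := Num.bound (4 * M / e).
apply: (@le_trans _ _ (4 * M * (4 * nrm (w - a) / r) ^+ m)).
  by have := Hc m w w8; rewrite big1 ?subr0 // => j _; rewrite cz mulr0.
apply: (@le_trans _ _ (4 * M * 2^-1 ^+ m)).
  by rewrite ler_wpM2l ?mulr_ge0 // lerXn2r // nnegrE // invr_ge0.
rewrite exprVn ler_pdivrMr ?exprn_gt0 // [e * _]mulrC -ler_pdivrMr //.
have : 4 * M / e < m%:R by apply: archi_boundP; rewrite divr_ge0 ?mulr_ge0 // ltW.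
move=> /ltW /le_trans; apply; rewrite -natrX ler_nat; exact: ltnW (ltn_expl _ _).
Qed.

(** Connectedness of the unit interval as a principle of induction. *)
Lemma segment_induction (P : R -> Prop) : P 0 ->
  (forall t, 0 < t <= 1 -> (forall s, 0 <= s < t -> P s) -> P t) ->
  (forall t, 0 <= t < 1 -> P t -> exists2 e : R, 0 < e & forall s, t < s < t + e -> P s) ->
  P 1.
Proof.
move=> P0 Pl Pr.
pose A := [set t : R | 0 <= t <= 1 /\ forall s, 0 <= s <= t -> P s].
have A0 : A 0.
  by split; [rewrite lexx ler01|move=> s /andP[s0 s0']; have -> : s = 0 by apply/eqP; rewrite eq_le s0 s0'].
have hs : has_sup A by split; [exists 0|exists 1 => t [/andP[]]].
set T := sup A.
have T0 : 0 <= T by apply: ub_le_sup => //; case: hs.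
have T1 : T <= 1 by apply: ge_sup; [case: hs|move=> t [/andP[]]].
have PT s : 0 <= s < T -> P s.
  move=> /andP[s0 sT]; have [t [_ At] st] := sup_gt hs.1 sT.
  by apply: At; rewrite s0 ltW.
have PTT : P T.
  by have [->//|Tn0] := eqVneq T 0; apply: Pl => //; rewrite T1 lt_neqAle eq_sym Tn0 T0.
have [<-//|Tn1] := eqVneq T 1.
have Tl1 : T < 1 by rewrite lt_neqAle Tn1.
have T01 : 0 <= T < 1 by rewrite T0.
have [e e0 He] := Pr T T01 PTT.
pose t := Num.min 1 (T + e / 2).
have : A t.
  split; first by rewrite le_min ler01 ge_min lexx /= addr_ge0 // divr_ge0 // ltW.
  move=> s /andP[s0]; rewrite le_min => /andP[s1 sT].
  have [h|h|->//] := ltgtP s T; first by apply: PT; rewrite s0.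
  by apply: He; rewrite h /=; lra.
move=> At; have : t <= T by apply: ub_le_sup => //; case: hs.
by rewrite ge_min; have := Tl1; lra.
Qed.

(** Unique continuation along segments.  The property is abstract, so that it
    applies to functions as well as to equality of curves in a manifold. *)
Lemma spread (Z : C -> Prop) (a : C) (r : R) :
  (forall b, nrm (b - a) < r ->
    (forall d : R, 0 < d -> exists w, [/\ w != b, nrm (w - b) < d & Z w]) ->
    \forall w \near b, Z w) ->
  (forall d : R, 0 < d -> exists w, [/\ w != a, nrm (w - a) < d & Z w]) ->
  forall z, nrm (z - a) < r -> Z z.
Proof.
move=> H acc z zr.
have [->|za] := eqVneq z a.
  have aa : nrm (a - a) < r by rewrite subrr nrm0 (le_lt_trans (nrm_ge0 _) zr).
  exact: nbhs_singleton (H a aa acc).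
pose g (t : R) := a + cR t * (z - a).
have gt s t : nrm (g s - g t) = `|s - t| * nrm (z - a).
  by rewrite /g opprD addrACA subrr add0r -mulrBl -cRB nrmM nrm_cR.
have za0 : 0 < nrm (z - a) by rewrite nrm_gt0 subr_eq0.
have g0 : g 0 = a by rewrite /g cR0 mul0r addr0.
have g1 : g 1 = z by rewrite /g cR1 mul1r addrC subrK.
have gr t : 0 <= t <= 1 -> nrm (g t - a) < r.
  move=> /andP[t0 t1]; rewrite -g0 gt subr0 ger0_norm //.
  by apply: le_lt_trans zr; rewrite ler_piMl ?nrm_ge0.
suff : \forall w \near g 1, Z w by rewrite g1; apply: nbhs_singleton.
apply: (@segment_induction (fun t => \forall w \near g t, Z w)).
- by rewrite g0; apply: H => //; rewrite subrr nrm0 (le_lt_trans (nrm_ge0 _) zr).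
- move=> t /andP[t0 t1] Ps; apply: H; first by apply: gr; rewrite ltW.
  move=> d d0; pose s := Num.max 0 (t - d / nrm (z - a) / 2).
  have dz : 0 < d / nrm (z - a) by rewrite divr_gt0.
  have st : s < t by rewrite gt_max t0 /=; lra.
  have s0 : 0 <= s by rewrite le_max lexx.
  have s1 : t - d / nrm (z - a) / 2 <= s by rewrite le_max lexx orbT.
  exists (g s); split; last by apply: nbhs_singleton (Ps s _); rewrite s0.
    by rewrite -subr_eq0 -nrm_gt0 gt mulr_gt0 // normr_gt0 subr_eq0 lt_eqF.
  rewrite gt distrC ger0_norm ?subr_ge0 ?ltW // -ltr_pdivlMr //; lra.
- move=> t _ /nbhs_nrm [d d0 Hd]; exists (d / nrm (z - a)); first by rewrite divr_gt0.
  move=> s /andP[ts sd]; apply/nbhs_nrm.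
  have dd : 0 < d - nrm (g s - g t).
    by rewrite subr_gt0 gt ger0_norm ?subr_ge0 ?ltW // -ltr_pdivlMr //; lra.
  exists (d - nrm (g s - g t)) => // w ws; apply: Hd.
  by have := nrm_tri (g s) w (g t); lra.
Qed.

Lemma identity_disk (f : C -> C) (a : C) (r : R) :
  (forall w, nrm (w - a) < r -> differentiable f w) ->
  (forall d : R, 0 < d -> exists w, [/\ w != a, nrm (w - a) < d & f w = 0]) ->
  forall z, nrm (z - a) < r -> f z = 0.
Proof.
move=> df; apply: spread => b br; apply: zeros_near.
apply/nbhs_nrm; exists (r - nrm (b - a)); first by rewrite subr_gt0.
by move=> w wb; apply: df; have := nrm_tri b w a; lra.
Qed.

Variables (T : Type) (U : set_system T).
Hypothesis UU : UltraFilter U.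

Definition nrm_cvg (V : normedModType C) (u : T -> V) (l : V) :=
  forall e : R, 0 < e -> \forall t \near U, nrm (u t - l) < e.

Let UF : Filter U. Proof. exact: filter_filter. Qed.

Lemma nrm_cvg_cvg (V : normedModType C) (u : T -> V) l : nrm_cvg u l <-> u @ U --> l.
Proof. by split=> H; apply/cvg_nrm. Qed.

Lemma nrm_cvg_le (V : normedModType C) (u : T -> V) l a (M : R) : nrm_cvg u l ->
  (\forall t \near U, nrm (u t - a) <= M) -> nrm (l - a) <= M.
Proof.
move=> ul uM; apply/ler_addgt0Pr => e e0.
have [t [h1 h2]] := filter_ex (filterI (ul e e0) uM).
by have := nrm_tri (u t) l a; rewrite [nrm (l - u t)]nrmBC; lra.
Qed.

Lemma nrm_cvgD (V : normedModType C) (u v : T -> V) a b : nrm_cvg u a -> nrm_cvg v b ->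
  nrm_cvg (fun t => u t + v t) (a + b).
Proof.
move=> ua vb e e0; have e2 : 0 < e / 2 by rewrite divr_gt0.
apply: filterS2 (ua _ e2) (vb _ e2) => t h1 h2.
by rewrite opprD addrACA; have := nrmD (u t - a) (v t - b); lra.
Qed.

Lemma nrm_cvgN (V : normedModType C) (u : T -> V) a : nrm_cvg u a -> nrm_cvg (fun t => - u t) (- a).
Proof. by move=> ua e /ua; apply: filterS => t; rewrite -opprD nrmN. Qed.

Lemma nrm_cvgMr (u : T -> C) a (b : C) : nrm_cvg u a -> nrm_cvg (fun t => u t * b) (a * b).
Proof.
move=> ua e e0; have b0 : 0 < nrm b + 1 by rewrite ltr_wpDl ?nrm_ge0.
have e' : 0 < e / (nrm b + 1) by rewrite divr_gt0.
apply: filterS (ua _ e') => t; rewrite -mulrBl nrmM ltr_pdivlMr //.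
by have := nrm_ge0 (u t - a); have := nrm_ge0 b; nra.
Qed.

(** Weierstrass' theorem: Taylor estimates are uniform, so they pass to the
    limit. *)
Lemma differentiable_limit (F : T -> C -> C) (f : C -> C) (a : C) (r M : R) : 0 < r ->
  (\forall t \near U, holo_le (F t) a r M) ->
  (forall w, nrm (w - a) < r -> nrm_cvg (F^~ w) (f w)) -> differentiable f a.
Proof.
move=> r0 HF cv.
have [t0 Ht0] := filter_ex HF; have M0 := holo_le_ge0 r0 Ht0.
have /choice [c Hc] t : exists c : nat -> C, holo_le (F t) a r M ->
   forall m z, nrm (z - a) < r / 8 ->
    nrm (F t z - \sum_(j < m) ((z - a) * cR (2 / r)) ^+ j * c j) <= 4 * M * (4 * nrm (z - a) / r) ^+ m.
  have [h|h] := pselect (holo_le (F t) a r M); last by exists (fun=> 0).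
  by have [c Hc] := taylor r0 h; exists c.
set k := cR (2 / r) in Hc.
have kn : nrm k = 2 / r by rewrite nrm_cR ger0_norm // divr_ge0 // ltW.
have key t : holo_le (F t) a r M -> forall z, nrm (z - a) < r / 8 ->
   nrm (F t z - F t a - c t 1%N * (k * (z - a))) <= 4 * M * (4 * nrm (z - a) / r) ^+ 2.
  move=> h z z8; have := Hc t h 2 z z8.
  rewrite !big_ord_recl big_ord0 expr0 mul1r (taylor0 r0 (Hc t h)) addr0 expr1.
  by rewrite opprD addrA [c t 1%N * _]mulrC [k * _]mulrC.
have bnd : \forall t \near U, nrm (c t 1%N) <= 40 * M.
  apply: filterS HF => t h.
  pose z := a + cR (r / 16).
  have za : nrm (z - a) = r / 16.
    by rewrite /z addrAC subrr add0r nrm_cR ger0_norm // divr_ge0 // ltW.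
  have z8 : nrm (z - a) < r / 8 by rewrite za; lra.
  have zr : nrm (z - a) < r by rewrite za; lra.
  have aa : nrm (a - a) < r by rewrite subrr nrm0.
  have := key t h z z8; rewrite za.
  have -> : 4 * (r / 16) / r = 4^-1 by field; rewrite gt_eqF.
  have n1 : nrm (c t 1%N * (k * (z - a))) = nrm (c t 1%N) / 8.
    by rewrite nrmM (nrmM k) za kn; congr (_ * _); field; rewrite gt_eqF.
  have := nrm_leD (c t 1%N * (k * (z - a))) (F t z - F t a); rewrite nrmBC n1.
  have := nrmB (F t z) (F t a); have := (h z zr).2; have := (h a aa).2.
  move: (nrm (F t z)) (nrm (F t a)) (nrm (F t z - F t a)) (nrm (c t 1%N)) => A B D E.
  move: (nrm _) => G; rewrite expr2; lra.
have [l _ Hl] := ultra_bounded UU bnd.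
apply/differentiable1P; exists (l * k) => e e0.
pose K := 4 * M * (4 / r) ^+ 2.
have K0 : 0 <= K by apply: mulr_ge0; [rewrite mulr_ge0|apply: exprn_ge0; rewrite divr_ge0 // ltW].
exists (Num.min (r / 8) (e / (K + 1))).
  by rewrite lt_min !divr_gt0 // ltr_pwDr.
move=> z; rewrite lt_min => /andP[z8 zK].
have zr : nrm (z - a) < r by lra.
have aa : nrm (a - a) < r by rewrite subrr nrm0.
apply: (@le_trans _ _ (4 * M * (4 * nrm (z - a) / r) ^+ 2)).
  rewrite -mulrA -[X in nrm X]subr0.
  apply: (@nrm_cvg_le _ (fun t => F t z - F t a - c t 1%N * (k * (z - a)))).
    apply: nrm_cvgD; last by apply: nrm_cvgN; apply: nrm_cvgMr.
    by apply: nrm_cvgD; [apply: cv|apply: nrm_cvgN; apply: cv].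
  by apply: filterS HF => t h; rewrite subr0; apply: key.
have -> : 4 * M * (4 * nrm (z - a) / r) ^+ 2 = K * nrm (z - a) * nrm (z - a).
  by rewrite /K; field; rewrite gt_eqF.
apply: ler_wpM2r; first exact: nrm_ge0.
rewrite ltr_pdivlMr ?ltr_pwDr // in zK.
by have := nrm_ge0 (z - a); nra.
Qed.

End OneVar.

(** * Newton's series of a map close to the identity *)

Section Newton.
Variable R : realType.
Local Notation C := (Cplx R).

(** One-variable Schwarz estimate on the complex line through [x] and [y]. *)
Lemma schwarz_rV n m (g : 'rV[C]_n -> 'rV[C]_m) y (d M : R) x : 0 < d ->
  (forall w, nrm (w - y) < d -> differentiable g w /\ nrm (g w) <= M) ->
  nrm (x - y) < d -> nrm (g x - g y) <= 16 * M / d * nrm (x - y).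
Proof.
move=> d0 H xd.
have yy : nrm (y - y) < d by rewrite subrr nrm0.
have M0 : 0 <= M by apply: le_trans (nrm_ge0 (g y)) (H y yy).2.
have [->|xy] := eqVneq x y; first by rewrite !subrr !nrm0 mulr0.
have xy0 : 0 < nrm (x - y) by rewrite nrm_gt0 subr_eq0.
apply: nrm_rV_le => [|i]; first by rewrite mulr_ge0 ?nrm_ge0 // divr_ge0 ?mulr_ge0 // ltW.
pose phi (s : C) := g (y + s *: (x - y)) ord0 i.
have H' : holo_le phi 0 (d / nrm (x - y)) M.
  move=> s; rewrite subr0 ltr_pdivlMr // => sd.
  have [dg gM] : differentiable g (y + s *: (x - y)) /\ nrm (g (y + s *: (x - y))) <= M.
    by apply: H; rewrite addrAC subrr add0r nrmZ.
  split; last exact: le_trans (nrm_coord _ _) gM.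
  apply: (@differentiable_comp_coord R C m (fun s : C => g (y + s *: (x - y)))).
  exact: differentiable_comp (differentiable_line _ _ _) dg.
have := @schwarz R phi 0 (d / nrm (x - y)) M 1; rewrite divr_gt0 // subr0 nrm1 => /(_ isT H').
rewrite ltr_pdivlMr // mul1r => /(_ xd).
have e1 : y + (1 : C) *: (x - y) = x by rewrite scale1r addrC subrK.
have e2 : y + (0 : C) *: (x - y) = y by rewrite scale0r addr0.
rewrite /phi e1 e2 !mxE => /le_trans; apply.
by rewrite mulr1 le_eqVlt; apply/orP; left; apply/eqP; field; rewrite !gt_eqF.
Qed.

(** The iterated difference [(T - 1) ^ j] applied to the identity, where [T] is
    composition with [F]. *)
Fixpoint fwd_diff n (F : 'rV[C]_n -> 'rV[C]_n) (j : nat) : 'rV[C]_n -> 'rV[C]_n :=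
  if j is j'.+1 then fun x => fwd_diff F j' (F x) - fwd_diff F j' x else id.

(** Binomial coefficient with a complex upper argument. *)
Fixpoint gbin (w : C) (j : nat) : C :=
  if j is j'.+1 then gbin w j' * (w - j'%:R) / j'.+1%:R else 1.

Lemma gbin_nat m j : gbin m%:R j = 'C(m, j)%:R.
Proof.
elim: j => [|j IH] /=; first by rewrite bin0.
rewrite IH; have j0 : (j.+1%:R : C) != 0 by rewrite pnatr_eq0.
apply: (mulIf j0); rewrite mulfVK //.
have := mul_bin_left m j.
have [jm|mj] := leqP j m.
  by rewrite -natrB // -!natrM => E; rewrite mulnC -E mulnC.
by rewrite !bin_small // ?mul0r // (ltn_trans mj).
Qed.

Lemma gbin_le w j (B : R) : nrm w + j%:R <= B -> nrm (gbin w j) <= B ^+ j / j`!%:R.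
Proof.
elim: j => [|j IH] le /=; first by rewrite nrm1 expr0 fact0 divr1.
have le' : nrm w + j%:R <= B by apply: le_trans le; rewrite lerD2l ler_nat.
have B0 : 0 <= B by apply: le_trans le; rewrite addr_ge0 ?nrm_ge0.
rewrite nrmM nrmM nrmV nrm_nat factS natrM invfM exprSr.
have -> : B ^+ j * B * (j.+1%:R^-1 / j`!%:R) = B ^+ j / j`!%:R * B / j.+1%:R by ring.
rewrite ler_wpM2r ?invr_ge0 //; apply: ler_pM; rewrite ?nrm_ge0 ?IH //.
by apply: le_trans (nrmB _ _) _; rewrite nrm_nat.
Qed.

Arguments gbin : simpl never.
Arguments fwd_diff : simpl never.

(** A crude form of Stirling's formula, from the size of the central binomial
    coefficient. *)
Lemma pow_fact j : (j%:R ^+ j : R) <= 4 ^+ j * j`!%:R.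
Proof.
have b4 k : ('C(k.*2, k) <= 4 ^ k)%N.
  apply: (@leq_trans (2 ^ k.*2)); last by rewrite -muln2 mulnC expnM.
  rewrite -[2%N]/(1 + 1)%N expnDn.
  have kk : (k < k.*2.+1)%N by rewrite ltnS -addnn leq_addr.
  rewrite (bigD1 (Ordinal kk)) //= !exp1n !muln1; exact: leq_addr.
have f k : (k ^ k * k`! <= k.*2`!)%N.
  have : forall i, (i <= k)%N -> (k ^ i * k`! <= (k + i)`!)%N.
    elim=> [|i IH] ik; first by rewrite addn0 mul1n.
    rewrite addnS factS expnS -mulnA leq_mul ?IH ?(ltnW ik) //.
    by rewrite -addnS leq_addr.
  by move=> /(_ k (leqnn k)); rewrite addnn.
have : (j ^ j <= 4 ^ j * j`!)%N.
  rewrite -(@leq_pmul2r (j`!)) ?fact_gt0 //; apply: (leq_trans (f j)).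
  have := bin_fact (_ : j <= j.*2)%N; rewrite -addnn addnK => <-; last exact: leq_addr.
  by rewrite addnn mulnA !leq_mul // b4.
by rewrite -!natrX -natrM ler_nat.
Qed.

Lemma geo_sum (q : R) m : 0 <= q <= 2^-1 -> \sum_(j < m) q ^+ j <= 2.
Proof.
move=> /andP[q0 q2].
suff : \sum_(j < m) q ^+ j + 2 * q ^+ m <= 2.
  by have := exprn_ge0 m q0; lra.
elim: m => [|m IH]; first by rewrite big_ord0 expr0; lra.
rewrite big_ord_recr /= exprS; have := exprn_ge0 m q0; nra.
Qed.

Section Local.
Variables (n : nat) (F : 'rV[C]_n -> 'rV[C]_n).

(** Newton's forward difference formula [T ^ m = (1 + (T - 1)) ^ m].  The bound
    [N] may exceed [m], as the binomial coefficients vanish beyond [m]. *)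
Lemma fwd_diff_iter m N i x : (m <= N)%N ->
  fwd_diff F i (iter m F x) = \sum_(j < N.+1) gbin m%:R j *: fwd_diff F (i + j) x.
Proof.
elim: m i N => [|m IH] i N mN.
  rewrite big_ord_recl [gbin _ _](gbin_nat 0 0) scale1r addn0 big1 ?addr0 // => j _.
  by rewrite [gbin _ _](gbin_nat 0 j.+1) bin0n scale0r.
have -> : fwd_diff F i (iter m.+1 F x) = fwd_diff F i (iter m F x) + fwd_diff F i.+1 (iter m F x).
  by rewrite -[fwd_diff F i.+1 _]/(fwd_diff F i (iter m.+1 F x) - fwd_diff F i _) addrC subrK.
case: N mN => // N mN.
rewrite (IH i N.+1 (leqW mN)) (IH i.+1 N mN) [in LHS]big_ord_recl [in RHS]big_ord_recl /=.
rewrite -addrA; congr (_ + _); rewrite -big_split /=; apply: eq_bigr => j _.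
by rewrite /bump /= add1n !gbin_nat addnS addSn -scalerDl -natrD binS.
Qed.

Variables (x0 : 'rV[C]_n) (r eps : R).
Hypothesis r0 : 0 < r.
Hypothesis e0 : 0 < eps.
Hypothesis HF : forall x, nrm (x - x0) < r -> differentiable F x /\ nrm (F x - x) <= eps.

Lemma iter_close m : m%:R * eps < r -> nrm (iter m F x0 - x0) <= m%:R * eps.
Proof.
elim: m => [|m IH] mr; first by rewrite /= subrr nrm0 mul0r.
have h : m%:R * eps + eps = m.+1%:R * eps by rewrite -natr1 mulrDl mul1r.
have mr' : m%:R * eps < r by apply: lt_trans mr; rewrite -h ltrDl.
have {IH}IH := IH mr'.
have := (HF (le_lt_trans IH mr')).2; have := nrm_tri (iter m F x0) (iter m.+1 F x0) x0.
by rewrite -h /=; lra.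
Qed.

(** [F] moves points by at most [eps], so by the Schwarz estimate on balls of
    radius [d = r / (J + 1)] each further difference costs a factor [16 * eps / d]. *)
Lemma fwd_diff_bound J : J.+1%:R * eps < r ->
  differentiable (fwd_diff F J.+1) x0 /\ nrm (fwd_diff F J.+1 x0) <= eps * (16 * J.+1%:R * eps / r) ^+ J.
Proof.
move=> Jr; pose d := r / J.+1%:R.
have J0 : 0 < J.+1%:R :> R by rewrite ltr0n.
have d0 : 0 < d by rewrite divr_gt0.
have ed : eps < d by rewrite ltr_pdivlMr // mulrC.
have rd : r = J.+1%:R * d by rewrite /d mulrC divfK // gt_eqF.
have q0 : 0 <= 16 * J.+1%:R * eps / r by rewrite divr_ge0 ?mulr_ge0 // ltW.
suff : forall i, (i <= J)%N -> forall x, nrm (x - x0) < r - i%:R * d ->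
    differentiable (fwd_diff F i.+1) x /\ nrm (fwd_diff F i.+1 x) <= eps * (16 * J.+1%:R * eps / r) ^+ i.
  move=> /(_ J (leqnn J)); apply; rewrite subrr nrm0 rd -natr1; lra.
elim=> [|i IH] iJ x.
  rewrite mul0r subr0 expr0 mulr1 => /HF [dF eF]; split; last exact: eF.
  exact: (@differentiableB _ _ _ F id x dF (diff_id x)).
have h : i%:R * d + d = i.+1%:R * d by rewrite -natr1 mulrDl mul1r.
move=> xr; have {}IH := IH (ltnW iJ).
have i0 : 0 <= i%:R * d by rewrite mulr_ge0 // ltW.
have xr' : nrm (x - x0) < r by lra.
have [dF eF] := HF xr'.
have HB w : nrm (w - x) < d -> differentiable (fwd_diff F i.+1) w /\
    nrm (fwd_diff F i.+1 w) <= eps * (16 * J.+1%:R * eps / r) ^+ i.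
  by move=> wx; apply: IH; have := nrm_tri x w x0; lra.
have Fd : nrm (F x - x) < d by lra.
split.
  apply: (@differentiableB _ _ _ (fun x => fwd_diff F i.+1 (F x)) (fwd_diff F i.+1)).
    exact: differentiable_comp dF (HB _ Fd).1.
  by apply: (HB x _).1; rewrite subrr nrm0.
apply: le_trans (schwarz_rV d0 HB Fd) _.
set M := eps * _ ^+ i.
have M0 : 0 <= M by rewrite mulr_ge0 ?exprn_ge0 // ltW.
apply: (@le_trans _ _ (16 * M / d * eps)).
  by apply: ler_wpM2l eF; apply: divr_ge0; [exact: mulr_ge0|exact: ltW].
rewrite /M exprS /d; move: (_ ^+ i) => Q; rewrite le_eqVlt; apply/orP; left; apply/eqP.
by field; rewrite !gt_eqF.
Qed.

Lemma fwd_diff_differentiable j : j%:R * eps < r -> differentiable (fwd_diff F j) x0.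
Proof.
case: j => [|j] jr; last exact: (fwd_diff_bound jr).1.
exact: (diff_id x0).
Qed.

(** The growth in [J ^ J] of the differences is absorbed by the factorial in the
    binomial coefficient. *)
Lemma term_bound (w : C) (B : R) J : J.+1%:R * eps < r -> nrm w + J.+1%:R <= B ->
  nrm (gbin w J.+1 *: fwd_diff F J.+1 x0) <= 4 * (B * eps) * (64 * (B * eps) / r) ^+ J.
Proof.
move=> Jr wB; rewrite nrmZ.
have B0 : 0 <= B by apply: le_trans wB; rewrite addr_ge0 ?nrm_ge0.
have J0 : 0 < J.+1%:R :> R by rewrite ltr0n.
have f0 : 0 < J.+1`!%:R :> R by rewrite ltr0n fact_gt0.
have [_ h1] := fwd_diff_bound Jr; have h2 := gbin_le wB.
apply: (@le_trans _ _ ((B ^+ J.+1 / J.+1`!%:R) * (eps * (16 * J.+1%:R * eps / r) ^+ J))).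
  by apply: ler_pM; rewrite ?nrm_ge0.
have h3 := pow_fact J.+1.
have h4 : J.+1%:R ^+ J / J.+1`!%:R <= 4 ^+ J.+1 :> R.
  rewrite ler_pdivrMr //; apply: le_trans h3.
  by rewrite exprS ler_peMl ?exprn_ge0 // ler1n.
have -> : B ^+ J.+1 / J.+1`!%:R * (eps * (16 * J.+1%:R * eps / r) ^+ J) =
    B * eps * (16 * (B * eps) / r) ^+ J * (J.+1%:R ^+ J / J.+1`!%:R).
  have -> : 16 * J.+1%:R * eps / r = (16 * eps / r) * J.+1%:R by ring.
  have -> : 16 * (B * eps) / r = (16 * eps / r) * B by ring.
  by rewrite !exprMn exprS; ring.
have -> : 4 * (B * eps) * (64 * (B * eps) / r) ^+ J =
    B * eps * (16 * (B * eps) / r) ^+ J * 4 ^+ J.+1.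
  have -> : 64 * (B * eps) / r = (16 * (B * eps) / r) * 4 by ring.
  by rewrite [X in _ * X = _]exprMn exprS; ring.
apply: ler_wpM2l => //.
have Be : 0 <= B * eps by rewrite mulr_ge0 // ltW.
by rewrite mulr_ge0 ?exprn_ge0 // divr_ge0 ?mulr_ge0 // ltW.
Qed.

(** Interpolation of the iterates of [F] at complex times [z], the [m]-th
    iterate being reached at time [m * eps]. *)
Definition newton_sum (N : nat) (z : C) (x : 'rV[C]_n) : 'rV[C]_n :=
  \sum_(j < N.+1) gbin (z / cR eps) j *: fwd_diff F j x.

Lemma newton_sum_iter N m x : (m <= N)%N -> newton_sum N (cR (m%:R * eps)) x = iter m F x.
Proof.
move=> mN; rewrite /newton_sum cRM mulfK ?(cRn R); last by rewrite -nrm_gt0 nrm_cR normr_gt0 gt_eqF.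
by rewrite -[RHS]/(fwd_diff F 0 (iter m F x)) (fwd_diff_iter _ _ mN).
Qed.

(** The terms are dominated by a geometric series of ratio at most [1 / 2].  The
    bound depends on the total time [c] but neither on [eps] nor on [N], which is
    what makes a limit possible. *)
Lemma newton_sum_bound N z (c : R) : 0 < c -> N%:R * eps <= c -> 256 * c <= r ->
  nrm z <= c -> nrm (newton_sum N z x0 - x0) <= 16 * c.
Proof.
move=> c0 Nc cr zc; rewrite /newton_sum big_ord_recl /= scale1r addrAC subrr add0r.
apply: le_trans (nrm_sum _ _ _) _.
pose B := (c + c) / eps.
have Be : B * eps = c + c by rewrite /B divfK // gt_eqF.
pose q := 64 * (B * eps) / r.
have q1 : 0 <= q <= 2^-1.
  rewrite /q Be; apply/andP; split; last by rewrite ler_pdivrMr //; lra.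
  by apply: divr_ge0; [lra|exact: ltW].
apply: (@le_trans _ _ (\sum_(j < N) 4 * (c + c) * q ^+ j)).
  apply: ler_sum => j _; rewrite -Be -[bump 0 j]/(j.+1); apply: term_bound.
    apply: (@le_lt_trans _ _ c); last by lra.
    by apply: le_trans Nc; rewrite ler_pM2r // ler_nat.
  rewrite /B ler_pdivlMr // mulrDl; apply: lerD.
    by rewrite nrmM nrmV nrm_cR gtr0_norm // divfK // gt_eqF.
  by apply: le_trans Nc; rewrite ler_pM2r // ler_nat.
rewrite -mulr_sumr; have := geo_sum N q1; set S := \sum_(j < N) _ => S2; nra.
Qed.

(** The right-hand side bounds the terms of order at least two of Newton's
    formula. *)
Lemma newton_first_order m : 256 * (m%:R * eps) <= r ->
  nrm (iter m F x0 - x0 - m%:R *: (F x0 - x0)) <= 16 * (m%:R * eps) * (128 * (m%:R * eps) / r).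
Proof.
case: m => [|m] mr.
  rewrite -[iter 0 F x0]/x0 subrr sub0r nrmN nrmZ nrm_nat mul0r.
  by rewrite mul0r mulr0 mul0r.
have m0 : 0 < m.+1%:R * eps by rewrite mulr_gt0.
have mr1 : m.+1%:R * eps < r by lra.
have -> : iter m.+1 F x0 - x0 - m.+1%:R *: (F x0 - x0) =
   \sum_(j < m) gbin m.+1%:R j.+2 *: fwd_diff F j.+2 x0.
  rewrite -[iter m.+1 F x0]/(fwd_diff F 0 (iter m.+1 F x0)) (fwd_diff_iter _ _ (leqnn _)).
  transitivity (x0 + (m.+1%:R *: (F x0 - x0) +
      \sum_(j < m) gbin m.+1%:R j.+2 *: fwd_diff F j.+2 x0) - x0 - m.+1%:R *: (F x0 - x0)).
    congr (_ - _ - _); rewrite 2!big_ord_recl; congr (_ + (_ + _)).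
      exact: scale1r.
    by rewrite [gbin _ _](gbin_nat m.+1 1) bin1.
  by rewrite (addrC x0) addrK addrAC subrr add0r.
apply: le_trans (nrm_sum _ _ _) _.
set t := m.+1%:R * eps.
pose q := 64 * ((m.+1%:R + m.+1%:R) * eps) / r.
have Be : (m.+1%:R + m.+1%:R) * eps = t + t by rewrite mulrDl.
have q1 : 0 <= q <= 2^-1.
  rewrite /q Be; apply/andP; split; last by rewrite ler_pdivrMr //; lra.
  by apply: divr_ge0; [lra|exact: ltW].
apply: (@le_trans _ _ (\sum_(j < m) 4 * (t + t) * q * q ^+ j)); last first.
  rewrite -mulr_sumr; have := geo_sum m q1; set S := \sum_(j < m) _ => S2.
  have -> : 16 * t * (128 * t / r) = 4 * (t + t) * q * 2 by rewrite /q Be; field; rewrite gt_eqF.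
  apply: ler_wpM2l S2; apply: mulr_ge0; last by case/andP: q1.
  by have := ltW m0; rewrite -/t => ?; lra.
apply: ler_sum => j _.
rewrite -[_ * q * _]mulrA -exprS -Be; apply: term_bound.
  apply: (@le_lt_trans _ _ (m.+1%:R * eps)) => //.
  by rewrite ler_pM2r // ler_nat ltnS ltn_ord.
by rewrite nrm_nat lerD2l ler_nat ltnS ltn_ord.
Qed.

End Local.
End Newton.

Section NewtonDiff.
Variable R : realType.
Local Notation C := (Cplx R).

Lemma differentiable_gbin (u : C -> C) z j :
  differentiable u z -> differentiable (fun s => gbin (u s) j) z.
Proof.
move=> du; elim: j => [|j IH]; first exact: (differentiable_cst (1 : C)).
have E : (fun s => gbin (u s) j.+1) =
   (fun s => gbin (u s) j) * ((fun s => u s) - cst (j%:R)) * cst (j.+1%:R^-1) by [].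
rewrite E; apply: differentiableM; last exact: differentiable_cst.
apply: differentiableM; first exact: IH.
apply: differentiableB; [exact: du|exact: differentiable_cst].
Qed.

Lemma differentiable_newton_sum n (F : 'rV[C]_n -> 'rV[C]_n) (eps : R) N (u : C -> C)
   (x : C -> 'rV[C]_n) z : differentiable u z -> differentiable x z ->
  (forall j, (j <= N)%N -> differentiable (fwd_diff F j) (x z)) ->
  differentiable (fun s => newton_sum F eps N (u s) (x s)) z.
Proof.
move=> du dx dF; rewrite /newton_sum.
have -> : (fun s => \sum_(j < N.+1) gbin (u s / cR eps) j *: fwd_diff F j (x s)) =
   \sum_(j < N.+1) (fun s => gbin (u s / cR eps) j *: fwd_diff F j (x s)).
  by apply/funext => y; rewrite fct_sumE.
apply: differentiable_sum => j; apply: differentiable_rV => i.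
have -> : (fun y : C => (gbin (u y / cR eps) j *: fwd_diff F j (x y)) ord0 i) =
   (fun y : C => gbin (u y / cR eps) j) * (fun y : C => fwd_diff F j (x y) ord0 i).
  by apply/funext => y; rewrite mxE.
apply: differentiableM.
  apply: (@differentiable_gbin (fun s => u s / cR eps)).
  have -> : (fun s => u s / cR eps) = u * cst (cR eps)^-1 by [].
  apply: differentiableM du _; exact: differentiable_cst.
apply: (@differentiable_comp_coord R C n (fun y : C => fwd_diff F j (x y))).
apply: differentiable_comp dx _; apply: dF; rewrite -ltnS; exact: ltn_ord.
Qed.

End NewtonDiff.

(** * Holomorphic curves, functions and maps on manifolds *)

Section Manifold.
Variable R : realType.
Local Notation C := (Cplx R).

Section One.
Variables (n : nat) (X : complexManifold R n).
Implicit Types c : chart R X n.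

Lemma atlas_holomorphic c : atlas c -> holomorphic_chart c.
Proof. by move=> ac c' ac'; split; apply: atlas_compatible. Qed.

Lemma near_dom c x : chart_dom c x -> \forall q \near x, chart_dom c q.
Proof. by move=> cx; apply: open_nbhs_nbhs; split => //; apply: chart_dom_open. Qed.

Lemma near_img c x : chart_dom c x ->
  \forall w \near c x, chart_dom c (chart_inv c w) /\ c (chart_inv c w) = w.
Proof.
move=> cx; have : nbhs (c x) (c @` chart_dom c).
  by apply: open_nbhs_nbhs; split; [exact: chart_img_open|exists x].
by apply: filterS => w [q cq <-]; rewrite chart_mapK.
Qed.

Lemma near_inv c x (P : set X) : chart_dom c x -> (\forall q \near x, P q) ->
  \forall w \near c x, P (chart_inv c w).
Proof.
move=> cx Px; have := chart_inv_cont cx; apply.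
by rewrite chart_mapK.
Qed.

Lemma near_chart c x (P : set 'rV[C]_n) : chart_dom c x -> (\forall w \near c x, P w) ->
  \forall q \near x, P (c q).
Proof. by move=> cx Px; apply: (chart_map_cont cx). Qed.

Lemma trans_holomorphic c c' x : holomorphic_chart c -> holomorphic_chart c' ->
  chart_dom c x -> chart_dom c' x -> differentiable (c' \o chart_inv c) (c x).
Proof.
move=> hc hc' cx c'x; have [c2 a2 c2x] := atlas_cover x.
have d1 := (hc c2 a2).1 x cx c2x.
have d2 := (hc' c2 a2).2 x c2x c'x.
apply: (@differentiable_near _ _ _ (fun w => (c' \o chart_inv c2) ((c2 \o chart_inv c) w))).
  apply: filterS (near_inv cx (near_dom c2x)) => w /= c2w.
  by rewrite chart_mapK.
apply: differentiable_comp d1 _.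
by rewrite /= chart_mapK.
Qed.

(** [holomorphic_disk] at a single point. *)
Definition holomorphic_at (h : C -> X) (z : C) := {for z, continuous h} /\
  forall c, atlas c -> chart_dom c (h z) -> differentiable (c \o h) z.

Lemma holomorphic_at_chart (h : C -> X) z c : holomorphic_at h z -> holomorphic_chart c ->
  chart_dom c (h z) -> differentiable (c \o h) z.
Proof.
move=> [hz dh] hc chz; have [c2 a2 c2x] := atlas_cover (h z).
apply: (@differentiable_near _ _ _ (fun w => (c \o chart_inv c2) ((c2 \o h) w))).
  have : \forall w \near z, chart_dom c2 (h w) by apply: hz (near_dom c2x).
  by apply: filterS => w /= c2w; rewrite chart_mapK.
apply: differentiable_comp (dh _ a2 c2x) _.
exact: (hc c2 a2).2.
Qed.

Lemma holomorphic_at_inv (x : C -> 'rV[C]_n) z c p : holomorphic_chart c -> chart_dom c p ->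
  x z = c p -> differentiable x z -> holomorphic_at (chart_inv c \o x) z.
Proof.
move=> hc cp xz dx; have cz := differentiable_continuous dx.
have E : chart_inv c (x z) = p by rewrite xz chart_mapK.
split.
  apply: continuous_comp => //; rewrite xz; exact: chart_inv_cont.
move=> c' ac' c'x; rewrite /= E in c'x.
have d : differentiable (c' \o chart_inv c) (x z).
  by rewrite xz; apply: (hc c' ac').1.
exact: (differentiable_comp dx d).
Qed.

Lemma holomorphic_at_near (h h' : C -> X) z : (\forall w \near z, h w = h' w) -> holomorphic_at h z -> holomorphic_at h' z.
Proof.
move=> E [ch dh]; have Ez := nbhs_singleton E.
split.
  move=> A; rewrite -Ez => /ch hA.
  have {}hA : \forall w \near z, A (h w) := hA.
  have : \forall w \near z, A (h' w) by apply: filterS2 E hA => w ->.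
  by [].
move=> c ac; rewrite -Ez => /(dh c ac); apply: differentiable_near.
by apply: filterS E => w /= ->.
Qed.

Lemma holomorphic_at_cst p z : holomorphic_at (fun=> p) z.
Proof.
split; first exact: cst_continuous.
by move=> c _ _; exact: (differentiable_cst (c p)).
Qed.

Lemma holomorphic_near_curve (g : X -> C) (h : C -> X) z :
  holomorphic_near g (h z) -> (\forall w \near z, holomorphic_at h w) ->
  \forall w \near z, differentiable (g \o h) w.
Proof.
move=> hg hh; have ch := (nbhs_singleton hh).1.
have [c ac cz] := atlas_cover (h z).
have A : \forall w \near z, chart_dom c (h w) by apply: ch (near_dom cz).
have B : \forall w \near z, forall c, atlas c -> chart_dom c (h w) ->
    differentiable (g \o chart_inv c) (c (h w)) by apply: ch hg.
have A2 : \forall w \near z, \forall v \near w, chart_dom c (h v).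
  move: A => /nbhs_nrm [d d0 Hd]; apply/nbhs_nrm; exists d => // w wz; apply/nbhs_nrm.
  exists (d - nrm (w - z)); first by rewrite subr_gt0.
  by move=> v vw; apply: Hd; have := nrm_tri w v z; lra.
apply: filterS3 A2 B hh => w A2w Bw [_ dh].
have cw := nbhs_singleton A2w.
apply: (@differentiable_near _ _ _ (fun w => (g \o chart_inv c) ((c \o h) w))).
  by apply: filterS A2w => v cv /=; rewrite chart_mapK.
exact: (differentiable_comp (dh c ac cw) (Bw c ac cw)).
Qed.

Lemma holomorphic_near_chart (g : X -> C) p c : holomorphic_near g p ->
  holomorphic_chart c -> chart_dom c p -> differentiable (g \o chart_inv c) (c p).
Proof.
move=> hg hc cp; have [c2 a2 c2p] := atlas_cover p.
have d := nbhs_singleton hg c2 a2 c2p.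
apply: (@differentiable_near _ _ _ (fun w => (g \o chart_inv c2) ((c2 \o chart_inv c) w))).
  by apply: filterS (near_inv cp (near_dom c2p)) => w /= c2w; rewrite chart_mapK.
apply: differentiable_comp ((hc c2 a2).1 p cp c2p) _.
by rewrite /= chart_mapK.
Qed.

Lemma near_near (T : topologicalType) (x : T) (P : set T) :
  (\forall y \near x, P y) -> \forall y \near x, \forall z \near y, P z.
Proof. by move=> /nbhs_interior. Qed.

Lemma holomorphic_near_coord c p i : holomorphic_chart c -> chart_dom c p ->
  holomorphic_near (fun q => c q ord0 i) p.
Proof.
move=> hc cp; apply: filterS (near_dom cp) => q cq c' ac' c'q.
exact: (@differentiable_comp_coord R _ n (c \o chart_inv c') _ i ((hc c' ac').2 q c'q cq)).
Qed.

Lemma holomorphic_near_near (g : X -> C) p : holomorphic_near g p ->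
  \forall q \near p, holomorphic_near g q.
Proof. exact: near_near. Qed.

Lemma holomorphic_near_cst (a : C) (p : X) : holomorphic_near (fun=> a : C) p.
Proof. by apply: filterE => q c _ _; exact: (differentiable_cst a). Qed.

End One.

Section Maps.
Variables (n m : nat) (X : complexManifold R n) (Y : complexManifold R m) (f : X -> Y).
Hypothesis hf : holomorphic_map f.

Lemma holomorphic_map_cont : continuous f.
Proof. by move=> x; have [] := hf x. Qed.

Lemma holomorphic_map_curve (h : C -> X) z : holomorphic_at h z -> holomorphic_at (f \o h) z.
Proof.
move=> [ch dh]; split; first by apply: continuous_comp ch _; have [] := hf (h z).
move=> c ac cf; have [c2 a2 c2z] := atlas_cover (h z).
apply: (@differentiable_near _ _ _ (fun w => (c \o f \o chart_inv c2) ((c2 \o h) w))).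
  have : \forall w \near z, chart_dom c2 (h w) by apply: ch (near_dom c2z).
  by apply: filterS => w /= c2w; rewrite chart_mapK.
exact: (differentiable_comp (dh c2 a2 c2z) ((hf (h z)).2 c2 c a2 ac c2z cf)).
Qed.

Lemma holomorphic_map_charts (c : chart R X n) (c' : chart R Y m) x :
  holomorphic_chart c -> holomorphic_chart c' -> chart_dom c x -> chart_dom c' (f x) ->
  differentiable (c' \o f \o chart_inv c) (c x).
Proof.
move=> hc hc' cx c'x.
have [c1 a1 c1x] := atlas_cover x; have [c2 a2 c2x] := atlas_cover (f x).
have d := (hf x).2 c1 c2 a1 a2 c1x c2x.
have d1 := (hc c1 a1).1 x cx c1x.
have d2 := (hc' c2 a2).2 (f x) c2x c'x.
apply: (@differentiable_near _ _ _ (fun w => (c' \o chart_inv c2)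
   ((c2 \o f \o chart_inv c1) ((c1 \o chart_inv c) w)))).
  have A := near_inv cx (near_dom c1x).
  have B : \forall w \near c x, chart_dom c2 (f (chart_inv c w)).
    apply: (near_inv (P := fun q => chart_dom c2 (f q)) cx).
    exact: (@holomorphic_map_cont x _ (near_dom c2x)).
  by apply: filterS2 A B => w /= A B; rewrite (chart_mapK A) (chart_mapK B).
apply: differentiable_comp.
  apply: differentiable_comp d1 _.
  by rewrite /= chart_mapK.
by rewrite /= (chart_mapK cx) (chart_mapK c1x).
Qed.

Lemma holomorphic_near_map (g : Y -> C) p : holomorphic_near g (f p) ->
  holomorphic_near (g \o f) p.
Proof.
move=> hg.
have A : \forall q \near p, holomorphic_near g (f q).
  exact: (@holomorphic_map_cont p _ (holomorphic_near_near hg)).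
apply: filterS A => q hq c ac cq.
have [c2 a2 c2q] := atlas_cover (f q).
have d := nbhs_singleton hq c2 a2 c2q.
apply: (@differentiable_near _ _ _ (fun w => (g \o chart_inv c2)
   ((c2 \o f \o chart_inv c) w))).
  have B : \forall w \near c q, chart_dom c2 (f (chart_inv c w)).
    apply: (near_inv (P := fun q => chart_dom c2 (f q)) cq).
    exact: (@holomorphic_map_cont q _ (near_dom c2q)).
  by apply: filterS B => w /= B; rewrite chart_mapK.
apply: differentiable_comp ((hf q).2 c c2 ac a2 cq c2q) _.
by rewrite /= chart_mapK.
Qed.

End Maps.

Lemma holomorphic_map_comp n m k (X : complexManifold R n) (Y : complexManifold R m)
   (Z : complexManifold R k) (f : X -> Y) (g : Y -> Z) :
  holomorphic_map f -> holomorphic_map g -> holomorphic_map (g \o f).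
Proof.
move=> hf hg x; split.
  by apply: continuous_comp; [have [] := hf x|have [] := hg (f x)].
move=> c c' ac ac' cx c'x; have [c2 a2 c2x] := atlas_cover (f x).
apply: (@differentiable_near _ _ _ (fun w => (c' \o g \o chart_inv c2)
   ((c2 \o f \o chart_inv c) w))).
  have B : \forall w \near c x, chart_dom c2 (f (chart_inv c w)).
    apply: (near_inv (P := fun q => chart_dom c2 (f q)) cx).
    exact: (holomorphic_map_cont hf (near_dom c2x)).
  by apply: filterS B => w /= B; rewrite chart_mapK.
apply: differentiable_comp ((hf x).2 c c2 ac a2 cx c2x) _.
rewrite /= (chart_mapK cx); exact: (hg (f x)).2.
Qed.

End Manifold.

(** * Symmetries of an orbifold *)

Section Transport.
Variable R : realType.
Local Notation C := (Cplx R).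
Variables (n : nat) (Y : complexManifold R n) (f g : Y -> Y).
Hypotheses (hf : holomorphic_map f) (hg : holomorphic_map g).
Hypotheses (fK : cancel f g) (gK : cancel g f).

Lemma analytic_preimage (A : set Y) : analytic_subset A -> analytic_subset (f @^-1` A).
Proof.
move=> [cA H]; split.
  by apply: closed_comp => // x _; apply: holomorphic_map_cont.
move=> p /H [k [F [hF near_F]]]; exists k, (fun i => F i \o f); split.
  by move=> i; apply: holomorphic_near_map.
exact: (holomorphic_map_cont hf near_F).
Qed.

Lemma image_preimage (A : set Y) : g @^-1` (f @^-1` A) = A.
Proof. by apply/seteqP; split => x /=; rewrite gK. Qed.

Lemma local_equation_transport (D : set Y) p (e : Y -> C) :
  local_equation (f @^-1` D) p e -> local_equation D (f p) (e \o g).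
Proof.
move=> [he van gen].
have nearg (P : set Y) : (\forall q \near p, P q) -> \forall q \near f p, P (g q).
  by move=> Pp; apply: (holomorphic_map_cont hg); rewrite fK.
split.
- by apply: holomorphic_near_map => //; rewrite fK.
- by apply: filterS (nearg _ van) => q /= H Dq; apply: H; rewrite gK.
- move=> h hh hv.
  have hh' := holomorphic_near_map hf hh.
  have [|u hu Hu] := gen _ hh'.
    exact: (holomorphic_map_cont hf hv).
  exists (u \o g); first by apply: holomorphic_near_map => //; rewrite fK.
  by apply: filterS (nearg _ Hu) => q /=; rewrite gK.
Qed.

End Transport.

Section Transport2.
Variable R : realType.
Local Notation C := (Cplx R).
Variables (n : nat) (Y : complexManifold R n) (f g : Y -> Y).
Hypotheses (hf : holomorphic_map f) (hg : holomorphic_map g).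
Hypotheses (fK : cancel f g) (gK : cancel g f).

Lemma irreducible_preimage (D : set Y) : irreducible_divisor D -> irreducible_divisor (f @^-1` D).
Proof.
move=> [[cD iD eD] [aD neD irr]]; split; split.
- by apply: closed_comp => // x _; apply: holomorphic_map_cont.
- apply/seteqP; split => // p ip.
  have : D° (f p).
    have : \forall q \near f p, (f @^-1` D) (g q).
      by apply: (holomorphic_map_cont hg); rewrite fK.
    by apply: filterS => q /=; rewrite gK.
  by rewrite iD.
- move=> p /eD [e [he He]]; exists (e \o f); split; first exact: holomorphic_near_map.
  exact: (holomorphic_map_cont hf He).
- exact: analytic_preimage.
- by have [x Dx] := neD; exists (g x); rewrite /= gK.
- move=> B1 B2 a1 a2 E.
  have E' : D = (g @^-1` B1) `|` (g @^-1` B2).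
    by rewrite -[D](image_preimage gK) E.
  have back (B : set Y) : f @^-1` (g @^-1` B) = B by apply: image_preimage.
  have [H|H] := irr _ _ (analytic_preimage hg a1) (analytic_preimage hg a2) E'.
    by left; rewrite H back.
  by right; rewrite H back.
Qed.

End Transport2.

Section Orb.
Variable R : realType.
Local Notation C := (Cplx R).
Variables (n : nat) (Y : complexManifold R n) (Delta : orbifold Y).
Local Notation D_ := (orb_comp (o := Delta)).
Local Notation m_ := (orb_mult (o := Delta)).
Local Notation S := (orb_support Delta).
Variable d : Y -> Y -> R.
Hypothesis Hk : kobayashi_pseudo_distance Delta d.
Hypothesis Hd : distance_on (~` orb_floor Delta) d.
Hypothesis floor0 : orb_floor Delta = set0.

Lemma nofloor x : ~ orb_floor Delta x. Proof. by rewrite floor0. Qed.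
Local Hint Resolve nofloor : core.

Lemma d_ge0 x y : 0 <= d x y.
Proof. by case: Hk => -[H _ _ _] _ _; apply: H; apply: nofloor. Qed.
Lemma dxx x : d x x = 0.
Proof. by case: Hk => -[_ H _ _] _ _; apply: H; apply: nofloor. Qed.
Lemma dC x y : d x y = d y x.
Proof. by case: Hk => -[_ _ H _] _ _; apply: H; apply: nofloor. Qed.
Lemma d_tri y x z : d x z <= d x y + d y z.
Proof. by case: Hk => -[_ _ _ H] _ _; apply: H; apply: nofloor. Qed.
Lemma d_eq0 x y : d x y = 0 -> x = y.
Proof. by case: Hd => _ H; apply: H; apply: nofloor. Qed.
Lemma d_disk h z w : orbifold_disk Delta h -> unit_disk z -> unit_disk w ->
  d (h z) (h w) <= poincare_dist z w.
Proof. by case: Hk => _ H _ oh zd wd; apply: H. Qed.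
Lemma d_max d' : (forall x y, 0 <= d' x y) -> (forall x, d' x x = 0) ->
  (forall x y, d' x y = d' y x) -> (forall y x z, d' x z <= d' x y + d' y z) ->
  disk_decreasing Delta d' -> forall x y, d' x y <= d x y.
Proof.
case: Hk => _ _ H h1 h2 h3 h4 h5 x y; apply: H; [|exact: h5|exact: nofloor|exact: nofloor].
by split => *; [exact: h1|exact: h2|exact: h3|exact: h4].
Qed.

Lemma multP i : exists2 k, m_ i = Some k & (1 <= k)%N.
Proof.
have := orb_mult_ge1 (o := Delta) i; case E : (m_ i) => [k|] H; first by exists k.
have [_ [_ [x Dx] _]] := orb_comp_irreducible (o := Delta) i.
by case: (@nofloor x); exists i.
Qed.

(** If no orbifold disk meets [x], then adding [1] to the distances between [x]
    and the other points keeps [d] disk-decreasing. *)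
Lemma disk_through (p q : Y) : p <> q -> forall x, exists h, orbifold_disk Delta h /\
  exists2 z, unit_disk z & h z = x.
Proof.
move=> pq x; apply: contrapT => nh.
have [y yx] : exists y, y <> x.
  have [px|] := pselect (p = x); last by exists p.
  by exists q => qx; apply: pq; rewrite qx px.
(* [1] between [x] and another point, [0] elsewhere *)
pose b (u v : Y) : R := (`[< u = x >] (+) `[< v = x >])%:R.
have : d x y + b x y <= d x y.
  apply: (@d_max (fun u v => d u v + b u v)).
  - by move=> u v; rewrite addr_ge0 ?d_ge0.
  - by move=> u; rewrite dxx /b addbb addr0.
  - by move=> u v; rewrite dC /b addbC.
  - move=> v u w; rewrite addrACA; apply: lerD; first exact: d_tri.
    rewrite /b -natrD ler_nat; by case: `[< u = x >]; case: `[< v = x >]; case: `[< w = x >].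
  - move=> h oh z w zd wd.
    have F z' : unit_disk z' -> `[< h z' = x >] = false.
      by move=> z'd; apply/asboolPn => hz; apply: nh; exists h; split => //; exists z'.
    by rewrite /b !F // addr0; apply: d_disk.
rewrite /b asboolT // asboolF // gerDl /=.
by rewrite ler10.
Qed.

Hypothesis nontrivial : exists p q : Y, p <> q.

(** A disk through [x] is an orbifold disk only if it comes with such an
    equation. *)
Lemma local_equation_ex i x : D_ i x -> exists g, local_equation (D_ i) x g.
Proof.
move=> Dx; have [p [q pq]] := nontrivial.
have [h [[_ _ H] [z zd hz]]] := disk_through pq x.
have := H i z zd; rewrite hz => /(_ Dx).
by case: (m_ i) => [k [g [lg _]]|//]; exists g; rewrite -hz.
Qed.

(** An automorphism may move components of multiplicity one to arbitrary
    hypersurfaces. *)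
Definition keeps_components (f : Y -> Y) := forall i, m_ i <> Some 1%N ->
  exists2 j, f @^-1` (D_ i) = D_ j & mult_le (m_ i) (m_ j).

Definition orb_symmetry (f g : Y -> Y) :=
  [/\ holomorphic_map f, holomorphic_map g, cancel f g, cancel g f & keeps_components f /\ keeps_components g].

Lemma mult_neq1 i j : m_ i <> Some 1%N ->
  mult_le (m_ i) (m_ j) -> m_ j <> Some 1%N.
Proof.
have [k -> k1] := multP i; have [l -> l1] := multP j => /= kn kl ln.
by case: ln kl => -> kl; apply: kn; congr Some; apply/eqP; rewrite eqn_leq kl.
Qed.

Lemma disk_holomorphic_at h z : holomorphic_disk h -> unit_disk z ->
  \forall w \near z, holomorphic_at (h : C -> Y) w.
Proof.
move=> hh zd; have zd' : 0 < 1 - nrm z.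
  by rewrite subr_gt0 -lt_cR -nrmE.
apply/nbhs_nrm; exists (1 - nrm z) => // w wz; apply: hh.
by rewrite /unit_disk /= nrmE lt_cR; have := nrm_leD w z; lra.
Qed.

(** Once there is a local equation, multiplicity one only means vanishing. *)
Lemma disk_mult1 i h z : D_ i (h z) -> (\forall w \near z, holomorphic_at (h : C -> Y) w) ->
  disk_multiplicity_ge h (D_ i) z 1.
Proof.
move=> Dz hh; have [g lg] := local_equation_ex Dz; exists g; split=> //.
have [hg vg _] := lg.
have dg := holomorphic_near_curve hg hh.
have g0 : (g \o h) z = 0 by apply: nbhs_singleton vg Dz.
have [psi dpsi E] := removable dg g0.
by exists psi; split => //; apply: filterE => w; rewrite expr1 -E.
Qed.

(** A component met by [f \o h] pulls back to a component met by [h], with at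
    least the same multiplicity, and local equations are transported by [g]. *)
Lemma symmetry_disk f g h : orb_symmetry f g -> orbifold_disk Delta h ->
  orbifold_disk Delta (f \o h).
Proof.
move=> [hf hg fK gK [cf cg]] [hh nS H]; split.
- by move=> z zd; apply: holomorphic_map_curve => //; apply: hh.
- move=> sub; apply: nS => _ [z zd <-].
  have [i [mi Di]] : S (f (h z)) by apply: sub; exists z.
  have [j Ej mj] := cf i mi; exists j; split; first exact: mult_neq1 mj.
  by rewrite -Ej.
- move=> i z zd Dz; have [k Ek k1] := multP i; rewrite Ek.
  have hz := disk_holomorphic_at hh zd.
  have [k11|kn1] := eqVneq k 1%N.
    rewrite k11; apply: disk_mult1 => //.
    by apply: filterS hz => w; apply: holomorphic_map_curve.
  have [|j Ej mj] := cf i; first by rewrite Ek => -[] /eqP; apply/negP.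
  have Dj : D_ j (h z) by rewrite -Ej.
  have := H j z zd Dj; have [l El l1] := multP j; rewrite El.
  move=> [e [le [psi [dpsi Hpsi]]]].
  exists (e \o g); split; first by apply: local_equation_transport => //; rewrite Ej.
  rewrite Ek El /= in mj.
  exists (fun w => (w - z) ^+ (l - k) * psi w); split.
    apply: filterS dpsi => w dw.
    apply: (@differentiableM _ _ (fun w => (w - z) ^+ (l - k)) psi) dw.
    exact: differentiable_powB.
  by apply: filterS Hpsi => w; rewrite /= fK => ->; rewrite mulrA -exprD subnKC.
Qed.

(** The distance [d (f x) (f y)] is disk-decreasing, hence at most [d]. *)
Lemma symmetry_le f g x y : orb_symmetry f g -> d (f x) (f y) <= d x y.
Proof.
move=> sf; apply: (@d_max (fun x y => d (f x) (f y))) => *; rewrite ?d_ge0 ?dxx //.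
- exact: dC.
- exact: d_tri.
- by move=> h oh z w zd wd; apply: (d_disk (symmetry_disk sf oh)).
Qed.

Lemma symmetry_inv f g : orb_symmetry f g -> orb_symmetry g f.
Proof. by move=> [? ? ? ? [? ?]]; split. Qed.

Lemma symmetry_iso f g x y : orb_symmetry f g -> d (f x) (f y) = d x y.
Proof.
move=> sf; apply/eqP; rewrite eq_le (symmetry_le _ _ sf) /=.
have := symmetry_le (f x) (f y) (symmetry_inv sf).
by case: sf => _ _ fK _ _; rewrite !fK.
Qed.

Lemma keeps_components_comp f g : keeps_components f -> keeps_components g -> keeps_components (f \o g).
Proof.
move=> cf cg i mi; have [j Ej mj] := cf i mi.
have [k Ek mk] := cg j (mult_neq1 mi mj); exists k; first by rewrite comp_preimage Ej.
have [a Ea _] := multP i; have [b Eb _] := multP j; have [c Ec _] := multP k.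
by move: mj mk; rewrite Ea Eb Ec; apply: leq_trans.
Qed.

Lemma symmetry_comp f g f' g' : orb_symmetry f g -> orb_symmetry f' g' ->
  orb_symmetry (f \o f') (g' \o g).
Proof.
move=> [hf hg fK gK [cf cg]] [hf' hg' fK' gK' [cf' cg']]; split.
- exact: holomorphic_map_comp.
- exact: holomorphic_map_comp.
- exact: can_comp.
- exact: can_comp.
- by split; apply: keeps_components_comp.
Qed.

Lemma symmetry_support f g x : orb_symmetry f g -> S (f x) <-> S x.
Proof.
have half f' g' y : orb_symmetry f' g' -> S (f' y) -> S y.
  move=> [_ _ _ _ [cf _]] [i [mi Di]]; have [j Ej mj] := cf i mi.
  by exists j; split; [exact: mult_neq1 mj|rewrite -Ej].
move=> sf; split; first exact: half sf.
have sg := symmetry_inv sf; case: sf => _ _ fK _ _ Sx.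
by apply: (half _ _ _ sg); rewrite fK.
Qed.

(** The morphism condition for [f^* D = E] with [t = 1] says that the preimage
    of a component of multiplicity at least two is a component of at least the same
    multiplicity.  The total multiplicity of a finite set is preserved by a
    permutation, so all these inequalities are equalities and the inverse of [f]
    satisfies the same condition. *)
Lemma aut_symmetry f : orbifold_aut Delta f -> exists g, orb_symmetry f g.
Proof.
move=> [[hf [g [hg fK gK]]] [_ _ morph]]; exists g.
have cf : keeps_components f.
  move=> i mi.
  have irrD := orb_comp_irreducible (o := Delta) i.
  have irrE := irreducible_preimage hf hg fK gK irrD.
  have Di : orb_multiplicity Delta (D_ i) = m_ i.
    rewrite /orb_multiplicity; case: pickP => [j /asboolP /orb_comp_distinct -> //|/(_ i)].
    by rewrite asboolT.
  have pm : pullback_multiplicity f (D_ i) (f @^-1` (D_ i)) 1%N.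
    move=> p Dp; have [e le] := local_equation_ex Dp.
    exists e, (e \o f), (fun=> 1); split => //.
    - have E : f @^-1` (D_ i) = f @^-1` (D_ i) by [].
      have := @local_equation_transport R n Y g f hg hf gK fK (f @^-1` (D_ i)) (f p) e.
      by rewrite (image_preimage gK) fK; apply.
    - exact: holomorphic_near_cst.
    - by apply: filterE => q; rewrite expr1 mulr1.
    - move=> H; have := nbhs_singleton H Dp => /eqP; by rewrite oner_eq0.
  have := morph (D_ i) (f @^-1` (D_ i)) 1%N irrD irrE isT pm.
  rewrite Di /orb_multiplicity; case: pickP => [j /asboolP Ej|_] /=.
    move=> le; exists j => //; move: le; rewrite /mult_scale.
    by have [k -> _] := multP j; rewrite /= mul1n.
  have [k Ek k1] := multP i; rewrite Ek /= => kl.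
  by case: mi; rewrite Ek; congr Some; apply/eqP; rewrite eqn_leq kl.
split=> //; split=> //.
have /choice [s Hs] i : exists j, (m_ i = Some 1%N -> j = i) /\
   (m_ i <> Some 1%N -> f @^-1` (D_ i) = D_ j /\ mult_le (m_ i) (m_ j)).
  have [m1|m1] := pselect (m_ i = Some 1%N); first by exists i.
  by have [j Ej mj] := cf i m1; exists j.
have inj : injective s.
  move=> i j E.
  have [mi|mi] := pselect (m_ i = Some 1%N).
    have [mj|mj] := pselect (m_ j = Some 1%N).
      by rewrite -((Hs i).1 mi) E ((Hs j).1 mj).
    have := mult_neq1 mj ((Hs j).2 mj).2; by rewrite -E ((Hs i).1 mi).
  have [mj|mj] := pselect (m_ j = Some 1%N).
    have := mult_neq1 mi ((Hs i).2 mi).2; by rewrite E ((Hs j).1 mj).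
  apply: (@orb_comp_distinct _ _ _ Delta).
  by rewrite -(image_preimage gK (D_ i)) ((Hs i).2 mi).1 E -((Hs j).2 mj).1 image_preimage.
pose m (i : 'I_(orb_size Delta)) := odflt 0%N (m_ i).
have le i : (m i <= m (s i) ?= iff (m i == m (s i)))%N.
  apply/leqif_eq.
  have [mi|mi] := pselect (m_ i = Some 1%N); first by rewrite ((Hs i).1 mi).
  have := ((Hs i).2 mi).2; rewrite /m.
  by have [a -> _] := multP i; have [b -> _] := multP (s i).
have := leqif_sum (fun i (_ : true) => le i).
have E : \sum_i m (s i) = \sum_i m i by rewrite [RHS](reindex_inj inj).
rewrite E => -[_]; rewrite eqxx => /esym /forallP eqm.
have [s' sK s'K] := injF_bij inj.
move=> i mi; exists (s' i).
  have mj : m_ (s' i) <> Some 1%N.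
    by move=> m1; have := (Hs (s' i)).1 m1; rewrite s'K => E'; rewrite E' in mi.
  by have := ((Hs (s' i)).2 mj).1; rewrite s'K => <-; rewrite image_preimage.
have /eqP := eqm (s' i); rewrite /= s'K /m.
by have [a -> _] := multP i; have [b -> _] := multP (s' i) => /= ->.
Qed.

End Orb.

(** * Continuity of the Kobayashi distance *)

Section Poincare.
Variable R : realType.
Local Notation C := (Cplx R).

Lemma poincare0 (b : R) : 0 <= b <= 2^-1 -> poincare_dist (0 : C) (cR b) <= 4 * b.
Proof.
move=> /andP[b0 b2]; rewrite /poincare_dist mulr0 subr0 sub0r normrN normr1 divr1.
rewrite -/(nrm (cR b)) nrm_cR ger0_norm //.
have b1 : 0 < 1 - b by lra.
have -> : (1 + b) / (1 - b) = 1 + 2 * b / (1 - b) by field; rewrite gt_eqF.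
have q : 2 * b / (1 - b) <= 4 * b by rewrite ler_pdivrMr //; nra.
have q0 : 0 <= 2 * b / (1 - b) by rewrite divr_ge0 ?mulr_ge0 // ltW.
by apply: le_trans q; apply: le_ln1Dx; lra.
Qed.

End Poincare.

Section Domain.
Variable R : realType.
Local Notation C := (Cplx R).
Variables (n : nat) (k : 'I_n).
Implicit Types w : 'rV[C]_n.

(** Holomorphic functions on a piece of hyperplane form an integral domain.  A
    function of the list that does not vanish identically is nonzero on a smaller
    ball, where it can be left out. *)
Lemma hyperplane_domain (s : seq 'I_n) (F : 'I_n -> 'rV[C]_n -> C) (r : R) : 0 < r ->
  (forall j w, nrm w < 4 * r -> differentiable (F j) w) ->
  (forall w, nrm w < r -> w ord0 k = 0 -> exists2 j, j \in s & F j w = 0) ->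
  exists2 j, j \in s & forall w, nrm w < r -> w ord0 k = 0 -> F j w = 0.
Proof.
move=> r0 dF.
suff H : forall (s : seq 'I_n) w1 (r1 : R), 0 < r1 -> w1 ord0 k = 0 ->
   (forall w, nrm (w - w1) < r1 -> nrm w < r) ->
   (forall w, nrm (w - w1) < r1 -> w ord0 k = 0 -> exists2 j, j \in s & F j w = 0) ->
   exists2 j, j \in s & forall w, nrm w < r -> w ord0 k = 0 -> F j w = 0.
  move=> H0; apply: (H s 0 r r0); first by rewrite mxE.
    by move=> w; rewrite subr0.
  by move=> w; rewrite subr0; apply: H0.
elim=> [|j s' IH] w1 r1 r10 w1k sub Hz.
  by have [||//] := Hz w1; rewrite ?subrr ?nrm0.
have w1r : nrm w1 < r by apply: sub; rewrite subrr nrm0.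
have [E|nE] := pselect (forall w, nrm (w - w1) < r1 -> w ord0 k = 0 -> F j w = 0).
  exists j; first exact: mem_head.
  move=> w wr wk.
  have [->|ww1] := eqVneq w w1; first by apply: E; rewrite ?subrr ?nrm0.
  have ww0 : 0 < nrm (w - w1) by rewrite nrm_gt0 subr_eq0.
  have ww2 : nrm (w - w1) < 2 * r by have := nrmB w w1; lra.
  pose phi (l : C) := F j (w1 + l *: (w - w1)).
  have dphi l : nrm (l - 0) < 3 / 2 -> differentiable phi l.
    rewrite subr0 => l2.
    apply: (differentiable_comp (differentiable_line _ _ _)); apply: dF.
    apply: le_lt_trans (nrmD _ _) _; rewrite nrmZ.
    have := nrm_ge0 l; have := ltW ww0; nra.
  have acc (e : R) : 0 < e -> exists l, [/\ l != 0, nrm (l - 0) < e & phi l = 0].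
    move=> e0; exists (cR (Num.min (e / 2) (r1 / nrm (w - w1) / 2))).
    have q0 : 0 < r1 / nrm (w - w1) by rewrite divr_gt0.
    set t := Num.min _ _.
    have t0 : 0 < t by rewrite lt_min !divr_gt0.
    have te : t <= e / 2 by rewrite ge_min lexx.
    have tr : t <= r1 / nrm (w - w1) / 2 by rewrite ge_min lexx orbT.
    rewrite subr0 nrm_cR gtr0_norm //; split.
    + by rewrite -nrm_gt0 nrm_cR normr_gt0 gt_eqF.
    + lra.
    + apply: E; last by rewrite !mxE w1k wk subrr mulr0 addr0.
      rewrite addrAC subrr add0r nrmZ nrm_cR gtr0_norm // -ltr_pdivlMr //; lra.
  have : phi 1 = 0 by apply: (identity_disk dphi acc); rewrite subr0 nrm1; lra.
  by rewrite /phi scale1r addrC subrK.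
have [w2 [w2r w2k w2n]] : exists w2, [/\ nrm (w2 - w1) < r1, w2 ord0 k = 0 & F j w2 != 0].
  apply: contrapT => nw; apply: nE => w wr wk; apply/eqP; apply: contrapT => /negP wn.
  by apply: nw; exists w.
have w2rr : nrm w2 < 4 * r by have := sub _ w2r; lra.
have /continuous_nrm /(_ _ (_ : 0 < nrm (F j w2))) [|e e0 He] := differentiable_continuous (dF j w2 w2rr).
  by rewrite nrm_gt0.
have r20 : 0 < Num.min e (r1 - nrm (w2 - w1)) by rewrite lt_min e0 subr_gt0.
have [||j' j's Hj'] := IH w2 _ r20 w2k.
- move=> w; rewrite lt_min => /andP[_ ww]; apply: sub.
  by have := nrm_tri w2 w w1; lra.
- move=> w; rewrite lt_min => /andP[we ww] wk.
  have [||j' j's Fw] := Hz w => //.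
    by have := nrm_tri w2 w w1; lra.
  move: j's; rewrite inE => /orP[/eqP jj|]; last by exists j'.
  have := He w we; rewrite -jj Fw sub0r nrmN ltxx //.
by exists j' => //; rewrite inE j's orbT.
Qed.

End Domain.

Section Charts.
Variable R : realType.
Local Notation C := (Cplx R).
Variables (n : nat) (Y : complexManifold R n).

Lemma ball_near (V : normedModType C) (x : V) (P : set V) :
  (\forall w \near x, P w) -> exists2 r : R, 0 < r & forall w, nrm (w - x) < r -> P w.
Proof. by move=> /nbhs_nrm. Qed.

(** A coordinate vanishes to first order, so it is not a product of two
    functions that vanish at [x]. *)
Lemma coord_unit (c : chart R Y n) x j (g v : Y -> C) : holomorphic_chart c ->
  chart_dom c x -> holomorphic_near g x -> holomorphic_near v x ->
  (\forall q \near x, c q ord0 j = g q * v q) -> g x = 0 -> v x != 0.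
Proof.
move=> hc cx hg hv E g0; apply/eqP => v0.
pose e : 'rV[C]_n := delta_mx ord0 j.
pose L (s : C) := c x + s *: e.
have L0 : L 0 = c x by rewrite /L scale0r addr0.
have dL := differentiable_line (c x) e 0.
have lin (h : Y -> C) : holomorphic_near h x -> h x = 0 ->
    exists K d : R, [/\ 0 < d, 0 <= K & forall s, nrm s < d -> nrm (h (chart_inv c (L s))) <= K * nrm s].
  move=> hh h0; have dh := holomorphic_near_chart hh hc cx.
  rewrite -L0 in dh.
  have /differentiable1P [a /(_ 1 ltr01) [d d0 Hd]] : differentiable (fun s => (h \o chart_inv c) (L s)) 0.
    exact: differentiable_comp dL dh.
  exists (nrm a + 1), d; split => //; first by rewrite addr_ge0 ?nrm_ge0.
  move=> s sd; have := Hd s; rewrite !subr0 => /(_ sd); rewrite /= L0 (chart_mapK cx) h0 subr0 mul1r.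
  have := nrm_leD (h (chart_inv c (L s))) (a * s); rewrite nrmM mulrDl mul1r; lra.
have [K1 [d1 [d10 K10 H1]]] := lin g hg g0; have [K2 [d2 [d20 K20 H2]]] := lin v hv v0.
have cL : \forall s \near (0 : C), chart_dom c (chart_inv c (L s)) /\ c (chart_inv c (L s)) = L s.
  have H := near_img cx; rewrite -L0 in H.
  exact: (differentiable_continuous dL H).
have EL : \forall s \near (0 : C), c (chart_inv c (L s)) ord0 j = g (chart_inv c (L s)) * v (chart_inv c (L s)).
  have H := near_inv cx E; rewrite -L0 in H.
  exact: (differentiable_continuous dL H).
have [d3 d30 H3] := ball_near (filterI cL EL).
have cxj : c x ord0 j = 0 by rewrite (nbhs_singleton E) g0 mul0r.
pose t := Num.min (Num.min d1 d2) (Num.min d3 (1 / (K1 * K2 + 1))) / 2.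
have KK : 0 <= K1 * K2 by rewrite mulr_ge0.
have m0 : 0 < Num.min (Num.min d1 d2) (Num.min d3 (1 / (K1 * K2 + 1))).
  by rewrite !lt_min d10 d20 d30 divr_gt0 // ltr_pwDr.
have t0 : 0 < t by rewrite divr_gt0.
have : t < Num.min (Num.min d1 d2) (Num.min d3 (1 / (K1 * K2 + 1))) by rewrite /t; lra.
rewrite !lt_min => /andP[/andP[t1 t2] /andP[t3 t4]].
have tn : nrm (cR t) = t by rewrite nrm_cR gtr0_norm.
have t3' : nrm (cR t - 0 : C) < d3 by rewrite subr0 tn.
have [[_ A] B] := H3 (cR t) t3'.
have : t <= K1 * t * (K2 * t).
  have := H1 (cR t); have := H2 (cR t); rewrite tn => /(_ t2) h2 /(_ t1) h1.
  have : nrm (c (chart_inv c (L (cR t))) ord0 j) <= K1 * t * (K2 * t).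
    by rewrite B nrmM; apply: ler_pM; rewrite ?nrm_ge0.
  by rewrite A /L !mxE cxj add0r !eqxx mulr1 tn.
have -> : K1 * t * (K2 * t) = (K1 * K2 * t) * t by ring.
rewrite ler_pMl // => h.
rewrite ltr_pdivlMr ?ltr_pwDr // mulrDr mulr1 in t4.
suff : (1 : R) < 1 by rewrite ltxx.
by clear - h t4 t0; lra.
Qed.

End Charts.

Section Cont.
Variable R : realType.
Local Notation C := (Cplx R).
Variables (n : nat) (Y : complexManifold R n) (Delta : orbifold Y).
Local Notation D_ := (orb_comp (o := Delta)).
Local Notation m_ := (orb_mult (o := Delta)).
Local Notation S := (orb_support Delta).
Hypothesis smooth : smooth_orbifold Delta.

Lemma chart_ball (c : chart R Y n) p (P : set Y) : chart_dom c p -> (\forall q \near p, P q) ->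
  exists2 r : R, 0 < r & forall x, nrm (x - c p) < r ->
    [/\ chart_dom c (chart_inv c x), c (chart_inv c x) = x & P (chart_inv c x)].
Proof.
move=> cp Pp; have [r r0 H] := ball_near (filterI (near_img cp) (near_inv cp Pp)).
by exists r => // x /H [[? ?] ?].
Qed.

(** The set [J] is empty when [p] is not in the support. *)
Lemma nc_chart p : exists (c : chart R Y n) (J : {set 'I_n}) (r : R),
  [/\ holomorphic_chart c, chart_dom c p, 0 < r,
    forall j, j \in J -> c p ord0 j = 0 &
    forall x, nrm (x - c p) < r -> [/\ chart_dom c (chart_inv c x), c (chart_inv c x) = x &
       S (chart_inv c x) <-> exists2 j, j \in J & x ord0 j = 0]].
Proof.
have [[cS nc] _] := smooth.
have [Sp|nSp] := pselect (S p).
  have [c [J [hc cp c0 H]]] := nc p Sp.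
  have [r r0 Hr] := chart_ball cp (near_dom cp).
  exists c, J, r; split => //; first by move=> j _; rewrite c0 mxE.
  by move=> x /Hr [d e _]; split => //; have := H _ d; rewrite e.
have [c ac cp] := atlas_cover p.
have near_nS : \forall q \near p, ~ S q.
  by apply: open_nbhs_nbhs; split => //; apply: closed_openC.
have [r r0 Hr] := chart_ball cp near_nS.
exists c, (finset.set0 : {set 'I_n}), r; split => //; first exact: atlas_holomorphic.
  by move=> j; rewrite inE.
move=> x /Hr [d e nS]; split => //; split => // -[j]; by rewrite inE.
Qed.

(** Near [x] the component is a piece of hyperplane in some chart, and it is
    covered by the hyperplanes of the given chart: one of them contains it. *)
Lemma nc_split i x (c : chart R Y n) (J : {set 'I_n}) : D_ i x -> m_ i <> Some 1%N ->
  holomorphic_chart c -> chart_dom c x ->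
  (\forall q \near x, S q -> exists2 j, j \in J & c q ord0 j = 0) ->
  exists2 j, j \in J & \forall q \near x, D_ i q -> c q ord0 j = 0.
Proof.
move=> Dx mi hc cx HS.
have [_ /(_ i mi) [_ /(_ x Dx) [c' [k [hc' c'x c'0 H]]]]] := smooth.
have [r r0 Hr] := chart_ball c'x (filterI (near_dom cx) HS).
rewrite c'0 in Hr.
pose F (j : 'I_n) (w : 'rV[C]_n) := c (chart_inv c' w) ord0 j.
have r40 : 0 < r / 4 by rewrite divr_gt0.
have dF j w : nrm w < 4 * (r / 4) -> differentiable (F j) w.
  move=> wr; have [|d e [dc _]] := Hr w; first by rewrite subr0; lra.
  apply: (@differentiable_comp_coord R _ n (c \o chart_inv c') w j).
  by have := trans_holomorphic hc' hc d dc; rewrite e.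
have [|j jJ Hj] := @hyperplane_domain R n k (enum J) F (r / 4) r40 dF.
  move=> w wr wk; have [|d e [dc HSw]] := Hr w; first by rewrite subr0; lra.
  have Dw : D_ i (chart_inv c' w) by apply/(H _ d); rewrite e.
  have [|j jJ Fj] := HSw; first by exists i.
  by exists j => //; rewrite mem_enum.
rewrite mem_enum in jJ; exists j => //.
have near_r : \forall q \near x, nrm (c' q) < r / 4.
  apply: (near_chart (P := fun w => nrm w < r / 4) c'x); rewrite c'0.
  by apply/nbhs_nrm; exists (r / 4) => // w; rewrite subr0.
apply: filterS2 (near_dom c'x) near_r => q dq qr Dq.
have := Hj (c' q) qr; rewrite /F chart_mapK //; apply.
exact: (H _ dq).1.
Qed.

Variable d : Y -> Y -> R.
Hypothesis Hk : kobayashi_pseudo_distance Delta d.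
Hypothesis Hd : distance_on (~` orb_floor Delta) d.
Hypothesis floor0 : orb_floor Delta = set0.
Hypothesis nontrivial : exists p q : Y, p <> q.

Lemma avoid_points (N : nat) (z : 'I_N -> C) : exists t : R, 0 < t < 1 /\ forall j, cR t <> z j.
Proof.
apply: contrapT => H.
(* more candidates than points to avoid *)
pose t (k : 'I_N.+1) : R := (k.+2%:R)^-1.
have /choice [f Hf] k : exists j, cR (t k) = z j.
  apply: contrapT => nj; apply: H; exists (t k); split.
    by rewrite invr_gt0 ltr0n /= invf_lt1 ?ltr0n // ltr1n.
  by move=> j tj; apply: nj; exists j.
have inj : injective f.
  move=> k l E; have : cR (t k) = cR (t l) by rewrite !Hf E.
  move=> /cR_inj /invr_inj /eqP; rewrite eqr_nat => /eqP [] kl; exact: val_inj.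
by have := leq_card f inj; rewrite !card_ord ltnn.
Qed.

(** A disk [H] with [H 0 = p] and [H b = q], where [b] is small.  Its [j]-th
    coordinate is [p]'s plus [u j ^ M], with [M] at least all the multiplicities, so
    it meets each hyperplane, hence each component, with multiplicity at least [M]. *)
Lemma d_near p (e : R) : 0 < e -> \forall q \near p, d p q < e.
Proof.
move=> e0; have [c [J [r [hc cp r0 cJ Hr]]]] := nc_chart p.
pose M := (\sum_i odflt 0%N (m_ i)).+1.
have mM i k : m_ i = Some k -> (k <= M)%N.
  by move=> E; rewrite /M (bigD1 i) //= E /=; apply: leqW; apply: leq_addr.
have [s [s0 s1 sr]] : exists s : R, [/\ 0 < s, s < 1 & s < r].
  exists (Num.min 1 r / 2).
  have m0 : 0 < Num.min 1 r by rewrite lt_min ltr01.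
  have m1 : Num.min 1 r <= 1 by rewrite ge_min lexx.
  have mr : Num.min 1 r <= r by rewrite ge_min lexx orbT.
  by split; lra.
have [b [b0 b2 be]] : exists b : R, [/\ 0 < b, b <= 2^-1 & b <= e / 5].
  exists (Num.min (2^-1) (e / 5)); split; first by rewrite lt_min invr_gt0 ltr0n /= divr_gt0.
    by rewrite ge_min lexx.
  by rewrite ge_min lexx orbT.
have q0 : 0 < (b * s / 2) ^+ M by rewrite exprn_gt0 // divr_gt0 // mulr_gt0.
have near_y : \forall q \near p, nrm (c q - c p) < (b * s / 2) ^+ M.
  by apply: (near_chart (P := fun w => nrm (w - c p) < (b * s / 2) ^+ M) cp); apply: near_nrm.
apply: filterS2 (near_dom cp) near_y => q cq qy.
apply: (@le_lt_trans _ _ (4 * b)); last by lra.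
have b01 : 0 <= b <= 2^-1 by rewrite ltW.
apply: le_trans (poincare0 b01).
pose y j : C := (c q - c p) ord0 j.
pose rho j : C := M.-root (y j).
have rhoM j : rho j ^+ M = y j by rewrite rootCK.
have rho_le j : nrm (rho j) <= b * s / 2.
  rewrite leNgt; apply/negP => lt.
  have : (b * s / 2) ^+ M < nrm (rho j) ^+ M.
    rewrite ltr_pXn2r // nnegrE ?nrm_ge0 //.
    by apply: divr_ge0 => //; apply: mulr_ge0; apply: ltW.
  rewrite -nrmX rhoM => /lt_trans /(_ (le_lt_trans (nrm_coord _ j) qy)).
  by rewrite ltxx.
pose ka : C := cR (s / 8).
have bC : cR b != 0 :> C by rewrite -nrm_gt0 nrm_cR normr_gt0 gt_eqF.
have kaC : ka != 0 by rewrite -nrm_gt0 nrm_cR normr_gt0 gt_eqF // divr_gt0.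
(* [u j] vanishes at [0], is an [M]-th root of the [j]-th coordinate of [q - p] at [b],
   and the term in [ka] keeps it from being identically zero *)
pose u j (w : C) : C := w * (ka * (w - cR b) + rho j / cR b).
have du j w : differentiable (u j) w.
  have -> : u j = @id C * (fun w => (rho j / cR b - ka * cR b) + ka * w).
    apply/funext => v; rewrite -[RHS]/(v * ((rho j / cR b - ka * cR b) + ka * v)) /u.
    by congr (_ * _); ring.
  apply: differentiableM; last exact: differentiable_affine.
  exact: (diff_id w).
have u_le j w : nrm w < 1 -> nrm (u j w) < s.
  move=> w1; rewrite /u nrmM.
  have h1 : nrm (ka * (w - cR b)) <= s / 4.
    rewrite nrmM nrm_cR gtr0_norm ?divr_gt0 //.
    have : nrm (w - cR b) <= 2.
      by have := nrmB w (cR b); rewrite nrm_cR gtr0_norm //; lra.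
    have := nrm_ge0 (w - cR b); have := s0; nra.
  have h2 : nrm (rho j / cR b) <= s / 2.
    rewrite nrmM nrmV nrm_cR gtr0_norm // ler_pdivrMr //.
    by apply: le_trans (rho_le j) _; lra.
  have h3 := nrmD (ka * (w - cR b)) (rho j / cR b).
  apply: (@le_lt_trans _ _ (nrm (ka * (w - cR b) + rho j / cR b))).
    by apply: ler_piMl; [exact: nrm_ge0|exact: ltW].
  by have := s0; lra.
have uM_le j w : nrm w < 1 -> nrm (u j w ^+ M) < r.
  move=> w1; rewrite nrmX exprS; have := u_le j w w1; have u0 := nrm_ge0 (u j w) => us.
  have : nrm (u j w) * nrm (u j w) ^+ (\sum_i odflt 0%N (m_ i)) <= nrm (u j w).
    by rewrite ler_piMr // exprn_ile1 // ltW // (lt_trans us).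
  by lra.
pose X (w : C) : 'rV[C]_n := c p + \row_j (u j w ^+ M).
have XE w j : X w ord0 j = c p ord0 j + u j w ^+ M by rewrite !mxE.
have XJ w j : j \in J -> X w ord0 j = u j w ^+ M.
  by move=> jJ; rewrite XE cJ // add0r.
have Xr w : nrm w < 1 -> nrm (X w - c p) < r.
  move=> w1; rewrite /X addrAC subrr add0r; apply: nrm_rV_lt => // j.
  by rewrite mxE; apply: uM_le.
have dX w : differentiable X w.
  apply: differentiable_rV => j.
  have -> : (fun v => X v ord0 j) = cst (c p ord0 j) + (u j) ^+ M.
    by apply/funext => v; rewrite XE exprfctE.
  apply: differentiableD; first exact: differentiable_cst.
  exact: differentiableX.
pose H (w : C) := chart_inv c (X w).
have HX w : nrm w < 1 -> [/\ chart_dom c (H w), c (H w) = X w &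
   S (H w) <-> exists2 j, j \in J & X w ord0 j = 0] by move=> /Xr /Hr.
have ud w : unit_disk w -> nrm w < 1 by rewrite /unit_disk /= nrmE lt_cR.
have hcH w : nrm w < 1 -> holomorphic_at H w.
  by move=> /HX [dw ew _]; apply: (holomorphic_at_inv hc dw).
have u0 j : u j 0 = 0 by rewrite /u mul0r.
have ub j : u j (cR b) = rho j by rewrite /u subrr mulr0 add0r mulrC divfK.
have H0 : H 0 = p.
  rewrite /H (_ : X 0 = c p) ?chart_mapK //.
  by apply/rowP => j; rewrite XE u0 expr0n addr0.
have Hb : H (cR b) = q.
  rewrite /H (_ : X (cR b) = c q) ?chart_mapK //.
  by apply/rowP => j; rewrite XE ub rhoM /y !mxE addrCA subrr addr0.
rewrite -{1}H0 -Hb; apply: (d_disk Hk); last first.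
- by rewrite /unit_disk /= nrmE lt_cR nrm_cR gtr0_norm //; lra.
- by rewrite /unit_disk /= normr0.
have near_disk (z : C) : nrm z < 1 -> \forall w \near z, nrm w < 1.
  move=> z1; apply/nbhs_nrm; exists (1 - nrm z); first by rewrite subr_gt0.
  by move=> w wz; have := nrm_leD w z; lra.
split.
- by move=> z /ud /hcH.
- move=> sub.
  have [t [/andP[t0 t1] Ht]] := avoid_points (fun j => cR b - rho j / cR b / ka).
  have tn : nrm (cR t : C) = t by rewrite nrm_cR gtr0_norm.
  have t1' : nrm (cR t : C) < 1 by rewrite tn.
  have [_ _ [HS _]] := HX _ t1'.
  have [|j jJ /eqP] := HS.
    by apply: sub; exists (cR t) => //; rewrite /unit_disk /= nrmE lt_cR tn.
  rewrite XJ // expf_eq0 /= mulf_eq0 => /orP[/eqP t0'|].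
    by move: t0; rewrite -tn t0' nrm0 ltxx.
  rewrite addr_eq0 => /eqP E; apply: (Ht j).
  have E2 : cR t - cR b = - (rho j / cR b) / ka by rewrite -E [ka * _]mulrC mulfK.
  by rewrite -[cR t](subrK (cR b)) E2 addrC mulNr.
- move=> i z /ud z1 Dz; have [k Ek k1] := multP floor0 i; rewrite Ek.
  have hz : \forall w \near z, holomorphic_at H w.
    by have := near_disk z z1; apply: filterS => w; apply: hcH.
  have [k11|kn1] := eqVneq k 1%N.
    by rewrite k11; apply: (disk_mult1 Hk floor0 nontrivial Dz hz).
  have mi : m_ i <> Some 1%N by rewrite Ek => -[] /eqP; apply/negP.
  have [dz ez _] := HX z z1.
  have HS : \forall q \near H z, S q -> exists2 j, j \in J & c q ord0 j = 0.
    have : \forall q \near H z, nrm (c q - c p) < r.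
      apply: (near_chart (P := fun w => nrm (w - c p) < r) dz); rewrite ez.
      apply/nbhs_nrm; exists (r - nrm (X z - c p)); first by rewrite subr_gt0 Xr.
      by move=> w wz; have := nrm_tri (X z) w (c p); lra.
    apply: filterS2 (near_dom dz) => q' dq /Hr [_ _]; rewrite chart_mapK // => -[HSq _] /HSq.
    by [].
  have [j jJ van] := nc_split Dz mi hc dz HS.
  have [g lg] := local_equation_ex Hk floor0 nontrivial Dz.
  have [hg gvan gen] := lg.
  have [v hv Ev] := gen _ (holomorphic_near_coord j hc dz) van.
  have g0 : g (H z) = 0 by apply: nbhs_singleton gvan Dz.
  have v0 := coord_unit hc dz hg hv Ev g0.
  have cH := (hcH z z1).1.
  have Ez : \forall w \near z, u j w ^+ M = g (H w) * v (H w).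
    have Ev' : \forall w \near z, c (H w) ord0 j = g (H w) * v (H w) := cH _ Ev.
    apply: filterS2 (near_disk z z1) Ev' => w w1 <-.
    by have [_ -> _] := HX w w1; rewrite XJ.
  have uz : u j z = 0.
    by have /eqP := nbhs_singleton Ez; rewrite g0 mul0r expf_eq0 /= => /eqP.
  have [psi dpsi Epsi] := removable (filterE _ (fun w => du j w)) uz.
  have dvH := holomorphic_near_curve hv hz.
  have vn : \forall w \near z, v (H w) != 0.
    have cvH := differentiable_continuous (nbhs_singleton dvH).
    have vpos : 0 < nrm (v (H z)) by rewrite nrm_gt0.
    have [dd dd0 Hdd] := (continuous_nrm (v \o H) z).1 cvH _ vpos.
    apply/nbhs_nrm; exists dd => // w /Hdd.
    by apply: contraTneq => /= ->; rewrite sub0r nrmN ltxx.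
  exists g; split => //.
  exists (fun w => (w - z) ^+ (M - k) * psi w ^+ M * (v (H w))^-1); split.
    apply: filterS3 dpsi dvH vn => w d1 d2 d3.
    apply: (@differentiableM _ _ (fun w => (w - z) ^+ (M - k) * psi w ^+ M) (fun w => (v (H w))^-1)); last first.
      exact: (@differentiableV _ _ (v \o H)).
    apply: (@differentiableM _ _ (fun w => (w - z) ^+ (M - k)) (fun w => psi w ^+ M)).
      exact: differentiable_powB.
    have -> : (fun w : C => psi w ^+ M) = psi ^+ M by rewrite exprfctE.
    exact: differentiableX.
  apply: filterS2 Ez vn => w Ew vw.
  rewrite !mulrA -exprD subnKC ?(mM i) // -exprMn -Epsi Ew mulfK //.
Qed.

End Cont.

(** * Isometries of a compact metric space *)

Section Metric.
Variables (R : realType) (Y : topologicalType) (d : Y -> Y -> R).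
Hypotheses (dge0 : forall x y, 0 <= d x y) (dxx0 : forall x, d x x = 0).
Hypotheses (dsym : forall x y, d x y = d y x) (dtri : forall y x z, d x z <= d x y + d y z).
Hypothesis deq0 : forall x y, d x y = 0 -> x = y.
Hypothesis dnear : forall p (e : R), 0 < e -> \forall q \near p, d p q < e.
Hypothesis cY : compact [set: Y].

Lemma d_eq x y : (forall e : R, 0 < e -> d x y <= e) -> x = y.
Proof.
move=> H; apply: deq0; apply/eqP; rewrite eq_le dge0 andbT.
by apply/ler_addgt0Pr => e e0; rewrite add0r H.
Qed.

Section Limits.
Variables (T : Type) (U : set_system T).
Hypothesis UU : UltraFilter U.
Let UF : Filter U. Proof. exact: filter_filter. Qed.

Definition dist_cvg (u : T -> Y) (l : Y) := forall e : R, 0 < e -> \forall k \near U, d (u k) l < e.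

Lemma cvg_dist u l : u @ U --> l -> dist_cvg u l.
Proof.
move=> ul e e0; have H : \forall k \near U, d l (u k) < e := ul _ (dnear l e0).
by apply: filterS H => k; rewrite dsym.
Qed.

Lemma dist_cvg_ex u : exists l, dist_cvg u l.
Proof.
have [l _ ul] := @ultra_compact T U UU Y [set: Y] u cY filterT.
by exists l; apply: cvg_dist.
Qed.

Lemma dist_cvg_unique u l l' : dist_cvg u l -> dist_cvg u l' -> l = l'.
Proof.
move=> h h'; apply: d_eq => e e0; have e2 : 0 < e / 2 by rewrite divr_gt0.
have [k [h1 h2]] := filter_ex (filterI (h _ e2) (h' _ e2)).
by have := dtri (u k) l l'; rewrite (dsym l (u k)); lra.
Qed.

Lemma dist_cvg_cvg u l : dist_cvg u l -> u @ U --> l.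
Proof.
move=> h; have [l' _ ul] := @ultra_compact T U UU Y [set: Y] u cY filterT.
by rewrite (dist_cvg_unique h (cvg_dist ul)).
Qed.

Lemma dist_cvg_near u v l : dist_cvg u l -> (forall e : R, 0 < e -> \forall k \near U, d (u k) (v k) <= e) ->
  dist_cvg v l.
Proof.
move=> h h' e e0; have e2 : 0 < e / 2 by rewrite divr_gt0.
apply: filterS2 (h _ e2) (h' _ e2) => k h1 h2.
by have := dtri (u k) (v k) l; rewrite (dsym (v k) (u k)); lra.
Qed.

Lemma dist_cvg_le u v l l' (a : R) : dist_cvg u l -> dist_cvg v l' -> (\forall k \near U, d (u k) (v k) <= a) ->
  d l l' <= a.
Proof.
move=> h h' H; apply/ler_addgt0Pr => e e0; have e2 : 0 < e / 2 by rewrite divr_gt0.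
have [k [[h1 h2] h3]] := filter_ex (filterI (filterI (h _ e2) (h' _ e2)) H).
by have := dtri (u k) l l'; have := dtri (v k) (u k) l'; rewrite (dsym l (u k)); lra.
Qed.

Lemma not_near (P : T -> Prop) : ~ (\forall k \near U, P k) -> \forall k \near U, ~ P k.
Proof. by move=> nP; have [//|] := in_ultra_setVsetC P UU. Qed.

End Limits.

Lemma ultra_nat : exists U : set_system nat, UltraFilter U /\ forall n0, \forall n \near U, (n0 <= n)%N.
Proof.
have [U [UU Uoo]] := @ultraFilterLemma nat \oo _.
by exists U; split => // n0; apply: Uoo; exists n0.
Qed.

(** By compactness a sequence of distinct isometries has a uniform limit, and
    the quotient of two terms close to the limit is close to the identity. *)
Lemma isometries_near_id (y0 : Y) (G : (Y -> Y) -> (Y -> Y) -> Prop) :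
  (forall f g x y, G f g -> d (f x) (f y) = d x y) ->
  (forall f g, G f g -> cancel f g /\ cancel g f) ->
  (forall f g, G f g -> G g f) ->
  (forall f g f' g', G f g -> G f' g' -> G (f \o f') (g' \o g)) ->
  ~ finite_set [set f | exists g, G f g] ->
  forall e : R, 0 < e -> exists f g, [/\ G f g, f <> id & forall y, d (f y) y <= e].
Proof.
move=> iso can inv comp inf e e0.
have [s [sinj sG]] : exists s : nat -> (Y -> Y), injective s /\ forall k, exists g, G (s k) g.
  have /infiniteP /card_leP [s] := inf.
  exists (fun k => set_val (s (to_setT k))); split; last by move=> k; exact: (set_valP (s (to_setT k))).
  move=> k l /val_inj /(inj (f := s)) E.
  by have /(congr1 set_val) := E (in_setT _) (in_setT _).
have /choice [s' Hs] := sG.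
have [U [UU Uge]] := ultra_nat.
have UF : Filter U by apply: filter_filter.
have /choice [phi Hphi] y := dist_cvg_ex UU (fun k => s k y).
have phi_iso x y : d (phi x) (phi y) <= d x y.
  apply: (dist_cvg_le UU (Hphi x) (Hphi y)); apply: filterE => k.
  by rewrite (iso _ _ _ _ (Hs k)).
have e4 : 0 < e / 4 by rewrite divr_gt0.
have unif : \forall k \near U, forall y, d (s k y) (phi y) <= e / 4.
  apply: contrapT => /(not_near UU) bad.
  have /choice [y Hy] k : exists y, ~ (forall y, d (s k y) (phi y) <= e / 4) -> ~ d (s k y) (phi y) <= e / 4.
    have [H|/existsNP [y Hy]] := pselect (forall y, d (s k y) (phi y) <= e / 4); last by exists y.
    by exists y0.
  have [l yl] := dist_cvg_ex UU y.
  have e8 : 0 < e / 16 by rewrite divr_gt0.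
  have [k [[h1 h2] h3]] := filter_ex (filterI (filterI (yl _ e8) (Hphi l _ e8)) bad).
  apply: (Hy k h3).
  have := dtri (s k l) (s k (y k)) (phi (y k)); have := dtri (phi l) (s k l) (phi (y k)).
  rewrite (iso _ _ _ _ (Hs k)); have := phi_iso l (y k); rewrite (dsym l (y k)); lra.
have [k [h1 _]] := filter_ex (filterI unif (Uge 0%N)).
have [l [h2 kl]] := filter_ex (filterI unif (Uge k.+1)).
exists (s' l \o s k), (s' k \o s l); split.
- by apply: comp (Hs k); apply: inv.
- move=> E; have : s k = s l.
    apply/funext => y; have := congr1 (fun f => f y) E; rewrite /= => /(congr1 (s l)).
    by have [_ ->] := can _ _ (Hs l).
  by move=> /sinj kl'; rewrite kl' ltnn in kl.
- move=> y; rewrite /= -(iso _ _ _ _ (Hs l)); have [_ ->] := can _ _ (Hs l).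
  have := dtri (phi y) (s k y) (s l y); have := h1 y; have := h2 y; rewrite (dsym (s l y) (phi y)); lra.
Qed.

End Metric.

(** * Charts adapted to the support, and displacements in them *)

Lemma fin_min (R : realType) (I : finType) (r : I -> R) : (forall i, 0 < r i) ->
  exists2 rho : R, 0 < rho & forall i, rho <= r i.
Proof.
move=> r0; have [rho rho0 H] : exists2 rho : R, 0 < rho & forall i, i \in enum I -> rho <= r i.
  elim: (enum I) => [|i s [rho rho0 H]]; first by exists 1.
  exists (Num.min (r i) rho); first by rewrite lt_min r0.
  move=> j; rewrite inE => /orP[/eqP ->|/H jr]; first by rewrite ge_min lexx.
  by rewrite ge_min jr orbT.
by exists rho => // i; apply: H; rewrite mem_enum.
Qed.

Lemma ultra_fin (T : Type) (U : set_system T) (I : finType) (P : I -> T -> Prop) :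
  UltraFilter U -> (\forall k \near U, exists i, P i k) -> exists i, \forall k \near U, P i k.
Proof.
move=> UU H; apply: contrapT => nH.
have UF : Filter U by apply: filter_filter.
have : \forall k \near U, forall i, ~ P i k.
  by apply: filter_forall => i; apply: (not_near UU) => Hi; apply: nH; exists i.
by move=> H'; have [k [[i Pi] nP]] := filter_ex (filterI H H'); apply: (nP i).
Qed.

Section UltraRow.
Variable R : realType.
Local Notation C := (Cplx R).
Variables (T : Type) (U : set_system T).
Hypothesis UU : UltraFilter U.
Let UF : Filter U. Proof. exact: filter_filter. Qed.

Lemma nrm_cvg_coord n (u : T -> 'rV[C]_n) l i : nrm_cvg U u l -> nrm_cvg U (fun t => u t ord0 i) (l ord0 i).
Proof.
move=> ul e e0; apply: filterS (ul e e0) => t; apply: le_lt_trans.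
by have := nrm_coord (u t - l) i; rewrite !mxE.
Qed.

Lemma ultra_bounded_rV n (u : T -> 'rV[C]_n) b (B : R) :
  (\forall t \near U, nrm (u t - b) <= B) ->
  exists2 l, nrm (l - b) <= B & nrm_cvg U u l.
Proof.
move=> ub.
have /choice [l Hl] i : exists l : C, forall e : R, 0 < e -> \forall t \near U, nrm ((u t - b) ord0 i - l) < e.
  have ubi : \forall t \near U, nrm ((u t - b) ord0 i) <= B.
    by apply: filterS ub => t; apply: le_trans (nrm_coord _ _).
  by have [l _ Hl] := ultra_bounded UU ubi; exists l.
have cv : nrm_cvg U u (b + \row_i l i).
  move=> e e0.
  have : \forall t \near U, forall i, nrm ((u t - b) ord0 i - l i) < e.
    by apply: filter_forall => i; apply: Hl.
  apply: filterS => t H; apply: nrm_rV_lt => // i.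
  by have := H i; rewrite !mxE opprD addrA.
exists (b + \row_i l i) => //.
exact: (nrm_cvg_le UU cv ub).
Qed.

End UltraRow.

Section Boxes.
Variable R : realType.
Local Notation C := (Cplx R).
Variables (n : nat) (Y : complexManifold R n) (Delta : orbifold Y).
Local Notation S := (orb_support Delta).

(** The ball of radius [4 * box_radius] is adapted to the support.  Estimates are
    made on the ball of half that radius, so that the limits taken there remain in
    the chart. *)
Record nc_box := NBox {
  box_chart : chart R Y n; box_center : 'rV[C]_n; box_walls : {set 'I_n}; box_radius : R;
  box_holomorphic : holomorphic_chart box_chart;
  box_radius_gt0 : 0 < box_radius;
  boxP : forall x, nrm (x - box_center) < 4 * box_radius ->
    [/\ chart_dom box_chart (chart_inv box_chart x), box_chart (chart_inv box_chart x) = x &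
       S (chart_inv box_chart x) <-> exists2 j, j \in box_walls & x ord0 j = 0] }.

Definition in_box (a : nc_box) (r : R) (q : Y) := chart_dom (box_chart a) q /\ nrm (box_chart a q - box_center a) < r.

Lemma in_box_near a r q : in_box a r q -> \forall q' \near q, in_box a r q'.
Proof.
move=> [dq qr]; have : \forall q' \near q, nrm (box_chart a q' - box_center a) < r.
  apply: (near_chart (P := fun w => nrm (w - box_center a) < r) dq).
  apply/nbhs_nrm; exists (r - nrm (box_chart a q - box_center a)); first by rewrite subr_gt0.
  by move=> w wz; have := nrm_tri (box_chart a q) w (box_center a); lra.
by apply: filterS2 (near_dom dq) => q' d' h; split.
Qed.

Hypothesis smooth : smooth_orbifold Delta.
Hypothesis cY : compact [set: Y].

Lemma box_ex p : exists a : nc_box, in_box a (box_radius a) p.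
Proof.
have [c [J [r [hc cp r0 _ H]]]] := nc_chart smooth p.
have r4 : 0 < r / 4 by rewrite divr_gt0.
have H' x : nrm (x - c p) < 4 * (r / 4) -> [/\ chart_dom c (chart_inv c x), c (chart_inv c x) = x &
       S (chart_inv c x) <-> exists2 j, j \in J & x ord0 j = 0].
  by rewrite mulrC divfK //; apply: H.
by exists (NBox hc r4 H'); split; rewrite //= subrr nrm0.
Qed.

Lemma finite_boxes : exists (I : finType) (a : I -> nc_box), forall q, exists i, in_box (a i) (box_radius (a i)) q.
Proof.
have /choice [a Ha] := box_ex.
have /compact_near_coveringP nc := cY.
(* the filter of all sufficiently large finite lists of points *)
pose F : set_system (seq Y) := fun A => exists s0 : seq Y, forall s : seq Y, {subset s0 <= s} -> A s.
have FF : Filter F.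
  split; first by exists [::].
    move=> A B [s1 H1] [s2 H2]; exists (s1 ++ s2) => s ss; split.
      by apply: H1 => x xs; apply: ss; rewrite mem_cat xs.
    by apply: H2 => x xs; apply: ss; rewrite mem_cat xs orbT.
  by move=> A B AB [s1 H1]; exists s1 => s /H1 /AB.
pose P (s : seq Y) (q : Y) := exists2 p, p \in s & in_box (a p) (box_radius (a p)) q.
have [|s0 H0] := nc (seq Y) F P FF.
  move=> x _; exists (in_box (a x) (box_radius (a x)), [set s : seq Y | x \in s]) => /=.
    split; first exact: in_box_near.
    by exists [:: x] => s; apply; rewrite mem_head.
  by move=> [x' s] /= [xx xs]; exists x.
exists (seq_sub s0 : finType), (fun i => a (ssval i)) => q.
have [p ps pq] := H0 s0 (fun _ h => h) q I.
by exists (SeqSub ps).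
Qed.

End Boxes.

Section Eps.
Variable R : realType.
Local Notation C := (Cplx R).
Variables (n : nat) (Y : complexManifold R n) (Delta : orbifold Y).
Local Notation S := (orb_support Delta).
Variable d : Y -> Y -> R.
Hypotheses (dge0 : forall x y, 0 <= d x y) (dxx0 : forall x, d x x = 0).
Hypotheses (dsym : forall x y, d x y = d y x) (dtri : forall y x z, d x z <= d x y + d y z).
Hypothesis deq0 : forall x y, d x y = 0 -> x = y.
Hypothesis dnear : forall p (e : R), 0 < e -> \forall q \near p, d p q < e.
Hypothesis cY : compact [set: Y].
Variables (I : finType) (a : I -> nc_box Delta).
Hypothesis cover : forall q, exists i, in_box (a i) (box_radius (a i)) q.
Variables (U : set_system nat).
Hypothesis UU : UltraFilter U.
Hypothesis Uge : forall n0, \forall n \near U, (n0 <= n)%N.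
Let UF : Filter U. Proof. exact: filter_filter. Qed.
Variable f : nat -> Y -> Y.
Hypothesis fmv : forall (e : R), 0 < e -> \forall k \near U, forall y, d (f k y) y <= e.
Hypothesis fid : forall k, f k <> id.

Lemma dist_cvg_inv i (x : nat -> 'rV[C]_n) l : nrm_cvg U x l -> nrm (l - box_center (a i)) < 4 * box_radius (a i) ->
  dist_cvg d U (fun k => chart_inv (box_chart (a i)) (x k)) (chart_inv (box_chart (a i)) l).
Proof.
move=> xl lr; have [dl el _] := boxP lr.
apply: cvg_dist => // A; have := chart_inv_cont dl; rewrite el => H /H nA.
have /nrm_cvg_cvg xl' := xl.
exact: xl' nA.
Qed.

Lemma dist_cvg_chart i (y : nat -> Y) l : dist_cvg d U y l -> chart_dom (box_chart (a i)) l ->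
  nrm_cvg U (fun k => box_chart (a i) (y k)) (box_chart (a i) l).
Proof.
move=> yl dl; have yl' := dist_cvg_cvg dge0 dsym dtri deq0 dnear cY UU yl.
move=> e e0.
exact: (yl' _ (near_chart (P := fun w => nrm (w - box_chart (a i) l) < e) dl (near_nrm _ e0))).
Qed.

Lemma dist_cvg_dom i (y : nat -> Y) l : dist_cvg d U y l -> chart_dom (box_chart (a i)) l ->
  \forall k \near U, chart_dom (box_chart (a i)) (y k).
Proof.
move=> yl dl; have yl' := dist_cvg_cvg dge0 dsym dtri deq0 dnear cY UU yl.
exact: (yl' _ (near_dom dl)).
Qed.

(** The closed ball is compact and is mapped homeomorphically into [Y]. *)
Lemma box_limit i (q : nat -> Y) (r : R) : r < 4 * box_radius (a i) ->
  (\forall k \near U, chart_dom (box_chart (a i)) (q k) /\ nrm (box_chart (a i) (q k) - box_center (a i)) <= r) ->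
  exists l, [/\ dist_cvg d U q l, chart_dom (box_chart (a i)) l & nrm (box_chart (a i) l - box_center (a i)) <= r].
Proof.
move=> r4 H.
have [l lr xl] := @ultra_bounded_rV R _ U UU n (fun k => box_chart (a i) (q k)) (box_center (a i)) r (filterS (fun _ => @proj2 _ _) H).
have lr4 := le_lt_trans lr r4.
have [dl el _] := boxP lr4.
exists (chart_inv (box_chart (a i)) l); split; rewrite ?el //.
have cv := dist_cvg_inv xl lr4.
move=> e e0; apply: filterS2 H (cv e e0) => k [dk _].
by rewrite chart_mapK.
Qed.

(** Otherwise limits of badly moved points, and of their images, would coincide
    in [Y] but not in the chart. *)
Lemma chart_displacement_small i (e : R) : 0 < e -> \forall k \near U, forall q, chart_dom (box_chart (a i)) q ->
  nrm (box_chart (a i) q - box_center (a i)) <= 3 * box_radius (a i) ->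
  chart_dom (box_chart (a i)) (f k q) /\ nrm (box_chart (a i) (f k q) - box_chart (a i) q) < e.
Proof.
move=> e0; apply: contrapT => /(not_near UU) bad.
have [i0 Hi0] : exists q0 : Y, True by exists (chart_inv (box_chart (a i)) 0).
pose good k q := chart_dom (box_chart (a i)) q -> nrm (box_chart (a i) q - box_center (a i)) <= 3 * box_radius (a i) ->
  chart_dom (box_chart (a i)) (f k q) /\ nrm (box_chart (a i) (f k q) - box_chart (a i) q) < e.
have /choice [q Hq] k : exists q, ~ (forall q, good k q) -> ~ good k q.
  have [h|/existsNP [q nq]] := pselect (forall q, good k q); last by exists q.
  by exists i0.
have bad' : \forall k \near U, [/\ chart_dom (box_chart (a i)) (q k), nrm (box_chart (a i) (q k) - box_center (a i)) <= 3 * box_radius (a i) &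
   ~ (chart_dom (box_chart (a i)) (f k (q k)) /\ nrm (box_chart (a i) (f k (q k)) - box_chart (a i) (q k)) < e)].
  apply: filterS bad => k /Hq nk; split; last by move=> h; apply: nk.
    by apply: contrapT => h; apply: nk => h1.
  by apply: contrapT => h; apply: nk => _ h2.
have r3 : 3 * box_radius (a i) < 4 * box_radius (a i) by have := box_radius_gt0 (a i); lra.
have [|l [ql dl lr]] := @box_limit i q (3 * box_radius (a i)) r3.
  by apply: filterS bad' => k [].
have fql : dist_cvg d U (fun k => f k (q k)) l.
  apply: (dist_cvg_near dsym dtri UU ql) => e' e'0.
  by apply: filterS (fmv e'0) => k h; rewrite dsym.
have e2 : 0 < e / 2 by rewrite divr_gt0.
have [k [[[h1 h2] h3] [_ _ h4]]] := filter_ex (filterI (filterI (filterI (dist_cvg_dom fql dl)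
  (dist_cvg_chart fql dl e2)) (dist_cvg_chart ql dl e2)) bad').
apply: h4; split => //.
by have := nrm_tri (box_chart (a i) l) (box_chart (a i) (f k (q k))) (box_chart (a i) (q k)); rewrite [nrm (box_chart (a i) l - _)]nrmBC; lra.
Qed.

(** [eps k] is the supremum of the displacements of [f k] in all the charts, so
    that some point is moved by at least half of it. *)
Lemma displacement_scale : exists eps : nat -> R,
  [/\ \forall k \near U, 0 < eps k,
      \forall k \near U, forall i q, in_box (a i) (2 * box_radius (a i)) q ->
         chart_dom (box_chart (a i)) (f k q) /\ nrm (box_chart (a i) (f k q) - box_chart (a i) q) <= eps k,
      forall e : R, 0 < e -> \forall k \near U, eps k < e &
      \forall k \near U, exists i q, in_box (a i) (2 * box_radius (a i)) q /\
         eps k / 2 <= nrm (box_chart (a i) (f k q) - box_chart (a i) q)].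
Proof.
pose Z k := [set t : R | exists i q, in_box (a i) (2 * box_radius (a i)) q /\ t = nrm (box_chart (a i) (f k q) - box_chart (a i) q)].
have cl (e : R) : 0 < e -> \forall k \near U, forall i q, in_box (a i) (2 * box_radius (a i)) q ->
    chart_dom (box_chart (a i)) (f k q) /\ nrm (box_chart (a i) (f k q) - box_chart (a i) q) < e.
  move=> e0; have : \forall k \near U, forall i q, chart_dom (box_chart (a i)) q ->
     nrm (box_chart (a i) q - box_center (a i)) <= 3 * box_radius (a i) ->
     chart_dom (box_chart (a i)) (f k q) /\ nrm (box_chart (a i) (f k q) - box_chart (a i) q) < e.
    by apply: filter_forall => i; apply: chart_displacement_small.
  apply: filterS => k H i q [dq qr]; apply: H => //.
  by have := box_radius_gt0 (a i); lra.
have ub k (e : R) : (forall i q, in_box (a i) (2 * box_radius (a i)) q ->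
    chart_dom (box_chart (a i)) (f k q) /\ nrm (box_chart (a i) (f k q) - box_chart (a i) q) < e) -> ubound (Z k) e.
  by move=> H t [i [q [/H [_ /ltW h] ->]]].
have pos k : (forall i q, in_box (a i) (2 * box_radius (a i)) q ->
    chart_dom (box_chart (a i)) (f k q) /\ nrm (box_chart (a i) (f k q) - box_chart (a i) q) < 1) -> exists2 t, Z k t & 0 < t.
  move=> H; have [q fq] : exists q, f k q <> q.
    by apply: contrapT => nq; apply: (fid (k := k)); apply/funext => q; apply: contrapT => h; apply: nq; exists q.
  have [i [dq qr]] := cover q.
  have q2 : in_box (a i) (2 * box_radius (a i)) q by split => //; have := box_radius_gt0 (a i); lra.
  exists (nrm (box_chart (a i) (f k q) - box_chart (a i) q)); first by exists i, q.
  rewrite nrm_gt0 subr_eq0; apply/eqP => E; apply: fq.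
  by rewrite -(chart_mapK (H i q q2).1) E chart_mapK.
have sp k : (forall i q, in_box (a i) (2 * box_radius (a i)) q ->
    chart_dom (box_chart (a i)) (f k q) /\ nrm (box_chart (a i) (f k q) - box_chart (a i) q) < 1) ->
    has_sup (Z k) /\ 0 < sup (Z k).
  move=> H; have [t Zt t0] := pos k H.
  have hs : has_sup (Z k) by split; [exists t|exists 1; apply: ub].
  split => //; apply: lt_le_trans t0 _; apply: ub_le_sup => //; by case: hs.
exists (fun k => sup (Z k)); split.
- by apply: filterS (cl 1 ltr01) => k /sp [].
- apply: filterS (cl 1 ltr01) => k H i q iq; split; first exact: (H i q iq).1.
  by apply: ub_le_sup; [case: (sp k H) => -[]|exists i, q].
- move=> e e0; have e2 : 0 < e / 2 by rewrite divr_gt0.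
  apply: filterS2 (cl 1 ltr01) (cl _ e2) => k H1 H2.
  have : sup (Z k) <= e / 2 by apply: ge_sup; [case: (sp k H1) => -[]|exact: ub].
  by lra.
- apply: filterS (cl 1 ltr01) => k H; have [hs s0] := sp k H.
  have [|t [i [q [iq ->]]] tq] := @sup_gt R (Z k) (sup (Z k) / 2) hs.1; first by lra.
  by exists i, q; split => //; apply: ltW.
Qed.

End Eps.

(** * The flow of a sequence of symmetries converging to the identity *)

Section CurveIdentity.
Variable R : realType.
Local Notation C := (Cplx R).
Variables (n : nat) (Y : complexManifold R n).
Variable d : Y -> Y -> R.
Hypotheses (dge0 : forall x y, 0 <= d x y) (dsym : forall x y, d x y = d y x).
Hypothesis dtri : forall y x z, d x z <= d x y + d y z.
Hypothesis deq0 : forall x y, d x y = 0 -> x = y.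
Hypothesis dnear : forall p (e : R), 0 < e -> \forall q \near p, d p q < e.

Lemma nrm_shift (V : normedModType C) (x w c : V) (r1 r2 r : R) :
  nrm (w - x) < r1 -> nrm (x - c) < r2 -> r1 + r2 <= r -> nrm (w - c) < r.
Proof. by move=> h1 h2; apply: lt_le_trans; apply: le_lt_trans (nrm_tri x w c) (ltrD h1 h2). Qed.

Lemma time_budget (c t u : R) : 0 < c -> t <= c / 2 -> u <= t -> u < 512 * c /\ 256 * u <= 512 * c.
Proof. by move=> *; split; lra. Qed.

Lemma half_lt (t u e : R) : t < u + e -> e < t / 2 -> t / 2 < u.
Proof. by move=> *; lra. Qed.

(** For times below [(4 * L * K) ^ -1] the quadratic error is at most half of
    the linear drift. *)
Lemma drift_bound (L K tau t big diff : R) : 0 < L -> 0 < K -> 0 < t -> tau <= t -> t / 2 < tau ->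
  t <= (4 * L * K)^-1 -> tau / 2 <= L * big -> big - diff <= K * (tau * tau) -> t / 8 < L * diff.
Proof.
move=> L0 K0 t0 tt t2 tK h1 h2; have tau0 : 0 < tau by lra.
have LK0 : 0 < 4 * L * K by apply: mulr_gt0 K0; apply: mulr_gt0 L0.
have h3 : tau * (4 * L * K) <= 1.
  by rewrite -ler_pdivlMr // mul1r; apply: le_trans tK.
have h4 : tau * (tau * (4 * L * K)) <= tau by rewrite ler_piMr // ltW.
have h5 : L * (big - diff) <= L * (K * (tau * tau)) by rewrite ler_pM2l.
have E : L * (K * (tau * tau)) = tau * (tau * (4 * L * K)) / 4 by field.
by rewrite E mulrBr in h5; lra.
Qed.

Lemma near_ball (V : normedModType C) (h : C -> V) z b (r : R) : {for z, continuous h} ->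
  nrm (h z - b) < r -> \forall w \near z, nrm (h w - b) < r.
Proof.
move=> ch hr; have r0 : 0 < r - nrm (h z - b) by rewrite subr_gt0.
have [e e0 He] := (continuous_nrm h z).1 ch _ r0.
apply/nbhs_nrm; exists e => // w /He; have := nrm_tri (h z) (h w) b; lra.
Qed.

(** At an accumulation point [b] the two curves take the same value, and the
    identity theorem applies to their coordinates in a chart around it. *)
Lemma curve_identity (h1 h2 : C -> Y) (c : R) : 0 < c ->
  (forall z, nrm z < c -> holomorphic_at h1 z) -> (forall z, nrm z < c -> holomorphic_at h2 z) ->
  (forall t, 0 <= t -> t < c -> h1 (cR t) = h2 (cR t)) ->
  forall z, nrm z < c -> h1 z = h2 z.
Proof.
move=> c_0 H1 H2 Hr z zc; have {zc} : nrm (z - 0) < c by rewrite subr0.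
move: z; apply: (@spread R (fun z => h1 z = h2 z) 0 c) => [b|e e0]; last first.
  pose t := Num.min (e / 2) (c / 2).
  have t0 : 0 < t by rewrite lt_min !divr_gt0.
  have te : t <= e / 2 by rewrite ge_min lexx.
  have tc : t <= c / 2 by rewrite ge_min lexx orbT.
  exists (cR t); rewrite subr0 nrm_cR gtr0_norm //; split; last by apply: Hr; lra.
    by rewrite -nrm_gt0 nrm_cR normr_gt0 gt_eqF.
  by lra.
rewrite subr0 => bc0 acc.
have c1 := (H1 b bc0).1; have c2 := (H2 b bc0).1.
have Eb : h1 b = h2 b.
  apply: (d_eq dge0 deq0) => e e0; have e2 : 0 < e / 2 by rewrite divr_gt0.
  have n1 : \forall w \near b, d (h1 b) (h1 w) < e / 2 := c1 _ (dnear (h1 b) e2).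
  have n2 : \forall w \near b, d (h2 b) (h2 w) < e / 2 := c2 _ (dnear (h2 b) e2).
  have [s s0 Hs] := ball_near (filterI n1 n2).
  have [w [_ ws Ew]] := acc s s0; have [h3 h4] := Hs w ws.
  by have := dtri (h1 w) (h1 b) (h2 b); rewrite {2}Ew (dsym (h2 w)); lra.
have [ch ac cb] := atlas_cover (h1 b).
have cb2 : chart_dom ch (h2 b) by rewrite -Eb.
have n1 : \forall w \near b, chart_dom ch (h1 w) := c1 _ (near_dom cb).
have n2 : \forall w \near b, chart_dom ch (h2 w) := c2 _ (near_dom cb2).
have nb : \forall w \near b, nrm w < c.
  apply/nbhs_nrm; exists (c - nrm b); first by rewrite subr_gt0.
  by move=> w wb; have := nrm_leD w b; lra.
have co i : \forall w \near b, ch (h1 w) ord0 i - ch (h2 w) ord0 i = 0.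
  apply: (@zeros_near R (fun w => ch (h1 w) ord0 i - ch (h2 w) ord0 i)).
    apply: filterS3 n1 n2 nb => w d1 d2 wc.
    apply: (@differentiableB _ _ _ (fun w => ch (h1 w) ord0 i) (fun w => ch (h2 w) ord0 i)).
      exact: (@differentiable_comp_coord R C n (ch \o h1) w i ((H1 w wc).2 ch ac d1)).
    exact: (@differentiable_comp_coord R C n (ch \o h2) w i ((H2 w wc).2 ch ac d2)).
  by move=> s s0; have [w [wb ws Ew]] := acc s s0; exists w; rewrite Ew subrr.
have coA : \forall w \near b, forall i, ch (h1 w) ord0 i - ch (h2 w) ord0 i = 0.
  exact: (@filter_forall C _ (fun (i : 'I_n) (w : C) => ch (h1 w) ord0 i - ch (h2 w) ord0 i = 0) (nbhs b) (nbhs_filter b) co).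
apply: filterS3 n1 n2 coA => w d1 d2 E.
rewrite -(chart_mapK d1) -(chart_mapK d2); congr chart_inv.
by apply/rowP => i; apply/eqP; rewrite -subr_eq0 E.
Qed.

End CurveIdentity.

Section Flow.
Variable R : realType.
Local Notation C := (Cplx R).
Variables (n : nat) (Y : complexManifold R n) (Delta : orbifold Y).
Local Notation S := (orb_support Delta).
Variable d : Y -> Y -> R.
Hypotheses (dge0 : forall x y, 0 <= d x y) (dxx0 : forall x, d x x = 0).
Hypotheses (dsym : forall x y, d x y = d y x) (dtri : forall y x z, d x z <= d x y + d y z).
Hypothesis deq0 : forall x y, d x y = 0 -> x = y.
Hypothesis dnear : forall p (e : R), 0 < e -> \forall q \near p, d p q < e.
Hypothesis cY : compact [set: Y].
Variables (I : finType) (a : I -> nc_box Delta).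
Hypothesis cover : forall q, exists i, in_box (a i) (box_radius (a i)) q.
Variables (U : set_system nat).
Hypothesis UU : UltraFilter U.
Let UF : Filter U. Proof. exact: filter_filter. Qed.
Variable f : nat -> Y -> Y.
Hypothesis fhol : forall k, holomorphic_map (f k).
Hypothesis fiso : forall k x y, d (f k x) (f k y) = d x y.
Hypothesis fS : forall k x, S x -> S (f k x).
Hypothesis fmv : forall (e : R), 0 < e -> \forall k \near U, forall y, d (f k y) y <= e.
Variable eps : nat -> R.
Hypothesis eps0 : \forall k \near U, 0 < eps k.
Hypothesis epsF : \forall k \near U, forall i q, in_box (a i) (2 * box_radius (a i)) q ->
  chart_dom (box_chart (a i)) (f k q) /\ nrm (box_chart (a i) (f k q) - box_chart (a i) q) <= eps k.
Hypothesis epsto0 : forall e : R, 0 < e -> \forall k \near U, eps k < e.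
Variable rho : R.
Hypothesis rho0 : 0 < rho.
Hypothesis rho_le : forall i, rho <= box_radius (a i).

Definition flow_time := rho / 2 ^+ 9.
Lemma flow_time_gt0 : 0 < flow_time. Proof. exact: (divr_gt0 rho0 (exprn_gt0 9 (ltr0n R 2))). Qed.
Lemma flow_timeE : 512 * flow_time = rho.
Proof.
have n2 : (2 : R) ^+ 9 != 0 by rewrite expf_neq0 // pnatr_eq0.
have -> : (512 : R) = 2 ^+ 9 by ring.
by rewrite /flow_time mulrC (divfK n2).
Qed.

Definition steps k (t : R) : nat := Num.truncn (t / eps k).

Lemma stepsP k t : 0 < eps k -> 0 <= t -> (steps k t)%:R * eps k <= t < (steps k t).+1%:R * eps k.
Proof.
move=> e0 t0; have te : 0 <= t / eps k by rewrite divr_ge0 // ltW.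
have /andP[h1 h2] := truncn_itv te.
by rewrite -ler_pdivlMr // -ltr_pdivrMr // h1 h2.
Qed.

Lemma iter_iso k m x y : d (iter m (f k) x) (iter m (f k) y) = d x y.
Proof. by elim: m => //= m IH; rewrite fiso. Qed.

(** One application of [f k] takes the time [eps k]. *)
Definition flow (t : R) (y : Y) : Y :=
  sval (cid (dist_cvg_ex dsym dnear cY UU (fun k => iter (steps k t) (f k) y))).

Lemma flowP t y : dist_cvg d U (fun k => iter (steps k t) (f k) y) (flow t y).
Proof. exact: (svalP (cid (dist_cvg_ex dsym dnear cY UU (fun k => iter (steps k t) (f k) y)))). Qed.

Lemma flow_le t x y : d (flow t x) (flow t y) <= d x y.
Proof.
apply: (dist_cvg_le dsym dtri UU (flowP t x) (flowP t y)); apply: filterE => k.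
by rewrite iter_iso.
Qed.

Lemma flow0 y : flow 0 y = y.
Proof.
have H : dist_cvg d U (fun k => iter (steps k 0) (f k) y) y.
  move=> e e0; apply: filterE => k.
  by rewrite /steps mul0r truncn0 /= dxx0.
exact: (dist_cvg_unique dge0 dsym dtri deq0 UU (flowP 0 y) H).
Qed.

(** The numbers of steps add up to within one step, and a single step moves
    points by an amount that tends to [0]. *)
Lemma flowD s t y : 0 <= s -> 0 <= t -> flow t (flow s y) = flow (t + s) y.
Proof.
move=> s0 t0.
apply: (dist_cvg_unique dge0 dsym dtri deq0 UU (flowP t (flow s y))).
have H : dist_cvg d U (fun k => iter (steps k t) (f k) (iter (steps k s) (f k) y)) (flow t (flow s y)).
  apply: (dist_cvg_near dsym dtri UU (flowP t (flow s y))) => e e0.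
  by apply: filterS (flowP s y e0) => k /ltW h; rewrite iter_iso dsym.
have E : flow (t + s) y = flow t (flow s y); last by rewrite E; exact: flowP.
apply: (dist_cvg_unique dge0 dsym dtri deq0 UU (flowP (t + s) y)).
apply: (dist_cvg_near dsym dtri UU H) => e e0.
apply: filterS2 eps0 (fmv e0) => k ek fk; rewrite -iterD.
have ts : 0 <= t + s by rewrite addr_ge0.
have /andP[a1 a2] := stepsP ek s0; have /andP[b1 b2] := stepsP ek t0; have /andP[u1 u2] := stepsP ek ts.
have l1 : (steps k t + steps k s <= steps k (t + s))%N.
  rewrite -ltnS -(ltr_nat R) -(ltr_pM2r ek); apply: le_lt_trans u2.
  by rewrite natrD mulrDl lerD.
have l2 : (steps k (t + s) <= (steps k t + steps k s).+1)%N.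
  rewrite -ltnS -(ltr_nat R) -(ltr_pM2r ek); apply: (le_lt_trans u1).
  apply: (lt_le_trans (ltrD b2 a2)); rewrite -mulrDl ler_pM2r // -natrD ler_nat.
  by rewrite addSn addnS.
have [E|E] : steps k (t + s) = (steps k t + steps k s)%N \/ steps k (t + s) = (steps k t + steps k s).+1.
  by move: l1; rewrite leq_eqVlt => /orP[/eqP ->|h]; [left|right; apply/eqP; rewrite eqn_leq l2].
  by rewrite E dxx0 ltW.
rewrite E -[iter _.+1 _ _]/(f k (iter (steps k t + steps k s) (f k) y)) dsym; exact: fk.
Qed.

Lemma flow_support t y : closed S -> S y -> S (flow t y).
Proof.
move=> cS Sy; have cv := dist_cvg_cvg dge0 dsym dtri deq0 dnear cY UU (flowP t y).
have itS k m : S (iter m (f k) y) by elim: m => //= m; apply: fS.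
apply: contrapT => nS; have oS : open (~` S) by apply: closed_openC.
have H : \forall k \near U, ~ S (iter (steps k t) (f k) y) := cv _ (open_nbhs_nbhs (conj oS nS)).
by have [k Hk] := filter_ex H; apply: Hk; apply: itS.
Qed.

Definition box_map i k (x : 'rV[C]_n) := box_chart (a i) (f k (chart_inv (box_chart (a i)) x)).

Lemma box_map_holomorphic : \forall k \near U, forall i x, nrm (x - box_center (a i)) < 2 * box_radius (a i) ->
  differentiable (box_map i k) x /\ nrm (box_map i k x - x) <= eps k.
Proof.
apply: filterS epsF => k H i x xr.
have b0 := box_radius_gt0 (a i).
have x4 : nrm (x - box_center (a i)) < 4 * box_radius (a i) by lra.
have [dx ex _] := boxP x4.
have ib : in_box (a i) (2 * box_radius (a i)) (chart_inv (box_chart (a i)) x) by split; rewrite ?ex.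
have [d1 d2] := H i _ ib; rewrite ex in d2; split => //.
have := holomorphic_map_charts (fhol k) (box_holomorphic (a i)) (box_holomorphic (a i)) dx d1.
by rewrite ex.
Qed.

(** Before the time [rho] the iterates of a point of the box stay in the ball of
    twice the radius, where they can be computed in the chart. *)
Lemma iter_chart : \forall k \near U, forall i y m, in_box (a i) (box_radius (a i)) y ->
  m%:R * eps k < rho -> [/\ box_chart (a i) (iter m (f k) y) = iter m (box_map i k) (box_chart (a i) y),
     in_box (a i) (2 * box_radius (a i)) (iter m (f k) y) &
     nrm (iter m (box_map i k) (box_chart (a i) y) - box_chart (a i) y) <= m%:R * eps k].
Proof.
apply: filterS3 eps0 epsF box_map_holomorphic => k e0 H1 H2 i y m [dy yr].
have HF x : nrm (x - box_chart (a i) y) < rho -> differentiable (box_map i k) x /\ nrm (box_map i k x - x) <= eps k.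
  move=> xr; apply: H2; have := rho_le i; have := nrm_tri (box_chart (a i) y) x (box_center (a i)); lra.
elim: m => [|m IH] mr.
  split => //=; last by rewrite subrr nrm0 mul0r.
  by split => //; have := box_radius_gt0 (a i); lra.
have mr' : m%:R * eps k < rho.
  by apply: le_lt_trans mr; rewrite ler_pM2r // ler_nat.
have [E [dm im] cm] := IH mr'.
have [d1 _] := H1 i _ (conj dm im).
have Em : box_chart (a i) (iter m.+1 (f k) y) = iter m.+1 (box_map i k) (box_chart (a i) y).
  by rewrite /= -E /box_map chart_mapK.
have cl := iter_close e0 HF mr.
split => //; split => //; rewrite Em.
have := nrm_tri (box_chart (a i) y) (iter m.+1 (box_map i k) (box_chart (a i) y)) (box_center (a i)).
have := rho_le i; lra.
Qed.

Definition max_steps k := steps k flow_time.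
Definition newton_at i k (z : C) x := newton_sum (box_map i k) (eps k) (max_steps k) z x.

Lemma newton_at_ok : \forall k \near U, forall i z x, nrm z <= flow_time -> nrm (x - box_center (a i)) < box_radius (a i) ->
  nrm (newton_at i k z x - x) <= 16 * flow_time /\ (forall j, (j <= max_steps k)%N -> differentiable (fwd_diff (box_map i k) j) x).
Proof.
apply: filterS2 eps0 box_map_holomorphic => k e0 H i z x zc xr.
have HF w : nrm (w - x) < rho -> differentiable (box_map i k) w /\ nrm (box_map i k w - w) <= eps k.
  by move=> wr; apply: H; have := rho_le i; have := nrm_tri x w (box_center (a i)); lra.
have flow_time_gt0 := flow_time_gt0; have cr := flow_timeE.
have /andP[N1 _] := stepsP e0 (ltW flow_time_gt0).
split.
  apply: (newton_sum_bound rho0 e0 HF flow_time_gt0 N1 _ zc); lra.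
move=> j jN; apply: (fwd_diff_differentiable rho0 e0 HF).
apply: (@le_lt_trans _ _ flow_time); last by lra.
by apply: le_trans N1; rewrite ler_pM2r // ler_nat.
Qed.

Lemma limit_flow_ex i z x : exists l, nrm z <= flow_time -> nrm (x - box_center (a i)) < box_radius (a i) ->
  nrm (l - x) <= 16 * flow_time /\ nrm_cvg U (fun k => newton_at i k z x) l.
Proof.
have [zc|] := pselect (nrm z <= flow_time); last by move=> h; exists 0 => /h.
have [xr|] := pselect (nrm (x - box_center (a i)) < box_radius (a i)); last by move=> h; exists 0 => _ /h.
have [|l l1 l2] := @ultra_bounded_rV R _ U UU n (fun k => newton_at i k z x) x (16 * flow_time).
  by apply: filterS newton_at_ok => k /(_ i z x zc xr) [].
by exists l.
Qed.

Definition limit_flow i z x := sval (cid (limit_flow_ex i z x)).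

Lemma limit_flowP i z x : nrm z <= flow_time -> nrm (x - box_center (a i)) < box_radius (a i) ->
  nrm (limit_flow i z x - x) <= 16 * flow_time /\ nrm_cvg U (fun k => newton_at i k z x) (limit_flow i z x).
Proof. exact: (svalP (cid (limit_flow_ex i z x))). Qed.

(** A bounded limit of holomorphic functions.  The time and the starting point
    both depend on a complex parameter, as is needed to compose flows. *)
Lemma differentiable_limit_flow i (u : C -> C) (x : C -> 'rV[C]_n) z0 :
  (\forall z \near z0, differentiable u z) -> (\forall z \near z0, differentiable x z) ->
  nrm (u z0) < flow_time -> nrm (x z0 - box_center (a i)) < box_radius (a i) ->
  differentiable (fun z => limit_flow i (u z) (x z)) z0.
Proof.
move=> du dx uc xr.
have nu : \forall z \near z0, nrm (u z - 0) < flow_time.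
  by apply: near_ball; rewrite ?subr0 //; apply: differentiable_continuous; apply: nbhs_singleton du.
have nx : \forall z \near z0, nrm (x z - box_center (a i)) < box_radius (a i).
  by apply: near_ball => //; apply: differentiable_continuous; apply: nbhs_singleton dx.
have [s s0 Hs] := ball_near (filterI (filterI du dx) (filterI nu nx)).
apply: differentiable_rV => j.
pose M := nrm (box_center (a i)) + box_radius (a i) + 16 * flow_time.
apply: (@differentiable_limit R _ U UU (fun k z => newton_at i k (u z) (x z) ord0 j) _ z0 s M s0).
  apply: filterS newton_at_ok => k H z /Hs [[duz dxz] [uz xz]]; rewrite subr0 in uz.
  have [nz dz] := H i (u z) (x z) (ltW uz) xz.
  split.
    apply: (@differentiable_comp_coord R C n (fun z => newton_at i k (u z) (x z))).
    exact: differentiable_newton_sum.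
  apply: le_trans (nrm_coord _ _) _; rewrite /M.
  have h1 := nrm_leD (newton_at i k (u z) (x z)) (x z); have h2 := nrm_leD (x z) (box_center (a i)); lra.
move=> z /Hs [_ [uz xz]]; rewrite subr0 in uz.
have [_ cv] := limit_flowP (ltW uz) xz.
exact: (nrm_cvg_coord UU j cv).
Qed.

Definition box_flow i z y := chart_inv (box_chart (a i)) (limit_flow i z (box_chart (a i) y)).

Lemma box_flow_in_box i z y : nrm z < flow_time -> in_box (a i) (box_radius (a i)) y ->
  in_box (a i) (2 * box_radius (a i)) (box_flow i z y) /\ box_chart (a i) (box_flow i z y) = limit_flow i z (box_chart (a i) y).
Proof.
move=> zc [dy yr]; have [l1 _] := limit_flowP (ltW zc) yr.
have h : nrm (limit_flow i z (box_chart (a i) y) - box_center (a i)) < 2 * box_radius (a i).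
  have flow_time_gt0 := flow_time_gt0; have cr := flow_timeE; have := rho_le i.
  by have := nrm_tri (box_chart (a i) y) (limit_flow i z (box_chart (a i) y)) (box_center (a i)); lra.
have h4 : nrm (limit_flow i z (box_chart (a i) y) - box_center (a i)) < 4 * box_radius (a i) by have := box_radius_gt0 (a i); lra.
have [dl el _] := boxP h4.
by split => //; split => //; rewrite el.
Qed.

Lemma box_flow_holomorphic_at i (u : C -> C) (h : C -> Y) z0 :
  (\forall z \near z0, differentiable u z) -> (\forall z \near z0, holomorphic_at h z) ->
  nrm (u z0) < flow_time -> in_box (a i) (box_radius (a i)) (h z0) -> holomorphic_at (fun z => box_flow i (u z) (h z)) z0.
Proof.
move=> du hh uc ib.
have [[dG _] eG] := box_flow_in_box uc ib.
apply: (holomorphic_at_inv (x := fun z => limit_flow i (u z) (box_chart (a i) (h z))) (box_holomorphic (a i)) dG); first by rewrite eG.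
apply: (differentiable_limit_flow (x := fun z => box_chart (a i) (h z))) => //; last by case: ib.
have dh : \forall z \near z0, chart_dom (box_chart (a i)) (h z).
  exact: ((nbhs_singleton hh).1 _ (near_dom ib.1)).
apply: filterS2 hh dh => z hz dz.
exact: (holomorphic_at_chart hz (box_holomorphic (a i)) dz).
Qed.

(** At multiples of [eps k] the Newton sum is an iterate.  The Schwarz estimate
    in the time variable leads from the last multiple [s k] before [t] to [t]. *)
Lemma box_flow_real i y t : in_box (a i) (box_radius (a i)) y -> 0 <= t -> t < flow_time -> box_flow i (cR t) y = flow t y.
Proof.
move=> ib t0 tc; have [dy yr] := ib.
apply: (dist_cvg_unique dge0 dsym dtri deq0 UU _ (flowP t y)).
have tn : nrm (cR t : C) = t by rewrite nrm_cR ger0_norm.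
have tc' : nrm (cR t : C) < flow_time by rewrite tn.
have [l1 l2] := limit_flowP (ltW tc') yr.
have [[dG bG] eG] := box_flow_in_box tc' ib.
set x0 := box_chart (a i) y in l1 l2 eG *.
pose s k : R := (steps k t)%:R * eps k.
have l3 : nrm_cvg U (fun k => newton_at i k (cR (s k)) x0) (limit_flow i (cR t) x0).
  move=> e e0; have e2 : 0 < e / 2 by rewrite divr_gt0.
  pose r := flow_time - t; have r0 : 0 < r by rewrite subr_gt0.
  pose M := nrm x0 + 16 * flow_time.
  have M0 : 0 <= M by rewrite addr_ge0 ?nrm_ge0 // mulr_ge0 // ltW // flow_time_gt0.
  pose K := 16 * M / r + 1.
  have K0 : 0 < K by rewrite ltr_wpDl // divr_ge0 ?mulr_ge0 // ltW.
  have eK : 0 < Num.min r (e / 2 / K) by rewrite lt_min r0 !divr_gt0.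
  apply: filterS3 (filterI eps0 (epsto0 eK)) newton_at_ok (l2 _ e2) => k [e0k ek] H l2k.
  have /andP[s1 s2] := stepsP e0k t0.
  have st : `|s k - t| <= eps k.
    by rewrite distrC ger0_norm ?subr_ge0 //; move: s2; rewrite -natr1 mulrDl mul1r /s; lra.
  suff h : nrm (newton_at i k (cR (s k)) x0 - newton_at i k (cR t) x0) <= e / 2.
    rewrite [e]splitr; apply: (le_lt_trans (nrm_tri (newton_at i k (cR t) x0) _ _)).
    exact: ler_ltD h l2k.
  apply: nrm_rV_le => [|j]; first exact: ltW.
  pose P (z : C) := newton_at i k z x0 ord0 j.
  have HP : holo_le P (cR t) r M.
    move=> z zr.
    have zc : nrm z <= flow_time by have := nrm_leD z (cR t); rewrite tn; move: zr; rewrite /r; lra.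
    have [n1 n2] := H i z x0 zc yr.
    split.
      apply: (@differentiable_comp_coord R C n (fun z => newton_at i k z x0)).
      have dx0 : differentiable (fun _ : C => x0) z by exact: (differentiable_cst x0).
      exact: (@differentiable_newton_sum R n (box_map i k) (eps k) (max_steps k) id (fun=> x0) z (diff_id z) dx0 n2).
    apply: le_trans (nrm_coord _ _) _.
    by have := nrm_leD (newton_at i k z x0) x0; rewrite /M; lra.
  have dst : nrm (cR (s k) - cR t : C) = `|s k - t| by rewrite -cRB nrm_cR.
  have := @schwarz R P (cR t) r M (cR (s k)) r0 HP; rewrite dst.
  move: ek; rewrite lt_min => /andP[ek1 ek2] /(_ (le_lt_trans st ek1)).
  rewrite /P !mxE => /le_trans; apply.
  rewrite ltr_pdivlMr // /K in ek2.
  have h1 : 16 * M / r * `|s k - t| <= 16 * M / r * eps k.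
    by rewrite ler_wpM2l // divr_ge0 ?mulr_ge0 // ltW.
  by apply: (le_trans h1); move: ek2; rewrite mulrDr mulr1 mulrC => ek2; lra.
have xr4 : nrm (limit_flow i (cR t) x0 - box_center (a i)) < 4 * box_radius (a i).
  by rewrite -eG; have := box_radius_gt0 (a i); lra.
have cv := dist_cvg_inv dsym dnear UU l3 xr4.
move=> e e0; apply: filterS3 (filterI eps0 iter_chart) newton_at_ok (cv e e0) => k [e0k Hk] _.
have /andP[s1 s2] := stepsP e0k t0.
have mN : (steps k t <= max_steps k)%N.
  rewrite -ltnS -(ltr_nat R) -(ltr_pM2r e0k); apply: le_lt_trans s1 _.
  have /andP[_ N2] := stepsP e0k (ltW flow_time_gt0).
  exact: lt_trans tc N2.
have mr : (steps k t)%:R * eps k < rho by have flow_time_gt0 := flow_time_gt0; have := flow_timeE; lra.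
have [E [dk _] _] := Hk i y (steps k t) ib mr.
by rewrite /newton_at /s (newton_sum_iter _ e0k _ mN) -E chart_mapK.
Qed.

Definition box_of y : I := sval (cid (cover y)).
Lemma box_ofP y : in_box (a (box_of y)) (box_radius (a (box_of y))) y. Proof. exact: (svalP (cid (cover y))). Qed.
(** The flow at complex times, computed in one of the boxes around [y]. *)
Definition complex_flow z y := box_flow (box_of y) z y.

(** In any two boxes the flows agree at real times, hence at complex times. *)
Lemma complex_flow_box i z y : in_box (a i) (box_radius (a i)) y -> nrm z < flow_time -> complex_flow z y = box_flow i z y.
Proof.
move=> ib; have H j : in_box (a j) (box_radius (a j)) y -> forall z, nrm z < flow_time -> holomorphic_at (fun z => box_flow j z y) z.
  move=> jb w wc; apply: (@box_flow_holomorphic_at j id (fun=> y)) => //.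
    by apply: filterE => v; apply: diff_id.
  by apply: filterE => v; apply: holomorphic_at_cst.
apply: (curve_identity dge0 dsym dtri deq0 dnear flow_time_gt0 (H _ (box_ofP y)) (H _ ib)) => t t0 tc.
by rewrite !box_flow_real //; apply: box_ofP.
Qed.

Lemma complex_flow_real t y : 0 <= t -> t < flow_time -> complex_flow (cR t) y = flow t y.
Proof. by move=> t0 tc; apply: box_flow_real => //; apply: box_ofP. Qed.

Lemma complex_flow_holomorphic_at (u : C -> C) (h : C -> Y) z0 :
  (\forall z \near z0, differentiable u z) -> (\forall z \near z0, holomorphic_at h z) ->
  nrm (u z0) < flow_time -> holomorphic_at (fun z => complex_flow (u z) (h z)) z0.
Proof.
move=> du hh uc; set i := box_of (h z0).
apply: (@holomorphic_at_near R n Y (fun z => box_flow i (u z) (h z))); last first.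
  by apply: box_flow_holomorphic_at => //; apply: box_ofP.
have nu : \forall z \near z0, nrm (u z - 0) < flow_time.
  by apply: near_ball; rewrite ?subr0 //; apply: differentiable_continuous; apply: nbhs_singleton du.
have nh : \forall z \near z0, in_box (a i) (box_radius (a i)) (h z).
  exact: ((nbhs_singleton hh).1 _ (in_box_near (box_ofP (h z0)))).
by apply: filterS2 nu nh => z uz hz; rewrite (complex_flow_box hz) // -[u z]subr0.
Qed.

(** By analytic continuation from real times, in one of the times after the
    other. *)
Lemma complex_flowD z w y : nrm z < flow_time / 2 -> nrm w < flow_time / 2 -> complex_flow w (complex_flow z y) = complex_flow (z + w) y.
Proof.
have c2 : 0 < flow_time / 2 by rewrite divr_gt0 // flow_time_gt0.
have c01 := flow_time_gt0.
have near_id (v : C -> C) (z1 : C) : (forall z, differentiable v z) -> \forall z \near z1, differentiable v z.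
  by move=> H; apply: filterE => w0; exact: H.
have near_cst y1 (z1 : C) : \forall z \near z1, holomorphic_at (fun _ : C => y1 : Y) z.
  by apply: filterE => z'; apply: holomorphic_at_cst.
have shift (b z1 : C) : differentiable (fun z : C => b + z) z1.
  have -> : (fun z : C => b + z) = (fun z : C => b + 1 * z) by apply/funext => v; rewrite mul1r.
  exact: differentiable_affine.
have near_c2 (z1 : C) : nrm z1 < flow_time / 2 -> \forall z' \near z1, nrm z' < flow_time / 2.
  move=> z1c; apply/nbhs_nrm; exists (flow_time / 2 - nrm z1); first by rewrite subr_gt0.
  by move=> v vz; have := nrm_leD v z1; lra.
have real_step t : 0 <= t -> t < flow_time / 2 -> forall z, nrm z < flow_time / 2 -> complex_flow (cR t) (complex_flow z y) = complex_flow (cR t + z) y.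
  move=> t0 tc; have tn : nrm (cR t : C) = t by rewrite nrm_cR ger0_norm.
  apply: (curve_identity dge0 dsym dtri deq0 dnear c2) => [z' zc|z' zc|s s0 sc].
  - apply: (@complex_flow_holomorphic_at (fun=> cR t) (fun z => complex_flow z y)); [| |by rewrite tn; lra].
      by apply: near_id => v; apply: differentiable_cst.
    apply: filterS (near_c2 _ zc) => v vc.
    apply: (@complex_flow_holomorphic_at id (fun=> y)); [exact: (near_id id _ (@diff_id R C))|exact: near_cst|lra].
  - apply: (@complex_flow_holomorphic_at (fun z => cR t + z) (fun=> y)); [exact: near_id|exact: near_cst|].
    by have := nrmD (cR t) z'; rewrite tn; lra.
  - rewrite !complex_flow_real ?flowD // -?cRD ?complex_flow_real //; [exact: addr_ge0|lra|lra|lra].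
move=> zc; move: w; apply: (curve_identity dge0 dsym dtri deq0 dnear c2) => [w wc|w wc|s s0 sc].
- apply: (@complex_flow_holomorphic_at id (fun=> complex_flow z y)); [exact: (near_id id _ (@diff_id R C))|exact: near_cst|lra].
- apply: (@complex_flow_holomorphic_at (fun w => z + w) (fun=> y)); [exact: near_id|exact: near_cst|].
  by have := nrmD z w; lra.
- by rewrite real_step // addrC.
Qed.

(** Near a point [s] of the support, the support is the zero set of a product of
    coordinates.  Along the trajectory of [s] this product vanishes at positive real
    times, hence at all complex times; the time [- z] leads back to [y]. *)
Lemma complex_flow_support z y : closed S -> nrm z < flow_time / 2 -> S (complex_flow z y) -> S y.
Proof.
move=> cS zc; set s := complex_flow z y => Ss; have c01 := flow_time_gt0.
set i := box_of s; have ib := box_ofP s.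
have box w : nrm w < flow_time -> in_box (a i) (2 * box_radius (a i)) (complex_flow w s).
  by move=> wc; have [] := box_flow_in_box wc ib.
pose P w := \prod_(j in box_walls (a i)) box_chart (a i) (complex_flow w s) ord0 j.
have SP w : nrm w < flow_time -> S (complex_flow w s) <-> P w = 0.
  move=> wc; have [dw bw] := box w wc.
  have b4 : nrm (box_chart (a i) (complex_flow w s) - box_center (a i)) < 4 * box_radius (a i) by have := box_radius_gt0 (a i); lra.
  have [_ _] := boxP b4; rewrite chart_mapK // => ->.
  split=> [[j jJ j0]|/eqP]; first by rewrite /P (bigD1 j) //= j0 mul0r.
  by move=> /eqP /eqP; rewrite prodf_seq_eq0 => /hasP[j _ /andP[jJ /eqP j0]]; exists j.
have curve w : nrm w < flow_time -> holomorphic_at (fun w => complex_flow w s) w.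
  move=> wc; apply: (@complex_flow_holomorphic_at id (fun=> s)) => //.
    by apply: filterE => v; apply: diff_id.
  by apply: filterE => v; apply: holomorphic_at_cst.
have dP w : nrm (w - 0) < flow_time -> differentiable P w.
  rewrite subr0 => wc; have cw := curve w wc; have [dw _] := box w wc.
  have dc := holomorphic_at_chart cw (box_holomorphic (a i)) dw.
  pose co j v := box_chart (a i) (complex_flow v s) ord0 j.
  have dco j : differentiable (co j) w.
    exact: (@differentiable_comp_coord R C n (box_chart (a i) \o (fun v => complex_flow v s)) w j dc).
  have dl (l : seq 'I_n) : differentiable (fun v => \prod_(j <- l | j \in box_walls (a i)) co j v) w.
    elim: l => [|j l IH].
      have -> : (fun v => \prod_(j <- [::] | j \in box_walls (a i)) co j v) = (fun=> 1).
        by apply/funext => v; rewrite big_nil.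
      exact: (differentiable_cst (1 : C)).
    have [jJ|jJ] := boolP (j \in box_walls (a i)); last first.
      have -> // : (fun v => \prod_(j <- j :: l | j \in box_walls (a i)) co j v) =
        (fun v => \prod_(j <- l | j \in box_walls (a i)) co j v).
      by apply/funext => v; rewrite big_cons (negbTE jJ).
    have -> : (fun v => \prod_(j <- j :: l | j \in box_walls (a i)) co j v) =
      (fun v => co j v * \prod_(j <- l | j \in box_walls (a i)) co j v).
      by apply/funext => v; rewrite big_cons jJ.
    exact: differentiableM (dco j) IH.
  exact: dl.
have P0 w : nrm (w - 0) < flow_time -> P w = 0.
  apply: (@identity_disk R P 0 flow_time dP) => e e0.
  pose t := Num.min (e / 2) (flow_time / 2).
  have t0 : 0 < t by rewrite lt_min !divr_gt0.
  have te : t <= e / 2 by rewrite ge_min lexx.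
  have tc : t <= flow_time / 2 by rewrite ge_min lexx orbT.
  exists (cR t); rewrite subr0 nrm_cR gtr0_norm //; split.
  - by rewrite -nrm_gt0 nrm_cR normr_gt0 gt_eqF.
  - lra.
  - apply/SP; first by rewrite nrm_cR gtr0_norm //; lra.
    by rewrite complex_flow_real ?ltW //; [apply: flow_support|lra].
have : S (complex_flow (- z) s).
  by apply/SP; [rewrite nrmN; lra|apply: P0; rewrite subr0 nrmN; lra].
rewrite complex_flowD ?nrmN // subrr -[0]/(cR 0) complex_flow_real ?flow0 //.
Qed.

Hypothesis smooth : smooth_orbifold Delta.
Hypothesis Hk : kobayashi_pseudo_distance Delta d.
Hypothesis floor0 : orb_floor Delta = set0.
Hypothesis nontrivial : exists p q : Y, p <> q.

Lemma closedS : closed S. Proof. by case: smooth => -[]. Qed.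

Lemma time_lt (z : C) : nrm z < 1 -> nrm (cR (flow_time / 2) * z) < flow_time / 2.
Proof.
have c2 : 0 < flow_time / 2 by rewrite divr_gt0 // flow_time_gt0.
by move=> z1; rewrite nrmM nrm_cR gtr0_norm // gtr_pMr.
Qed.

(** On the unit disk the time runs over a disk of radius [N * flow_time / 2]. *)
Definition orbit N y (z : C) := iter N (complex_flow (cR (flow_time / 2) * z)) y.

Lemma orbit_holomorphic_at N y z : nrm z < 1 -> holomorphic_at (orbit N y) z.
Proof.
elim: N z => [|N IH] z z1; first exact: holomorphic_at_cst.
have c01 := flow_time_gt0.
apply: (@complex_flow_holomorphic_at (fun z => cR (flow_time / 2) * z) (orbit N y)).
- apply: filterE => w.
  have -> : (fun z : C => cR (flow_time / 2) * z) = (fun z : C => 0 + cR (flow_time / 2) * z).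
    by apply/funext => v; rewrite add0r.
  exact: differentiable_affine.
- apply/nbhs_nrm; exists (1 - nrm z); first by rewrite subr_gt0.
  by move=> w wz; apply: IH; have := nrm_leD w z; lra.
- by have := time_lt z1; lra.
Qed.

Lemma orbit_real N y s : 0 <= s < 1 -> orbit N y (cR s) = flow (N%:R * (flow_time / 2 * s)) y.
Proof.
have c2 : 0 < flow_time / 2 by rewrite divr_gt0 // flow_time_gt0.
move=> /andP[s0 s1]; have cs0 : 0 <= flow_time / 2 * s by rewrite mulr_ge0 // ltW.
have cs1 : flow_time / 2 * s < flow_time by have := ler_piMr (ltW c2) (ltW s1); lra.
elim: N => [|N IH]; first by rewrite mul0r flow0.
rewrite /orbit /= -/(orbit N y (cR s)) IH -cRM complex_flow_real // flowD //.
  by rewrite -[N.+1%:R]natr1 mulrDl mul1r addrC.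
exact: mulr_ge0.
Qed.

Lemma orbit_support N y z : nrm z < 1 -> S (orbit N y z) -> S y.
Proof. by move=> z1; elim: N => //= N IH; move/(complex_flow_support closedS (time_lt z1)). Qed.

(** Components of multiplicity at least two lie in the support, which is avoided;
    those of multiplicity one are dealt with by [disk_mult1]. *)
Lemma orbit_disk N y : ~ S y -> orbifold_disk Delta (orbit N y).
Proof.
move=> nS; have ud w : unit_disk w -> nrm w < 1 by rewrite /unit_disk /= nrmE lt_cR.
have ho : holomorphic_disk (orbit N y) by move=> z /ud zd; apply: orbit_holomorphic_at.
split=> //.
  have u0 : unit_disk (0 : C) by rewrite /unit_disk /= normr0.
  move=> sub; apply: nS; apply: (@orbit_support N y 0); first by rewrite nrm0.
  by apply: sub; exists 0.
move=> i z zd Dz; have [k Ek _] := multP floor0 i; rewrite Ek.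
have [->|k1] := eqVneq k 1%N.
  by apply: (disk_mult1 Hk floor0 nontrivial Dz); apply: disk_holomorphic_at.
case: nS; apply: (@orbit_support N y z); first exact: ud.
by exists i; split => //; rewrite Ek => -[] /eqP; apply/negP.
Qed.

(** An entire curve is constant in a hyperbolic space: the orbit reaches
    [flow t y] at the point [T / N] of the unit disk, which tends to [0]. *)
Lemma flow_off_support t y : ~ S y -> 0 <= t -> flow t y = y.
Proof.
move=> nS t0; have c2 : 0 < flow_time / 2 by rewrite divr_gt0 // flow_time_gt0.
apply/esym; apply: (d_eq dge0 deq0) => e e0.
(* large enough for [T / N <= 1 / 2] and [4 * (T / N) <= e] *)
pose N := (Num.truncn (t / (flow_time / 2) * (2 + 4 / e))).+1.
have e4 : 0 < 4 / e by rewrite divr_gt0.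
have N1 : t / (flow_time / 2) * (2 + 4 / e) < N%:R by apply: truncnS_gt.
have N0 : 0 < N%:R :> R by rewrite ltr0n.
set T := t / (flow_time / 2) in N1.
have T0 : 0 <= T by rewrite divr_ge0 // ltW.
have b0 : 0 <= T / N%:R by rewrite divr_ge0 // ltW.
have b2 : T / N%:R <= 2^-1.
  by rewrite ler_pdivrMr //; have := mulr_ge0 T0 (ltW e4); lra.
have be : 4 * (T / N%:R) <= e.
  rewrite mulrA ler_pdivrMr //.
  have h : e * (T * (2 + 4 / e)) = 2 * (e * T) + 4 * T by field; rewrite gt_eqF.
  have := mulr_ge0 (ltW e0) T0; move: N1; rewrite -(ltr_pM2l e0) h; lra.
have oN : orbit N y (cR (T / N%:R)) = flow t y.
  rewrite orbit_real; last by rewrite b0 /=; lra.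
  congr flow; rewrite /T; have n0 := lt0r_neq0 N0; have n2 := lt0r_neq0 c2.
  by rewrite mulrCA [N%:R * _]mulrC (divfK n0) mulrC (divfK n2).
have o0 : orbit N y 0 = y.
  by rewrite -[0]/(cR 0) orbit_real ?lexx ?ltr01 // !mulr0 flow0.
rewrite -{1}o0 -oN.
have b01 : 0 <= T / N%:R <= 2^-1 by rewrite b0.
apply: le_trans (le_trans (poincare0 b01) be).
apply: (d_disk Hk (orbit_disk N nS)); first by rewrite /unit_disk /= normr0.
by rewrite /unit_disk /= nrmE lt_cR nrm_cR ger0_norm //; lra.
Qed.

Lemma support_thin p (e : R) : 0 < e -> exists2 q, ~ S q & d p q < e.
Proof.
move=> e0; have [c [J [r [hc cp r0 cJ Hr]]]] := nc_chart smooth p.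
have [r' r'0 Hr'] := chart_ball cp (dnear p e0).
pose s := Num.min r r' / 2.
have m0 : 0 < Num.min r r' by rewrite lt_min r0.
have s0 : 0 < s by rewrite divr_gt0.
have sr : s < r by have : Num.min r r' <= r; [rewrite ge_min lexx|rewrite /s; lra].
have sr' : s < r' by have : Num.min r r' <= r'; [rewrite ge_min lexx orbT|rewrite /s; lra].
pose x := c p + const_mx (cR s).
have xs u : s < u -> nrm (x - c p) < u.
  move=> su; rewrite /x addrAC subrr add0r; apply: nrm_rV_lt => [|j].
    exact: lt_trans su.
  by rewrite mxE nrm_cR gtr0_norm.
have [_ _ px] := Hr' x (xs _ sr').
exists (chart_inv c x) => //; have [_ _ ->] := Hr x (xs _ sr).
move=> [j jJ]; rewrite !mxE cJ // add0r => /eqP.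
by rewrite -nrm_eq0 nrm_cR normr_eq0 gt_eqF.
Qed.

(** The complement of the support is dense and the flow is continuous. *)
Lemma flow_id t y : 0 <= t -> flow t y = y.
Proof.
move=> t0; apply: (d_eq dge0 deq0) => e e0; have e2 : 0 < e / 2 by rewrite divr_gt0.
have [q nS yq] := support_thin y e2.
have := flow_le t y q; rewrite (flow_off_support nS t0).
by have := dtri q (flow t y) y; rewrite (dsym q y); lra.
Qed.

Hypothesis epsS : \forall k \near U, exists i q, in_box (a i) (2 * box_radius (a i)) q /\
  eps k / 2 <= nrm (box_chart (a i) (f k q) - box_chart (a i) q).

(** The points that are moved by about [eps k] converge to some [l].  In a box
    around [l] their displacements are still comparable with [eps k], the change of
    charts being Lipschitz.  By [newton_first_order] the iterates over a small time
    [t] then add up to a drift comparable with [t], although [flow t] is the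
    identity. *)
Lemma flow_contradiction : False.
Proof.
have [i Hi] := ultra_fin (P := fun i k => exists q, in_box (a i) (2 * box_radius (a i)) q /\
  eps k / 2 <= nrm (box_chart (a i) (f k q) - box_chart (a i) q)) UU epsS.
have [y0 _] := nontrivial.
have /choice [q Hq'] k : exists q, (exists q, in_box (a i) (2 * box_radius (a i)) q /\
  eps k / 2 <= nrm (box_chart (a i) (f k q) - box_chart (a i) q)) -> in_box (a i) (2 * box_radius (a i)) q /\
  eps k / 2 <= nrm (box_chart (a i) (f k q) - box_chart (a i) q).
  have [[q hq]|nq] := pselect (exists q, in_box (a i) (2 * box_radius (a i)) q /\
    eps k / 2 <= nrm (box_chart (a i) (f k q) - box_chart (a i) q)); first by exists q.
  by exists y0 => /nq.
have Hq : \forall k \near U, in_box (a i) (2 * box_radius (a i)) (q k) /\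
    eps k / 2 <= nrm (box_chart (a i) (f k (q k)) - box_chart (a i) (q k)) by apply: filterS Hi.
have r4 : 2 * box_radius (a i) < 4 * box_radius (a i) by have := box_radius_gt0 (a i); lra.
have [|l [ql di _]] := box_limit dsym dnear UU (q := q) r4.
  by apply: filterS Hq => k [[h1 /ltW h2] _].
pose b := box_of l; have ib : in_box (a b) (box_radius (a b)) l := box_ofP l.
have db := ib.1.
pose x k := box_chart (a b) (q k).
have xl : nrm_cvg U x (box_chart (a b) l).
  exact: (dist_cvg_chart dge0 dsym dtri deq0 dnear cY UU ql db).
have qb : \forall k \near U, in_box (a b) (box_radius (a b)) (q k).
  exact: (dist_cvg_cvg dge0 dsym dtri deq0 dnear cY UU ql (in_box_near ib)).
have n1 : \forall w \near l, nrm (box_chart (a i) w - box_chart (a i) l) < 1.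
  exact: (near_chart (P := fun w => nrm (w - box_chart (a i) l) < 1) di (near_nrm _ ltr01)).
have [s s0 Hs] := chart_ball db (filterI (near_dom di) n1).
pose M := nrm (box_chart (a i) l) + 1.
have M0 : 0 < M by rewrite ltr_wpDl ?nrm_ge0.
pose T w := box_chart (a i) (chart_inv (box_chart (a b)) w).
have HT w : nrm (w - box_chart (a b) l) < s -> differentiable T w /\ nrm (T w) <= M.
  move=> /Hs [d1 e1 [d2 l2]]; split.
    by have := trans_holomorphic (box_holomorphic (a b)) (box_holomorphic (a i)) d1 d2; rewrite e1.
  by have := nrm_leD (box_chart (a i) (chart_inv (box_chart (a b)) w)) (box_chart (a i) l); rewrite /T /M; lra.
have s2 : 0 < s / 2 by rewrite divr_gt0.
pose L := 16 * M / (s / 2).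
have L0 : 0 < L by rewrite divr_gt0 // mulr_gt0.
pose K := 16 * 128 / rho.
have K0 : 0 < K := divr_gt0 (mulr_gt0 (ltr0n R 16) (ltr0n R 128)) rho0.
(* [K * tau ^ 2] is the error term of [newton_first_order] after a time [tau] *)
pose t := Num.min (flow_time / 2) (4 * L * K)^-1.
have LK0 : 0 < 4 * L * K by apply: mulr_gt0 K0; apply: mulr_gt0 L0.
have t0 : 0 < t by rewrite lt_min invr_gt0 LK0 andbT divr_gt0 // flow_time_gt0.
have tc : t <= flow_time / 2 by rewrite ge_min lexx.
have tK : t <= (4 * L * K)^-1 by rewrite ge_min lexx orbT.
have il : dist_cvg d U (fun k => iter (steps k t) (f k) (q k)) l.
  have pl := flowP t l; rewrite (flow_id l (ltW t0)) in pl.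
  apply: (dist_cvg_near dsym dtri UU pl) => e e0; apply: filterS (ql e e0) => k h.
  by rewrite iter_iso dsym ltW.
have il' := dist_cvg_chart dge0 dsym dtri deq0 dnear cY UU il db.
pose eta := t / (16 * L).
have eta0 : 0 < eta by rewrite divr_gt0 // mulr_gt0.
have t2 : 0 < t / 2 by rewrite divr_gt0.
have [k [[[[e0 Hk'] [HF' HE]] [[qbk [Hqk1 Hqk2]] [xlk ilk]]] [[es et] xk]]] := filter_ex
  (filterI (filterI (filterI (filterI eps0 iter_chart) (filterI box_map_holomorphic epsF))
    (filterI (filterI qb Hq) (filterI (xl eta eta0) (il' eta eta0))))
    (filterI (filterI (epsto0 s2) (epsto0 t2)) (xl _ s2))).
have /andP[m1 m2] := stepsP e0 (ltW t0).
set m := steps k t in m1 m2 ilk.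
have c0r := flow_timeE; have c01 := flow_time_gt0.
have [mr m256] := time_budget c01 tc m1; rewrite c0r in mr m256.
have [Em _ _] := Hk' b (q k) m qbk mr.
have q2 : in_box (a b) (2 * box_radius (a b)) (q k).
  by case: qbk => h1 h2; split => //; apply: lt_trans h2 _; rewrite ltr_pMl ?box_radius_gt0 // ltr1n.
have [df nf] := HE b (q k) q2.
have EF : box_map b k (x k) = box_chart (a b) (f k (q k)) by rewrite /box_map /x chart_mapK //; case: qbk.
have ET : T (box_map b k (x k)) = box_chart (a i) (f k (q k)) by rewrite EF /T chart_mapK.
have ETx : T (x k) = box_chart (a i) (q k) by rewrite /T /x chart_mapK //; case: qbk.
have nF : nrm (box_map b k (x k) - x k) <= eps k by rewrite EF.
have low : eps k / 2 <= L * nrm (box_map b k (x k) - x k).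
  apply: le_trans Hqk2 _; rewrite -ET -ETx.
  apply: schwarz_rV s2 _ (le_lt_trans nF es) => w wx; apply: HT.
  by apply: (nrm_shift wx xk); rewrite -splitr.
have HF w : nrm (w - x k) < rho -> differentiable (box_map b k) w /\ nrm (box_map b k w - w) <= eps k.
  move=> wr; apply: HF'; apply: (nrm_shift wr qbk.2).
  by rewrite mulrDl mul1r lerD2r.
have first := newton_first_order rho0 e0 HF m256.
rewrite -Em in first.
set tau := m%:R * eps k in m1 mr m256 first.
set v := m%:R *: _ in first.
set y := box_chart (a b) (iter m (f k) (q k)) in first.
have h1 : tau / 2 <= L * nrm v.
  rewrite /v nrmZ nrm_nat mulrCA /tau -mulrA.
  by apply: ler_wpM2l low; apply: ler0n.
have h2 : nrm v - nrm (y - x k) <= K * (tau * tau).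
  have -> : K * (tau * tau) = 16 * tau * (128 * tau / rho).
    by rewrite /K; field; rewrite gt_eqF.
  rewrite lerBlDl; apply: le_trans (nrm_leD v (y - x k)) _.
  by rewrite [nrm (v - _)]nrmBC lerD2l.
have tt : t / 2 < tau by rewrite -natr1 mulrDl mul1r in m2; apply: half_lt et.
have := drift_bound L0 K0 t0 m1 tt tK h1 h2.
have h3 : nrm (y - x k) < eta + eta.
  apply: (nrm_shift ilk _ (lexx _)).
  by rewrite nrmBC.
rewrite ltNge => /negP; apply.
have -> : t / 8 = L * (eta + eta) by rewrite /eta; field; rewrite gt_eqF.
by rewrite ler_pM2l // ltW.
Qed.

End Flow.

(** * Finiteness *)

Lemma single_point_maps (T : Type) : ~ (exists p q : T, p <> q) -> forall F : set (T -> T), finite_set F.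
Proof.
move=> one F; apply: (@sub_finite_set _ _ [set id]); last exact: finite_set1.
move=> f _; apply/funext => x; apply: contrapT => fx; apply: one.
by exists (f x), x.
Qed.

Section Main.
Variable R : realType.
Variables (n : nat) (Y : complexManifold R n) (Delta : orbifold Y).
Variable d : Y -> Y -> R.
Hypothesis smooth : smooth_orbifold Delta.
Hypothesis cY : compact [set: Y].
Hypothesis Hk : kobayashi_pseudo_distance Delta d.
Hypothesis Hd : distance_on (~` orb_floor Delta) d.
Hypothesis floor0 : orb_floor Delta = set0.
Hypothesis nontrivial : exists p q : Y, p <> q.

(** A sequence of symmetries converging to the identity would generate a flow. *)
Lemma symmetries_discrete : exists2 e : R, 0 < e &
  forall f g, orb_symmetry Delta f g -> (forall y, d (f y) y <= e) -> f = id.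
Proof.
apply: contrapT => nd.
have dge0 := d_ge0 Hk floor0; have dxx0 := dxx Hk floor0; have dsym := dC Hk floor0.
have dtri := d_tri Hk floor0; have deq0 := d_eq0 Hd floor0.
have dnear := d_near smooth Hk floor0 nontrivial.
have /choice [f Hf] (k : nat) : exists f, exists g,
    [/\ orb_symmetry Delta f g, forall y, d (f y) y <= (k.+1%:R)^-1 & f <> id].
  apply: contrapT => nf; apply: nd; exists (k.+1%:R)^-1; first by rewrite invr_gt0 ltr0n.
  move=> f g fg mv; apply: contrapT => fid; apply: nf; exists f, g; split => //.
have /choice [g Hg] := Hf.
have [U [UU Uge]] := ultra_nat.
have UF : Filter U by apply: filter_filter.
have fmv (e : R) : 0 < e -> \forall k \near U, forall y, d (f k y) y <= e.
  move=> e0; apply: filterS (Uge (Num.truncn e^-1)) => k ke y.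
  have [_ mv _] := Hg k; apply: le_trans (mv y) _.
  rewrite -[e]invrK lef_pV2 ?posrE ?invr_gt0 ?ltr0n //.
  by apply: ltW; apply: lt_le_trans (truncnS_gt _) _; rewrite ler_nat.
have fid k : f k <> id by case: (Hg k).
have [I [a cover]] := finite_boxes smooth cY.
have [eps [eps0 epsF epsto0 epsS]] := displacement_scale dge0 dsym dtri deq0 dnear cY cover UU fmv fid.
have [rho rho0 rho_le] := fin_min (fun i => box_radius_gt0 (a i)).
apply: (flow_contradiction dge0 dxx0 dsym dtri deq0 dnear cY cover UU _ _ _ fmv eps0 epsF
  epsto0 rho0 rho_le smooth Hk floor0 nontrivial epsS).
- by move=> k; have [[]] := Hg k.
- by move=> k x y; have [s _ _] := Hg k; apply: (symmetry_iso Hk floor0 nontrivial x y s).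
- by move=> k x Sx; have [s _ _] := Hg k; apply/(symmetry_support floor0 x s).
Qed.

Lemma symmetries_finite : finite_set [set f | exists g, orb_symmetry Delta f g].
Proof.
apply: contrapT => inf; have [e e0 He] := symmetries_discrete.
have [y0 _] := nontrivial.
have dsym := dC Hk floor0; have dtri := d_tri Hk floor0.
have dnear := d_near smooth Hk floor0 nontrivial.
have iso f g x y : orb_symmetry Delta f g -> d (f x) (f y) = d x y.
  exact: (symmetry_iso Hk floor0 nontrivial).
have can f g : orb_symmetry Delta f g -> cancel f g /\ cancel g f by move=> [_ _ fK gK _].
have comp f g f' g' : orb_symmetry Delta f g -> orb_symmetry Delta f' g' ->
    orb_symmetry Delta (f \o f') (g' \o g) by apply: (symmetry_comp floor0).
have [f [g [fg fid mv]]] := isometries_near_id dsym dtri dnear cY y0 iso can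
  (@symmetry_inv _ _ _ _) comp inf e0.
by apply: fid; apply: He fg mv.
Qed.

End Main.

Local Close Scope ring_scope.

Theorem theorem1p4 (R : realType) (n : nat) (Y : complexManifold R n)
    (Delta : orbifold Y)
    (Y_irreducible : irreducible_analytic [set: Y])
    (Delta_smooth : smooth_orbifold Delta)
    (Delta_compact : compact_orbifold Delta)
    (Delta_hyperbolic : hyperbolic_orbifold Delta) :
  finite_set (orbifold_aut Delta).
Proof.
have [nontrivial|/single_point_maps] := pselect (exists p q : Y, p <> q); last exact.
have [cY floor0] := Delta_compact; have [d Hk Hd] := Delta_hyperbolic.
apply: (sub_finite_set _ (symmetries_finite Delta_smooth cY Hk Hd floor0 nontrivial)).
by move=> f; apply: (aut_symmetry Hk floor0 nontrivial).
Qed.
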